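(* Let $N\ge1$ be an integer, $\alpha\in(0,1)$, $s\in(0,1)$, and $\beta\in(N,N+2s)$. Let $u_0\in L^1(\mathbb{R}^N)$ be non-negative and non-trivial, let $M=\int_{\mathbb{R}^N}u_0$, and assume that $u_0\in\mathcal{D}_\beta$, i.e. there exist $C,R>0$ such that $|x|^\beta|u_0(x)|\le C$ for all $|x|>R$. Let $u$ be the mild solution, with initial datum $u_0$, of $\partial_t^\alpha u+(-\Delta)^s u=0$ in $\mathbb{R}^N\times(0,\infty)$, and let $Z$ be the fundamental solution of the equation. Given $\nu>0$ and a function $h:(0,\infty)\to(0,\infty)$ such that $h(t)=o\big(t^{\frac{\alpha}{N+2s-\beta}}\big)$ as $t\to\infty$, then $$ u(x,t)=MZ(x,t)\big(1+o(1)\big)\quad\text{uniformly in }\nu t^{\frac{\alpha}{2s}}\le|x|\le h(t)\quad\text{as }t\to\infty, $$ that is, for every $\varepsilon>0$ there is $T>0$ such that $\left|\frac{u(x,t)}{MZ(x,t)}-1\right|\le\varepsilon$ for all $t\ge T$ and all $x$ with $\nu t^{\frac{\alpha}{2s}}\le|x|\le h(t)$.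
   Context: Here $\partial_t^\alpha$ is the Caputo derivative, $\partial_t^\alpha u(x,t)=\frac{1}{\Gamma(1-\alpha)}\,\partial_t\int_0^t\frac{u(x,\tau)-u(x,0)}{(t-\tau)^\alpha}\,d\tau$, and $(-\Delta)^s$ is the fractional Laplacian, with Fourier symbol $|k|^{2s}$. The fundamental solution $Z$ is the solution of the equation with a Dirac mass at the origin as initial datum; that is, for each $t>0$, $Z(\cdot,t)$ is the integrable function with $\int_{\mathbb{R}^N}e^{-ik\cdot x}Z(x,t)\,dx=E_\alpha(-|k|^{2s}t^\alpha)$, where $E_\alpha(z)=\sum_{j\ge0}\frac{z^j}{\Gamma(\alpha j+1)}$ is the Mittag-Leffler function. It has the self-similar form $Z(x,t)=t^{-\frac{\alpha N}{2s}}F(xt^{-\frac{\alpha}{2s}})$ with $F\in C^\infty(\mathbb{R}^N\setminus\{0\})$ positive and radially symmetric. The mild solution with initial datum $u_0$ is, by definition, $u(x,t)=\int_{\mathbb{R}^N}Z(x-y,t)u_0(y)\,dy$. *)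

(* Defs.v *)
From HB Require Import structures.
From mathcomp Require Import all_boot all_order all_algebra.
From mathcomp Require Import all_classical all_reals all_analysis.
From mathcomp Require Import complex.

Set Implicit Arguments.
Unset Strict Implicit.
Unset Printing Implicit Defensive.
Import Order.TTheory GRing.Theory Num.Theory.
Import numFieldNormedType.Exports.

Local Open Scope classical_set_scope.
Local Open Scope ring_scope.

(* MathComp-Analysis has no measurable structure on row vectors: equip 'rV[T]_n
   with the sigma-algebra generated by the coordinates (the Borel one if T is
   the real line), as the library does for n.-tuple T. *)
Definition measure_rV_display : measure_display -> measure_display.
Proof. exact. Qed.

Section measurable_rV.
Context {d} {T : sigmaRingType d}.
Variable n : nat.

Definition rV_coord (i : 'I_n) (v : 'rV[T]_n) : T := v ord0 i.

Let rV_set0 : g_sigma_preimage rV_coord set0.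
Proof. exact: sigma_algebra0. Qed.

Let rV_setC A : g_sigma_preimage rV_coord A -> g_sigma_preimage rV_coord (~` A).
Proof. exact: sigma_algebraC. Qed.

Let rV_bigcup (F : _^nat) : (forall i, g_sigma_preimage rV_coord (F i)) ->
  g_sigma_preimage rV_coord (\bigcup_i (F i)).
Proof. exact: sigma_algebra_bigcup. Qed.

HB.instance Definition _ := @isMeasurable.Build (measure_rV_display d)
  'rV[T]_n (g_sigma_preimage rV_coord) rV_set0 rV_setC rV_bigcup.

End measurable_rV.

Section measurable_fun_rV.
Context {d} {T : measurableType d}.

Lemma measurable_rV_coord n (i : 'I_n) :
  measurable_fun [set: 'rV[T]_n] (@rV_coord d T n i).
Proof.
move=> _ Y mY; rewrite setTI; apply: sub_sigma_algebra => /=.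
rewrite -bigcup_seq/=; exists i => /=; first by rewrite mem_index_enum.
by exists Y => //; rewrite setTI.
Qed.

Lemma measurable_fun_rVP d' (S : measurableType d') n (f : S -> 'rV[T]_n) :
  (forall i, measurable_fun [set: S] (fun x => f x ord0 i)) ->
  measurable_fun [set: S] f.
Proof.
move=> mf _ Y mY; rewrite setTI.
have H : <<s \big[setU/set0]_(i < n)
    preimage_set_system setT (@rV_coord d T n i) measurable >> `<=`
    [set A | measurable (f @^-1` A)].
  apply: smallest_sub.
    split => /=.
    - by rewrite preimage_set0; exact: measurable0.
    - by move=> A mA; rewrite setTD preimage_setC; exact: measurableC.
    - by move=> F mF; rewrite preimage_bigcup; exact: bigcupT_measurable.
  rewrite -bigcup_seq => A [i _ [B mB <-]] /=.
  by have := mf i measurableT B mB; rewrite !setTI.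
exact: H.
Qed.

End measurable_fun_rV.

(* Lebesgue measure on 'rV[R]_n, by recursion on n: the image of
   lebesgue_measure \x lebesgue_rV n under (x, v) |-> (x, v_0, .., v_(n-1)). *)
Section lebesgue_rV.
Variable R : realType.

Definition cons_rV n (p : measurableTypeR R * 'rV[R]_n) : 'rV[R]_n.+1 :=
  \row_i (if unlift ord0 i is Some j then p.2 ord0 j else p.1).

Definition uncons_rV n (v : 'rV[R]_n.+1) : measurableTypeR R * 'rV[R]_n :=
  (v ord0 ord0, \row_j v ord0 (lift ord0 j)).

Lemma cons_rV0 n p : @cons_rV n p ord0 ord0 = p.1.
Proof. by rewrite mxE unlift_none. Qed.

Lemma cons_rVS n p j : @cons_rV n p ord0 (lift ord0 j) = p.2 ord0 j.
Proof. by rewrite mxE liftK. Qed.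

Lemma cons_rVK n : cancel (@cons_rV n) (@uncons_rV n).
Proof.
move=> [x v]; rewrite /uncons_rV cons_rV0; congr pair.
by apply/rowP => j; rewrite mxE cons_rVS.
Qed.

Lemma measurable_cons_rV n : measurable_fun setT (@cons_rV n).
Proof.
apply: measurable_fun_rVP => i.
have [->|[j ->]] : i = ord0 \/ exists j, i = lift ord0 j.
  by case: (unliftP ord0 i) => [j ->|->]; [right; exists j|left].
  by under eq_fun do rewrite cons_rV0; exact: measurable_fst.
under eq_fun do rewrite cons_rVS.
exact: (measurableT_comp (measurable_rV_coord j) measurable_snd).
Qed.

Lemma measurable_uncons_rV n : measurable_fun setT (@uncons_rV n).
Proof.
apply/measurable_fun_pairP; split; first exact: (measurable_rV_coord ord0).
apply: measurable_fun_rVP => i; rewrite /comp/=.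
by under eq_fun do rewrite mxE; exact: (measurable_rV_coord (lift ord0 i)).
Qed.

Section step.
Variables (n : nat) (mu : {sigma_finite_measure set 'rV[R]_n -> \bar R}).

Definition lebesgue_cons : set 'rV[R]_n.+1 -> \bar R :=
  pushforward (lebesgue_measure \x mu)%E (@cons_rV n).

HB.instance Definition _ := Measure.copy lebesgue_cons
  (measure_function_pushforward__canonical__measure_function_Measure
    (lebesgue_measure \x mu)%E (@measurable_cons_rV n)).

Lemma lebesgue_consX (A : set R) (B : set 'rV[R]_n) :
  measurable A -> measurable B ->
  lebesgue_cons (@uncons_rV n @^-1` (A `*` B)) = (lebesgue_measure A * mu B)%E.
Proof.
move=> mA mB; rewrite /lebesgue_cons /pushforward -comp_preimage.
rewrite (_ : _ \o _ = id) ?preimage_id ?product_measure1E//.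
by apply/funext => p /=; rewrite cons_rVK.
Qed.

Lemma lebesgue_cons_sigma_finite : sigma_finite setT lebesgue_cons.
Proof.
have /sigma_finiteP[F [TF ndF Foo]] := sigma_finiteT (@lebesgue_measure R).
have /sigma_finiteP[G [TG ndG Goo]] := sigma_finiteT mu.
exists (fun k => @uncons_rV n @^-1` (F k `*` G k)).
  rewrite -preimage_bigcup (_ : \bigcup_k _ = setT) ?preimage_setT//.
  apply/seteqP; split => // -[x v] _.
  have [j _ Fx] : (\bigcup_k F k) x by rewrite -TF.
  have [k _ Gv] : (\bigcup_k G k) v by rewrite -TG.
  exists (maxn j k) => //; split.
  - by move: Fx; exact/subsetPset/ndF/leq_maxl.
  - by move: Gv; exact/subsetPset/ndG/leq_maxr.
move=> k; have [mF Fk] := Foo k; have [mG Gk] := Goo k; split.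
  rewrite -[X in measurable X]setTI; apply: measurable_uncons_rV => //.
  exact: measurableX.
by rewrite lebesgue_consX// lte_mul_pinfty// ge0_fin_numE.
Qed.

HB.instance Definition _ := @Measure_isSigmaFinite.Build _ _ _
  lebesgue_cons lebesgue_cons_sigma_finite.
End step.

Fixpoint lebesgue_rV n : {sigma_finite_measure set 'rV[R]_n -> \bar R} :=
  match n with
  | 0 => dirac (0 : 'rV[R]_0)
  | n.+1 => lebesgue_cons (lebesgue_rV n)
  end.

Lemma measurable_rV_box n (A : 'I_n -> set R) :
  (forall i, measurable (A i)) ->
  measurable [set v : 'rV[R]_n | forall i, A i (v ord0 i)].
Proof.
move=> mA; rewrite (_ : [set _ | _] =
    \big[setI/setT]_(i < n) (@rV_coord _ R n i @^-1` A i)).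
  apply: bigsetI_measurable => i _; rewrite -[X in measurable X]setTI.
  exact: measurable_rV_coord.
rewrite -bigcap_seq; apply/seteqP; split => v /= Av i; first by move=> _; exact: Av.
by apply: Av => /=; rewrite mem_index_enum.
Qed.

Lemma lebesgue_rV_box n (A : 'I_n -> set R) :
  (forall i, measurable (A i)) ->
  lebesgue_rV n [set v : 'rV[R]_n | forall i, A i (v ord0 i)] =
  (\prod_(i < n) lebesgue_measure (A i))%E.
Proof.
elim: n A => [|n IH] A mA.
  rewrite big_ord0 /= diracE mem_set//; first by move=> -[].
have mAS i : measurable (A (lift ord0 i)) by [].
have mbox := measurable_rV_box mAS.
rewrite big_ord_recl /= -(IH _ mAS) -(lebesgue_consX _ (mA ord0) mbox).
congr (lebesgue_cons _ _); apply/seteqP; split => v /=.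
  by move=> Av; split => //= i; rewrite mxE.
move=> [A0 AS] i; case: (unliftP ord0 i) => [j ->|->//].
by have := AS j; rewrite mxE.
Qed.

End lebesgue_rV.

Section euclidean.
Variable R : realType.

(* The norm `|x| of 'rV[R]_N is the sup norm, hence the definition of the
   Euclidean one. *)
Definition dotv N (x y : 'rV[R]_N) : R := \sum_(i < N) x ord0 i * y ord0 i.
Definition enorm N (x : 'rV[R]_N) : R := Num.sqrt (dotv x x).

Fixpoint Ck (V : normedModType R) k (A : set V) (f : V -> R) : Prop :=
  (forall x, A x -> {for x, continuous f}) /\
  if k is k'.+1 then
    forall v, (forall x, A x -> derivable f x v) /\ Ck k' A ('D_v f)
  else True.

(* Meant for an open set A. *)
Definition smooth_on (V : normedModType R) (A : set V) (f : V -> R) : Prop :=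
  forall k, Ck k A f.

End euclidean.

Section fractional_heat.
Variable R : realType.
Implicit Types (alpha s t z a : R).

Definition Gamma a : R :=
  \int[lebesgue_measure]_(x in `]0, +oo[) (x `^ (a - 1) * expR (- x)).

Definition mittag_leffler alpha z : R :=
  limn (series (fun j : nat => z ^+ j / Gamma (alpha * j%:R + 1))).

(* \int e^(- i k.x) f(x) dx, with e^(- i y) = cos y - i sin y *)
Definition fourier N (f : 'rV[R]_N -> R) (k : 'rV[R]_N) : R[i] :=
  Complex (\int[lebesgue_rV R N]_x (cos (dotv k x) * f x))
          (- \int[lebesgue_rV R N]_x (sin (dotv k x) * f x)).

(* An integrable function is determined by its Fourier transform only almost
   everywhere: [fs_profile] selects the representative.  The value Z 0 t is
   left free, as Z(., t) may blow up at the origin. *)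
Record fundamental_solution N alpha s (Z : 'rV[R]_N -> R -> R) : Prop := {
  fs_integrable : forall t, 0 < t ->
    (lebesgue_rV R N).-integrable setT (EFin \o Z ^~ t) ;
  fs_fourier : forall t k, 0 < t ->
    fourier (Z ^~ t) k =
    (mittag_leffler alpha (- (enorm k `^ (2 * s) * t `^ alpha)))%:C%C ;
  fs_profile : exists F : 'rV[R]_N -> R,
    [/\ smooth_on [set x | x != 0] F,
        forall x, x != 0 -> 0 < F x,
        forall x y, enorm x = enorm y -> F x = F y
      & forall x t, x != 0 -> 0 < t ->
        Z x t = t `^ (- (alpha * N%:R / (2 * s))) *
                F (t `^ (- (alpha / (2 * s))) *: x)]
}.

Definition mild_solution N (Z : 'rV[R]_N -> R -> R) (u0 : 'rV[R]_N -> R)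
    (x : 'rV[R]_N) t : R :=
  \int[lebesgue_rV R N]_y (Z (x - y) t * u0 y).

(* The class D_beta; u0 stands for an element of L^1, so the bound is required
   almost everywhere. *)
Definition decay_class N (beta : R) (u0 : 'rV[R]_N -> R) : Prop :=
  exists C r : R, [/\ 0 < C, 0 < r &
    {ae lebesgue_rV R N, forall x, r < enorm x -> enorm x `^ beta * `|u0 x| <= C}].

End fractional_heat.

(* Main.v *)
Require Import Defs.
From mathcomp Require Import all_boot all_order all_algebra.
From mathcomp Require Import all_classical all_reals all_analysis.
From mathcomp Require Import measurable_realfun ring lra.
Set Implicit Arguments.
Unset Strict Implicit.
Unset Printing Implicit Defensive.
Import Order.TTheory GRing.Theory Num.Theory.
Import numFieldNormedType.Exports.
Local Open Scope classical_set_scope.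
Local Open Scope ring_scope.

(** Let F = Z(., 1). Two facts about F give the theorem: F(x) is of the exact
    order |x|^(-N-2s) for large |x|, and F varies slowly, in the sense that
    |F(x - y) - F(x)| <= K d F(x) when |y| <= d |x| and |x| is bounded below.
    By self-similarity both hold for Z(., t) in the region
    |x| >= nu t^(alpha/2s), uniformly in t ([Z_asymp]).

    In the convolution u(x, t), the part |y| <= d |x| is M Z(x, t) up to a
    relative error K d and the tail of the mass of u0 beyond d |x|. In the
    part |y| > d |x| the decay of u0 gives u0(y) <= C (d |x|)^(-beta), and the
    integral of Z is 1; so this part is at most C (d |x|)^(-beta). Relatively
    to Z(x, t) >= c t^alpha |x|^(-N-2s) it is of order
    |x|^(N+2s-beta) / t^alpha, which tends to 0 uniformly in |x| <= h(t) by
    the growth condition on h.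

    The two facts about F are read off its Fourier transform
    phi(|k|^2), phi(l) = E_alpha(-l^s), without asymptotic expansions.

    - phi is completely monotone: it is a pointwise limit of nonnegative
      combinations of exponentials exp(-r l). For l |-> l^s this is
      subordination ([bern_powR]); for z |-> E_alpha(-z) it follows from
      Gauss's product formula for 1 / Gamma(alpha j + 1), every factor of
      which acts on the power series as an average of dilations of z
      ([cm_mittag_leffler]).

    - Hence the Fourier integral of phi(|k|^2), regularised by a Gaussian, is
      a limit of nonnegative combinations of Gaussians, and so is F by Fourier
      inversion. Therefore F(x) is a nonincreasing and convex function of
      |x|^2 ([inversion_radconv]).

    - Since 1 - phi(l) is of order l^s near 0, the mass of F at distance
      e^(1/2) and beyond is of order e^(-s) (Fourier duality with Gaussians).
      As F is radially nonincreasing, this forces F(x) to be of order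
      |x|^(-N-2s) ([decay_upper_bound] and [decay_lower_bound]).

    - A positive convex function of v = |x|^2 that grows by a bounded factor
      when v is halved varies slowly ([radconv_slow_variation]). *)

(** * Real-valued integrals *)

Section real_integration.
Context d (T : measurableType d) (R : realType).
Variable mu : {measure set T -> \bar R}.
Implicit Types (f g : T -> R) (D : set T).

Lemma Rle_integrable D f g : measurable D -> measurable_fun D f ->
  (forall x, D x -> `|f x| <= g x) -> mu.-integrable D (EFin \o g) ->
  mu.-integrable D (EFin \o f).
Proof.
move=> mD mf fg ig; apply: le_integrable ig => //; first exact/measurable_EFinP.
by move=> x Dx /=; rewrite lee_fin (le_trans (fg _ Dx))// ler_norm.
Qed.

Lemma Rdominated_cvg D (f_ : nat -> T -> R) f g : measurable D ->
  (forall n, measurable_fun D (f_ n)) ->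
  (forall x, D x -> f_ n x @[n --> \oo] --> f x) ->
  mu.-integrable D (EFin \o g) ->
  (forall n x, D x -> `|f_ n x| <= g x) ->
  mu.-integrable D (EFin \o f) /\
  \int[mu]_(x in D) f_ n x @[n --> \oo] --> \int[mu]_(x in D) f x.
Proof.
move=> mD mf ff ig fg.
have mlim : measurable_fun D f by apply: (measurable_fun_cvg mf).
have [|||||iF _ HF] := @dominated_convergence _ _ _ mu D mD
    (fun n => EFin \o f_ n) (EFin \o f) (EFin \o g).
- by move=> n; exact/measurable_EFinP.
- exact/measurable_EFinP.
- apply: aeW => x Dx; apply: cvg_EFin; last exact: ff.
  exact: nearW.
- exact: ig.
- by apply: aeW => x n Dx; rewrite /= lee_fin fg.
split => //.
have E : (\int[mu]_(x in D) (f x)%:E)%E = (\int[mu]_(x in D) f x)%:E.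
  by rewrite /Rintegral fineK//; exact: integrable_fin_num.
move: HF; rewrite /comp E; exact: fine_cvg.
Qed.

End real_integration.

(** * Completely monotone functions and subordination *)

Section cm.
Variable R : realType.
Implicit Types (f g b : R -> R) (r c l x z : R).

(** Closure of the decaying exponentials under nonnegative combinations and
    pointwise limits on [0, +oo[. This encodes bounded complete monotonicity
    in a form that comes with an induction principle: whatever holds for
    exponentials and is stable under sums, scaling and limits holds for all of
    them, without a representing measure. *)
Inductive cm : (R -> R) -> Prop :=
| cm_exp r : 0 <= r -> cm (fun l => expR (- (r * l)))
| cm_add f g : cm f -> cm g -> cm (fun l => f l + g l)
| cm_scale c f : 0 <= c -> cm f -> cm (fun l => c * f l)
| cm_lim (f_ : nat -> R -> R) f : (forall n, cm (f_ n)) ->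
    (forall l, 0 <= l -> f_ n l @[n --> \oo] --> f l) -> cm f.

Lemma cm_ext f g : cm f -> (forall l, 0 <= l -> f l = g l) -> cm g.
Proof.
move=> cf fg; apply: (@cm_lim (fun=> f)) => // l l0.
by rewrite -fg//; exact: cvg_cst.
Qed.

(** The value at 0 serves below as the uniform bound in dominated
    convergence. *)
Lemma cm_bounds f : cm f -> forall l, 0 <= l -> 0 <= f l <= f 0.
Proof.
elim=> {f} [r r0|f g _ IHf _ IHg|c f c0 _ IH|f_ f _ IH ff] l l0.
- by rewrite expR_ge0 mulr0 oppr0 expR0 expR_le1 oppr_le0 mulr_ge0.
- have /andP[? ?] := IHf _ l0; have /andP[? ?] := IHg _ l0.
  by rewrite addr_ge0//= lerD.
- have /andP[? ?] := IH _ l0; by rewrite mulr_ge0//= ler_wpM2l.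
- apply/andP; split.
    apply: (cvgr_to_ge (ff _ l0)).
    by apply: nearW => n; have /andP[] := IH n _ l0.
  apply: (ler_cvg_to (ff _ l0) (ff _ (lexx 0))).
  by apply: nearW => n; have /andP[] := IH n _ l0.
Qed.

Lemma cm_cst c : 0 <= c -> cm (fun=> c).
Proof.
move=> c0; apply: (@cm_ext (fun l => c * expR (- (0 * l)))).
  by apply: cm_scale => //; exact: cm_exp.
by move=> l _; rewrite mul0r oppr0 expR0 mulr1.
Qed.

Lemma cm_sum (f_ : nat -> R -> R) n : (forall i, cm (f_ i)) ->
  cm (fun l => \sum_(i < n) f_ i l).
Proof.
move=> cf; elim: n => [|n IH].
  by apply: (@cm_ext (fun=> 0)) => [|l _]; [exact: cm_cst|rewrite big_ord0].
apply: (@cm_ext (fun l => \sum_(i < n) f_ i l + f_ n l)); first exact: cm_add.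
by move=> l _; rewrite big_ord_recr.
Qed.

Lemma cm_mul f g : cm f -> cm g -> cm (fun l => f l * g l).
Proof.
move=> cf cg; elim: cf => {f} [r r0|f1 f2 _ IH1 _ IH2|c f c0 _ IH|f_ f _ IH ff].
- elim: cg => {g} [q q0|g1 g2 _ IH1 _ IH2|c g c0 _ IH|g_ g _ IH gg].
  + apply: (@cm_ext (fun l => expR (- ((r + q) * l)))).
      by apply: cm_exp; rewrite addr_ge0.
    by move=> l _; rewrite -expRD; congr expR; ring.
  + by apply: (cm_ext (cm_add IH1 IH2)) => l _; rewrite mulrDr.
  + by apply: (cm_ext (cm_scale c0 IH)) => l _; rewrite mulrCA.
  + by apply: (cm_lim IH) => l l0; apply: cvgMl_tmp; exact: gg.
- by apply: (cm_ext (cm_add IH1 IH2)) => l _; rewrite mulrDl.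
- by apply: (cm_ext (cm_scale c0 IH)) => l _; rewrite mulrA.
- by apply: (cm_lim IH) => l l0; apply: cvgMr_tmp; exact: ff.
Qed.

Lemma cm_X f n : cm f -> cm (fun l => f l ^+ n).
Proof.
move=> cf; elim: n => [|n IH].
  by apply: (@cm_ext (fun=> 1)) => [|l _]; [exact: cm_cst|rewrite expr0].
by apply: (cm_ext (cm_mul cf IH)) => l _; rewrite exprS.
Qed.

(** The power series of the exponential has nonnegative coefficients, and
    powers of [f] are completely monotone. *)
Lemma cm_expR f : cm f -> cm (fun l => expR (f l)).
Proof.
move=> cf.
apply: (@cm_lim (fun n l => \sum_(i < n) (i`!%:R)^-1 * f l ^+ i)).
  move=> n; apply: (@cm_sum (fun i l => (i`!%:R)^-1 * f l ^+ i)) => i.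
  by apply: cm_scale; [|exact: cm_X].
move=> l l0; have := @is_cvg_series_exp_coeff R (f l); rewrite seriesEord.
move=> /cvg_ex[/= e] H; rewrite /expR seriesEord (cvg_lim _ H)//.
move: H; apply: cvg_trans; apply: near_eq_cvg; apply: nearW => n /=.
by apply: eq_bigr => i _; rewrite exp_coeffE.
Qed.

Lemma cm_dilate f c : 0 <= c -> cm f -> cm (fun l => f (c * l)).
Proof.
move=> c0; elim=> {f} [r r0|f g _ IHf _ IHg|d f d0 _ IH|f_ f _ IH ff].
- apply: (@cm_ext (fun l => expR (- (r * c * l)))).
    by apply: cm_exp; rewrite mulr_ge0.
  by move=> l _; rewrite mulrA.
- exact: cm_add.
- exact: cm_scale.
- by apply: (cm_lim IH) => l l0; apply: ff; rewrite mulr_ge0.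
Qed.

(** Bernstein functions, in the form in which subordination uses them:
    composing an exponential exp(- tau x) with [b] gives a completely monotone
    function. *)
Definition bern b := (forall l, 0 <= l -> 0 <= b l) /\
  forall tau, 0 <= tau -> cm (fun l => expR (- (tau * b l))).

Lemma cm_comp_bern f b : cm f -> bern b -> cm (fun l => f (b l)).
Proof.
move=> cf [b0 cb].
elim: cf => {f} [r r0|f g _ IHf _ IHg|d f d0 _ IH|f_ f _ IH ff].
- exact: cb.
- exact: cm_add.
- exact: cm_scale.
- by apply: (cm_lim IH) => l l0; apply: ff; exact: b0.
Qed.

Lemma bern_add b g : bern b -> bern g -> bern (fun l => b l + g l).
Proof.
move=> [b0 cb] [g0 cg]; split=> [l l0|tau tau0].
  by rewrite addr_ge0 ?b0 ?g0.
apply: (cm_ext (cm_mul (cb _ tau0) (cg _ tau0))) => l _.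
by rewrite -expRD mulrDr opprD.
Qed.

Lemma bern_scale (a : R) b : 0 <= a -> bern b -> bern (fun l => a * b l).
Proof.
move=> a0 [b0 cb]; split=> [l l0|tau tau0]; first by rewrite mulr_ge0 ?b0.
by apply: (cm_ext (cb _ (mulr_ge0 tau0 a0))) => l _; rewrite mulrA.
Qed.

Lemma bern_lim (b_ : nat -> R -> R) b : (forall n, bern (b_ n)) ->
  (forall l, 0 <= l -> b_ n l @[n --> \oo] --> b l) -> bern b.
Proof.
move=> bb bl; split=> [l l0|tau tau0].
  apply: (cvgr_to_ge (bl _ l0)).
  by apply: nearW => n; have [+ _] := bb n; exact.
apply: (@cm_lim (fun n l => expR (- (tau * b_ n l)))).
  by move=> n; have [_] := bb n; exact.
move=> l l0; apply: continuous_cvg; first exact: continuous_expR.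
by apply: cvgN; apply: cvgMl_tmp; exact: bl.
Qed.

Lemma bern_sum (b_ : nat -> R -> R) n : (forall i, bern (b_ i)) ->
  bern (fun l => \sum_(i < n) b_ i l).
Proof.
move=> cf; elim: n => [|n IH].
  under eq_fun do rewrite big_ord0.
  by split=> // tau _; rewrite mulr0 oppr0 expR0; exact: cm_cst.
have [? ?] := bern_add IH (cf n).
by under eq_fun do rewrite big_ord_recr.
Qed.

(** exp(- tau (1 - exp(- r l))) = exp(- tau) exp(tau exp(- r l)), the
    exponential of a completely monotone function. *)
Lemma bern_onem_exp r : 0 <= r -> bern (fun l => 1 - expR (- (r * l))).
Proof.
move=> r0; split=> [l l0|tau tau0].
  by rewrite subr_ge0 expR_le1 oppr_le0 mulr_ge0.
apply: (@cm_ext (fun l => expR (- tau) * expR (tau * expR (- (r * l))))).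
  apply: cm_scale; first exact: expR_ge0.
  by apply: cm_expR; apply: cm_scale => //; exact: cm_exp.
by move=> l _; rewrite -expRD; congr expR; ring.
Qed.

End cm.

(** * Fractional powers *)

Section power.
Variables (R : realType) (s : R).
Hypothesis s01 : 0 < s < 1.

Let s0 : 0 < s. Proof. by case/andP: s01. Qed.

Section ratio.
Variable q : R.
Hypothesis q1 : 1 < q.

Let q0 : 0 < q. Proof. exact: lt_trans q1. Qed.

Let qD x y : q `^ (x + y) = q `^ x * q `^ y.
Proof. by rewrite powRD// (gt_eqF q0) implybT. Qed.

Let qr1 : q `^ 1 = q. Proof. by rewrite powRr1 ?(ltW q0). Qed.

(** The power l^s is a mixture of the functions 1 - exp(- r l) with a density
    proportional to r^(-1-s). Restricting r to the powers q^x, with x an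
    integer, keeps an exact scaling law: the series [gsum] of these terms is
    multiplied by q^s when l is multiplied by q ([gsum_scale]). So it agrees
    with a multiple of l^s on the powers of q, and by monotonicity everywhere
    up to a factor q^s; then q tends to 1. *)
Definition gterm (x l : R) : R := (1 - expR (- (q `^ x * l))) * q `^ (- (s * x)).

Definition gpart (n : nat) (l : R) : R :=
  \sum_(i < n) (gterm i%:R l + gterm (- i.+1%:R) l).

Lemma gterm_ge0 x l : 0 <= l -> 0 <= gterm x l.
Proof.
move=> l0; rewrite mulr_ge0 ?powR_ge0// subr_ge0 expR_le1 oppr_le0.
by rewrite mulr_ge0// powR_ge0.
Qed.

Lemma gterm_scale x l : gterm x (q * l) = q `^ s * gterm (x + 1) l.
Proof.
rewrite /gterm [RHS]mulrCA -qD mulrA qD qr1.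
by congr (_ * _ `^ _); ring.
Qed.

(** Geometric decay of the terms as x tends to +oo, and with the next lemma as
    x tends to -oo: convergence needs 0 < s and s < 1 respectively. *)
Lemma gterm_le_pos x l : gterm x l <= q `^ (- (s * x)).
Proof. by rewrite ler_piMl ?powR_ge0// gerBl expR_ge0. Qed.

Lemma gterm_le_neg x l : gterm x l <= l * q `^ ((1 - s) * x).
Proof.
apply: (@le_trans _ _ (q `^ x * l * q `^ (- (s * x)))).
  rewrite ler_wpM2r ?powR_ge0// lerBlDr -lerBlDl.
  by have := expR_ge1Dx (- (q `^ x * l)); lra.
rewrite mulrAC -qD mulrC.
by rewrite (_ : x + _ = (1 - s) * x)//; ring.
Qed.

Lemma gterm_homo x l1 l2 : l1 <= l2 -> gterm x l1 <= gterm x l2.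
Proof.
move=> l12; rewrite ler_wpM2r ?powR_ge0// lerD2l lerN2 ler_expR lerN2.
by rewrite ler_wpM2l// powR_ge0.
Qed.

Let rho1 := q `^ (- s).
Let rho2 := q `^ (- (1 - s)).

Let powR_lt1 (y : R) : 0 < y -> q `^ (- y) < 1.
Proof.
move=> y0; rewrite powRN invf_lt1 ?powR_gt0//.
rewrite /powR gt_eqF// expR_gt1 mulr_gt0//; exact: ln_gt0.
Qed.

Let rho1_bound : `|rho1| < 1.
Proof. by rewrite ger0_norm ?powR_ge0// powR_lt1. Qed.

Let rho2_bound : `|rho2| < 1.
Proof. by rewrite ger0_norm ?powR_ge0// powR_lt1//; case/andP: s01; lra. Qed.

Let gterm_ub1 (n : nat) l : gterm n%:R l <= rho1 ^+ n.
Proof.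
rewrite (le_trans (gterm_le_pos _ _))// -powR_mulrn ?powR_ge0// -powRrM.
by rewrite mulNr.
Qed.

Let gterm_ub2 (n : nat) l : 0 <= l -> gterm (- n%:R) l <= l * rho2 ^+ n.
Proof.
move=> l0; rewrite (le_trans (gterm_le_neg _ _))// ler_wpM2l//.
by rewrite -powR_mulrn ?powR_ge0// -powRrM mulrN mulNr.
Qed.

Lemma gpart_cvg l : 0 <= l -> cvgn (gpart ^~ l).
Proof.
move=> l0; rewrite /gpart.
suff : cvgn (series (fun i => gterm i%:R l + gterm (- i.+1%:R) l)).
  by rewrite seriesEord.
apply: (@series_le_cvg _ _ (geometric 1 rho1 + geometric l rho2)).
- by move=> n; rewrite addr_ge0 ?gterm_ge0.
- by move=> n /=; rewrite addr_ge0// /geometric/= mulr_ge0// exprn_ge0// powR_ge0.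
- move=> n; apply: (@le_trans _ _ (1 * rho1 ^+ n + l * rho2 ^+ n)); last exact: lexx.
  apply: lerD; first by rewrite mul1r gterm_ub1.
  apply: (le_trans (gterm_ub2 n.+1 l0)); apply: ler_wpM2l => //.
  rewrite exprS ler_piMl//; first by rewrite exprn_ge0// powR_ge0.
  by rewrite (le_trans (ler_norm _))// ltW.
- by apply: is_cvg_seriesD; exact: is_cvg_geometric_series.
Qed.

Definition gsum (l : R) : R := limn (gpart ^~ l).

Lemma gpart_cvg_to l : 0 <= l -> gpart n l @[n --> \oo] --> gsum l.
Proof. exact: gpart_cvg. Qed.

(** Multiplying l by q shifts the index by one, so that only the two end terms
    of the partial sum change. *)
Lemma gpart_scale n l : gpart n (q * l) =
  q `^ s * (gpart n l + gterm n%:R l - gterm (- n%:R) l).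
Proof.
rewrite /gpart; elim: n => [|n IH].
  by rewrite !big_ord0 oppr0 add0r subrr mulr0.
rewrite !big_ord_recr/= IH !gterm_scale -natr1.
rewrite (_ : - (n%:R + 1) + 1 = - n%:R); last ring.
ring.
Qed.

Lemma gsum_scale l : 0 <= l -> gsum (q * l) = q `^ s * gsum l.
Proof.
move=> l0; apply: (@cvg_unique _ _ (gpart n (q * l) @[n --> \oo])).
- exact: Rhausdorff.
- by apply: gpart_cvg_to; rewrite mulr_ge0// ltW.
rewrite (_ : (fun n => gpart n (q * l)) = fun n =>
  q `^ s * (gpart n l + gterm n%:R l - gterm (- n%:R) l)); last first.
  by apply/funext => n; exact: gpart_scale.
apply: cvgMl_tmp; rewrite -[X in _ --> X]addr0 -[X in _ --> X + 0]addr0 -{2}oppr0.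
apply: cvgB.
  apply: cvgD; first exact: gpart_cvg_to.
  apply: (@squeeze_cvgr _ _ _ _ (fun=> 0) (fun n => rho1 ^+ n)).
  - by apply: nearW => n; rewrite gterm_ge0//= gterm_ub1.
  - exact: cvg_cst.
  - exact: cvg_expr.
apply: (@squeeze_cvgr _ _ _ _ (fun=> 0) (fun n => l * rho2 ^+ n)).
- by apply: nearW => n; rewrite gterm_ge0//= gterm_ub2.
- exact: cvg_cst.
- by rewrite -[X in _ --> X](mulr0 l); apply: cvgMl_tmp; exact: cvg_expr.
Qed.

Lemma gpart_homo n l1 l2 : l1 <= l2 -> gpart n l1 <= gpart n l2.
Proof. by move=> l12; apply: ler_sum => i _; rewrite lerD ?gterm_homo. Qed.

Lemma gsum_homo l1 l2 : 0 <= l1 -> l1 <= l2 -> gsum l1 <= gsum l2.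
Proof.
move=> l10 l12; have l20 := le_trans l10 l12.
apply: (ler_cvg_to (gpart_cvg_to l10) (gpart_cvg_to l20)).
by apply: nearW => n; exact: gpart_homo.
Qed.

Lemma gsum0 : gsum 0 = 0.
Proof.
rewrite /gsum (_ : gpart ^~ 0 = fun=> 0) ?lim_cst//.
apply/funext => n; rewrite /gpart big1// => i _.
by rewrite /gterm !mulr0 oppr0 expR0 subrr !mul0r addr0.
Qed.

Lemma gsum1_gt0 : 0 < gsum 1.
Proof.
apply: (@lt_le_trans _ _ (gterm 0 1)).
  rewrite /gterm powRr0 mulr0 oppr0 powRr0 !mulr1 subr_gt0.
  by rewrite expR_lt1 oppr_lt0.
apply: (cvgr_to_ge (gpart_cvg_to ler01)).
exists 1%N => // -[//|n] _; rewrite /gpart big_ord_recl/= -addrA lerDl.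
rewrite addr_ge0 ?gterm_ge0// sumr_ge0// => i _.
by rewrite addr_ge0 ?gterm_ge0.
Qed.

Lemma gsum_intpow (m : int) : gsum (q `^ m%:~R) = q `^ (s * m%:~R) * gsum 1.
Proof.
have stepP (x : R) : gsum (q `^ x) = q `^ (s * x) * gsum 1 <->
    gsum (q `^ (x + 1)) = q `^ (s * (x + 1)) * gsum 1.
  have qs0 : q `^ s != 0 by rewrite gt_eqF// powR_gt0.
  rewrite qD qr1 (mulrC (q `^ x) q) gsum_scale ?powR_ge0// mulrDr mulr1 qD.
  rewrite (mulrC (q `^ (s * x))) -mulrA.
  by split => [->|H]; [ring|apply: (mulfI qs0); rewrite H; ring].
elim: m => [|n IH|n IH].
- by rewrite mulr0z mulr0 powRr0 mul1r.
- rewrite (_ : n.+1%:~R = (n%:~R + 1 : R)); last by rewrite intS intrD addrC.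
  by have [+ _] := stepP n%:~R; apply.
- have [_] := stepP (- n.+1%:Z)%:~R; apply.
  rewrite (_ : (- n.+1%:Z)%:~R + 1 = (- n%:Z)%:~R :> R); first exact: IH.
  by rewrite intS opprD intrD; ring.
Qed.

(** Squeeze l between two consecutive powers of q; s < 1 bounds q^s - 1 by
    q - 1. *)
Lemma gsum_powR l : 0 <= l ->
  `|gsum l / gsum 1 - l `^ s| <= l `^ s * (q - 1).
Proof.
rewrite le_eqVlt => /orP[/eqP <-|l0].
  by rewrite gsum0 powR0 ?gt_eqF// !mul0r subrr normr0.
pose m := Num.floor (ln l / ln q).
have lnq : 0 < ln q by exact: ln_gt0.
have lE : l = q `^ (ln l / ln q).
  by rewrite /powR gt_eqF// divfK ?gt_eqF// lnK.
have [m1 m2] : m%:~R <= ln l / ln q /\ ln l / ln q <= m%:~R + 1.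
  split; first exact: floor_le_tmp.
  by rewrite ltW//; have := floorD1_gt (ln l / ln q); rewrite intrD.
set c := q `^ (s * m%:~R).
have c0 : 0 <= c by exact: powR_ge0.
have ceq : q `^ (s * (m%:~R + 1)) = c * q `^ s.
  by rewrite mulrDr mulr1 qD.
have ls1 : c <= l `^ s.
  by rewrite lE -powRrM mulrC ler_powR ?(ltW q1)// ler_wpM2l// ltW.
have ls2 : l `^ s <= c * q `^ s.
  by rewrite lE -powRrM mulrC -ceq ler_powR ?(ltW q1)// ler_wpM2l// ltW.
have g1 := gsum1_gt0.
have gs1 : c <= gsum l / gsum 1.
  rewrite ler_pdivlMr// /c -gsum_intpow gsum_homo ?powR_ge0//.
  by rewrite [leRHS]lE ler_powR ?(ltW q1).
have gs2 : gsum l / gsum 1 <= c * q `^ s.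
  rewrite ler_pdivrMr// -ceq -(intrD _ m 1) -gsum_intpow gsum_homo ?(ltW l0)//.
  by rewrite [leLHS]lE ler_powR ?(ltW q1)// intrD.
have qs : q `^ s - 1 <= q - 1.
  rewrite lerD2r ler1_powR ?(ltW q1)//; case/andP: s01; lra.
apply: (@le_trans _ _ (c * (q `^ s - 1))).
  by rewrite ler_norml; apply/andP; split; lra.
apply: ler_pM => //; rewrite subr_ge0 -(powRr0 q) ler_powR ?(ltW q1)//.
exact: ltW.
Qed.

Lemma bern_gsum : bern (fun l => gsum l / gsum 1).
Proof.
have bt x : bern (gterm x).
  have := @bern_scale R (q `^ (- (s * x))) _ (powR_ge0 _ _)
    (@bern_onem_exp R (q `^ x) (powR_ge0 _ _)).
  by congr bern; apply/funext => l; rewrite mulrC.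
apply: (@bern_lim _ (fun n l => (gsum 1)^-1 * gpart n l)).
  move=> n; apply: bern_scale; first by rewrite invr_ge0 ltW// gsum1_gt0.
  apply: (@bern_sum _ (fun i l => gterm i%:R l + gterm (- i.+1%:R) l)) => i.
  by apply: bern_add; exact: bt.
move=> l l0; rewrite mulrC; apply: cvgMl_tmp; exact: gpart_cvg_to.
Qed.

End ratio.

Lemma bern_powR : bern (fun l => l `^ s).
Proof.
pose q (n : nat) := 1 + n.+1%:R^-1 : R.
have q1 n : 1 < q n by rewrite ltrDl invr_gt0.
apply: (@bern_lim _ (fun n l => gsum (q n) l / gsum (q n) 1)).
  by move=> n; exact: bern_gsum.
move=> l l0; apply/subr_cvg0/norm_cvg0P.
apply: (@squeeze_cvgr _ _ _ _ (fun=> 0) (fun n => l `^ s * (n.+1%:R)^-1)).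
- apply: nearW => n; rewrite normr_ge0/= (le_trans (gsum_powR (q1 n) l0))//.
  by rewrite (_ : q n - 1 = n.+1%:R^-1)// /q addrAC subrr add0r.
- exact: cvg_cst.
- by rewrite -[X in _ --> X](mulr0 (l `^ s)); apply: cvgMl_tmp; exact: cvg_harmonic.
Qed.

End power.

(** * Exponential generating series *)

Section tannery.
Variable R : realType.
Implicit Types (a M x : nat -> R).

Lemma cvgn_sum (f : nat -> nat -> R) (l : nat -> R) J :
  (forall i, f n i @[n --> \oo] --> l i) ->
  \sum_(i < J) f n i @[n --> \oo] --> \sum_(i < J) l i.
Proof.
move=> fl; elim: J => [|J IH].
  by rewrite big_ord0; under eq_fun do rewrite big_ord0; exact: cvg_cst.
by rewrite big_ord_recr/=; under eq_fun do rewrite big_ord_recr/=; exact: cvgD.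
Qed.

Lemma dominated_is_cvg x M : (forall j, `|x j| <= M j) -> cvgn (series M) ->
  cvgn (series x).
Proof.
move=> xM cM; apply: normed_cvg; apply: (series_le_cvg _ _ _ cM) => j /=.
- exact: normr_ge0.
- exact: le_trans (xM j).
- exact: xM.
Qed.

Lemma series_tail_le x M J : (forall j, `|x j| <= M j) -> cvgn (series M) ->
  `|limn (series x) - series x J| <= limn (series M) - series M J.
Proof.
move=> xM cM; have cx := dominated_is_cvg xM cM.
have H1 : `|series x n - series x J| @[n --> \oo] --> `|limn (series x) - series x J|.
  by apply: cvg_norm; apply: cvgB => //; exact: cvg_cst.
have H2 : series M n - series M J @[n --> \oo] --> limn (series M) - series M J.
  by apply: cvgB => //; exact: cvg_cst.
apply: (ler_cvg_to H1 H2); exists J => // n /= Jn.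
rewrite !sub_series_geq// (le_trans (ler_norm_sum _ _ _))//.
by apply: ler_sum => i _; exact: xM.
Qed.

(** Dominated convergence for series. The domination may start at any rank m
    of the sequence, since for the Mittag-Leffler series it holds for large n
    only. *)
Lemma tannery (a : nat -> nat -> R) (b M : nat -> R) (m : nat) :
  (forall n j, (m <= n)%N -> `|a n j| <= M j) -> cvgn (series M) ->
  (forall j, a n j @[n --> \oo] --> b j) ->
  limn (series (a n)) @[n --> \oo] --> limn (series b).
Proof.
move=> aM cM ab.
have bM j : `|b j| <= M j.
  apply: (cvgr_to_le (cvg_norm (ab j))).
  by exists m => // n /= mn; exact: aM.
apply/cvgrPdist_le => e e0.
have e3 : 0 < e / 3 by rewrite divr_gt0.
have cM' : series M n @[n --> \oo] --> limn (series M) by exact: cM.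
have /cvgrPdist_le/(_ _ e3)[J _ HJ] := cM'.
have {HJ} HJ : limn (series M) - series M J <= e / 3.
  by rewrite (le_trans (ler_norm _))// HJ/=.
have cvJ : series (a n) J @[n --> \oo] --> series b J.
  rewrite seriesEord/=; under eq_fun do rewrite seriesEord/=.
  exact: cvgn_sum.
have /cvgrPdist_le/(_ _ e3) near1 := cvJ.
near=> n.
have mn : (m <= n)%N by near: n; exists m.
have n1 := series_tail_le J (aM n ^~ mn) cM.
have n2 := series_tail_le J bM cM.
have n3 : `|series b J - series (a n) J| <= e / 3 by near: n; exact: near1.
rewrite (_ : limn _ - limn _ = (limn (series b) - series b J) +
  (series b J - series (a n) J) - (limn (series (a n)) - series (a n) J)); last ring.
rewrite (le_trans (ler_normB _ _))// (le_trans (lerD (ler_normD _ _) (lexx _)))//.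
rewrite (_ : e = e / 3 + e / 3 + e / 3); last by lra.
by rewrite !lerD// ?(le_trans n2)// ?(le_trans n1).
Unshelve. all: by end_near. Qed.

End tannery.

Section exponential_series.
Variable R : realType.
Implicit Types (c d : nat -> R) (z : R).

(** Exponential generating series at - z: when [c] is the moment sequence of a
    measure, this is the Laplace transform of the measure. *)
Definition egf c z : R := limn (series (fun j => (- z) ^+ j / j`!%:R * c j)).

Let egf_dom c z B : (forall j, `|c j| <= B) -> forall j,
  `|(- z) ^+ j / j`!%:R * c j| <= (B *: exp_coeff `|z|) j.
Proof.
move=> cB j; rewrite normrM [leRHS]mulrC ler_pM//.
by rewrite exp_coeffE/= normrM normfV normrX normrN mulrC [`|_%:R|]ger0_norm.
Qed.

Let cvg_dom B z : cvgn (series (B *: exp_coeff `|z|)).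
Proof. by apply: is_cvg_seriesZ; exact: is_cvg_series_exp_coeff. Qed.

Lemma egf_cvg c z B : (forall j, `|c j| <= B) ->
  cvgn (series (fun j => (- z) ^+ j / j`!%:R * c j)).
Proof. by move=> cB; apply: (dominated_is_cvg (egf_dom z cB)). Qed.

Lemma egf_lim (c_ : nat -> nat -> R) c z B : (forall n j, `|c_ n j| <= B) ->
  (forall j, c_ n j @[n --> \oo] --> c j) ->
  egf (c_ n) z @[n --> \oo] --> egf c z.
Proof.
move=> cB cc; apply: (@tannery _ _ _ _ 0%N (fun n j _ => egf_dom z (cB n) j)) => //.
by move=> j; apply: cvgMl_tmp; exact: cc.
Qed.

Lemma egfD c d z B B' : (forall j, `|c j| <= B) -> (forall j, `|d j| <= B') ->
  egf (fun j => c j + d j) z = egf c z + egf d z.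
Proof.
move=> cB dB; rewrite /egf -lim_seriesD; [|exact: egf_cvg cB|exact: egf_cvg dB].
by congr (limn (series _)); apply/funext => j; rewrite mulrDr.
Qed.

Lemma egfZ w c z B : (forall j, `|c j| <= B) ->
  egf (fun j => w * c j) z = w * egf c z.
Proof.
move=> cB; rewrite /egf -[RHS](lim_seriesZ _ (egf_cvg cB)).
by congr (limn (series _)); apply/funext => j /=; rewrite mulrCA.
Qed.

Lemma egf_dilate c x z : egf c (x * z) = egf (fun j => c j * x ^+ j) z.
Proof.
rewrite /egf; congr (limn (series _)); apply/funext => j.
by rewrite -mulrN exprMn; ring.
Qed.

Lemma egf_cst1 z : egf (fun=> 1) z = expR (- z).
Proof.
rewrite /egf /expR; congr (limn (series _)); apply/funext => j.
by rewrite mulr1 exp_coeffE mulrC.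
Qed.

Lemma onem_geom (x : R) n : 1 - x ^+ n = (1 - x) * \sum_(i < n) x ^+ i.
Proof. by rewrite -(opprB _ 1) subrX1 -mulNr opprB. Qed.

(** Multiplying the j-th coefficient by x^j dilates the variable by x
    ([egf_dilate]). The factor (1 - q^k) / (1 - q^(k+j)) is the sum over i of
    (1 - q^k) q^(k i) (q^i)^j, by the geometric series; so the new series is a
    convex combination of dilations of the old one. *)
Lemma cm_egf_beta_geom c (B : R) k (q : R) : (0 < k)%N -> 0 < q < 1 ->
  (forall j, `|c j| <= B) -> cm (egf c) ->
  cm (egf (fun j => c j * ((1 - q ^+ k) / (1 - q ^+ (k + j))))).
Proof.
move=> k0 /andP[q0 q1] cB cc.
have qX0 n : 0 <= q ^+ n by rewrite exprn_ge0// ltW.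
have qX1 n : q ^+ n <= 1 by rewrite exprn_ile1// ltW.
have qX n : (0 < n)%N -> q ^+ n < 1 by move=> n0; rewrite exprn_ilt1 ?(ltW q0)// -lt0n.
have qXX0 n m : 0 <= (q ^+ n) ^+ m by rewrite -exprM.
have qXX1 n m : (q ^+ n) ^+ m <= 1 by rewrite -exprM.
have B0 : 0 <= B by apply: le_trans (cB 0%N).
have cqB n j : `|c j * (q ^+ n) ^+ j| <= B.
  rewrite normrM -[leRHS]mulr1 ler_pM// -exprM ger0_norm//.
(* the first I terms of the geometric series *)
pose S I j := c j * ((1 - q ^+ k) * \sum_(i < I) (q ^+ (k + j)) ^+ i).
have SE I j : S I j = c j * ((1 - q ^+ k) / (1 - q ^+ (k + j)) * (1 - (q ^+ (k + j)) ^+ I)).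
  rewrite /S (onem_geom (q ^+ (k + j)) I); congr (_ * _).
  by rewrite mulrA divfK// subr_eq0 gt_eqF// qX// addn_gt0 k0.
have rat1 j : 0 <= (1 - q ^+ k) / (1 - q ^+ (k + j)) <= 1.
  have kj : 0 < 1 - q ^+ (k + j) by rewrite subr_gt0 qX// addn_gt0 k0.
  rewrite divr_ge0 ?(ltW kj) ?subr_ge0//= ler_pdivrMr// mul1r lerD2l lerN2.
  by rewrite exprD ler_piMr.
have SB I j : `|S I j| <= B.
  rewrite SE normrM -[leRHS]mulr1 ler_pM// ger0_norm.
    have /andP[h1 h2] := rat1 j.
    by rewrite -[leRHS]mulr1 ler_pM// ?subr_ge0 ?qXX1// gerBl qXX0.
  by have /andP[? ?] := rat1 j; rewrite mulr_ge0// subr_ge0 qXX1.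
have fE I z : egf (S I) z =
    \sum_(i < I) ((1 - q ^+ k) * q ^+ (k * i)) * egf c (q ^+ i * z).
  elim: I => [|I IH].
    rewrite big_ord0 /egf (_ : (fun j => _) = fun=> 0).
      rewrite (_ : series _ = fun=> 0) ?lim_cst//.
      by apply/funext => n; rewrite /series/= big1.
    by apply/funext => j; rewrite /S big_ord0 !mulr0.
  rewrite big_ord_recr/= -IH egf_dilate -(egfZ _ _ (cqB I)).
  rewrite -(@egfD _ _ _ B (`|(1 - q ^+ k) * q ^+ (k * I)| * B)).
  - congr egf; apply/funext => j; rewrite /S big_ord_recr/= !mulrDr; congr (_ + _).
    by rewrite -!exprM mulnDl exprD (mulnC j); ring.
  - exact: SB.
  - by move=> j; rewrite normrM ler_wpM2l.
apply: (@cm_lim _ (fun I => egf (S I))).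
  move=> I; rewrite (_ : egf _ = fun z =>
      \sum_(i < I) ((1 - q ^+ k) * q ^+ (k * i)) * egf c (q ^+ i * z)); last first.
    by apply/funext => z; rewrite fE.
  apply: (@cm_sum _ (fun i z => ((1 - q ^+ k) * q ^+ (k * i)) * egf c (q ^+ i * z))) => i.
  by apply: cm_scale; [rewrite mulr_ge0 ?subr_ge0|exact: cm_dilate].
move=> z _; apply: (@egf_lim S _ z B SB) => j.
under eq_fun do rewrite SE.
apply: cvgMl_tmp; rewrite -[X in _ --> X]mulr1; apply: cvgMl_tmp.
rewrite -[X in _ --> X]subr0; apply: cvgB; first exact: cvg_cst.
by apply: cvg_expr; rewrite ger0_norm// qX// addn_gt0 k0.
Qed.

(** k / (k + j) is the j-th moment of the probability density k y^(k-1) on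
    [0, 1]. The geometric laws of the previous lemma converge to it as q tends
    to 1, which avoids integrating over y. *)
Lemma cm_egf_beta c (B : R) k : (0 < k)%N ->
  (forall j, `|c j| <= B) -> cm (egf c) ->
  cm (egf (fun j => c j * (k%:R / (k%:R + j%:R)))).
Proof.
move=> k0 cB cc.
pose q (n : nat) : R := 1 - n.+2%:R^-1.
have q01 n : 0 < q n < 1.
  by rewrite subr_gt0 invf_lt1// ltr1n/= gtrBl invr_gt0.
have q1 : q n @[n --> \oo] --> (1 : R).
  rewrite /q -[X in _ --> X]subr0; apply: cvgB; first exact: cvg_cst.
  by have := @cvg_harmonic R; rewrite -cvg_shiftS; exact.
have B0 : 0 <= B by apply: le_trans (cB 0%N).
apply: (@cm_lim _ (fun n => egf (fun j => c j * ((1 - q n ^+ k) / (1 - q n ^+ (k + j)))))).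
  by move=> n; apply: (cm_egf_beta_geom k0 (q01 n) cB).
move=> z _; apply: (@egf_lim _ _ _ B).
  move=> n j; have /andP[q0 q11] := q01 n.
  have kj : 0 < 1 - q n ^+ (k + j).
    by rewrite subr_gt0 exprn_ilt1 ?(ltW q0)// addn_eq0 negb_and -lt0n k0.
  rewrite normrM -[leRHS]mulr1 ler_pM// ger0_norm.
    rewrite ler_pdivrMr// mul1r lerD2l lerN2.
    by rewrite exprD ler_piMr ?exprn_ge0 ?exprn_ile1 ?(ltW q0)// ltW.
  by rewrite divr_ge0 ?(ltW kj)// subr_ge0 exprn_ile1 ?(ltW q0)// ltW.
move=> j; apply: cvgMl_tmp.
have sumcvg m : \sum_(i < m) q n ^+ i @[n --> \oo] --> (m%:R : R).
  have -> : (m%:R : R) = \sum_(i < m) 1 by rewrite sumr_const card_ord.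
  apply: (@cvgn_sum _ (fun n i => q n ^+ i) (fun=> 1)) => i.
  rewrite -(expr1n _ i).
  exact: (cvg_comp _ _ q1 (@exprn_continuous R i 1)).
have rE n : (1 - q n ^+ k) / (1 - q n ^+ (k + j)) =
    (\sum_(i < k) q n ^+ i) / (\sum_(i < k + j) q n ^+ i).
  have /andP[q0 q11] := q01 n.
  have qn : 1 - q n != 0 by rewrite subr_eq0 gt_eqF.
  by rewrite !onem_geom -mulf_div divff ?mul1r.
under eq_fun do rewrite rE.
rewrite -natrD; apply: cvgM; first exact: sumcvg.
apply: cvgV; last exact: sumcvg.
by rewrite pnatr_eq0 addn_eq0 negb_and -lt0n k0.
Qed.

End exponential_series.

(** * Gauss's product formula for the Gamma function *)

Section gauss_product.
Variable R : realType.
Implicit Types (u : R) (n m j : nat).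

(** Gauss's product, which converges to Gamma (u + 1). *)
Definition gaussP n u : R :=
  n`!%:R * n%:R `^ u / \prod_(i < n) (i.+1%:R + u).

Lemma gaussP_den_gt0 n u : 0 <= u -> 0 < \prod_(i < n) (i.+1%:R + u).
Proof. by move=> u0; apply: prodr_gt0 => i _; rewrite ltr_pwDl. Qed.

Lemma gaussP_gt0 n u : (0 < n)%N -> 0 <= u -> 0 < gaussP n u.
Proof.
move=> n0 u0; rewrite divr_gt0 ?gaussP_den_gt0// mulr_gt0 ?ltr0n ?fact_gt0//.
by rewrite powR_gt0// ltr0n.
Qed.

Lemma gaussPS n u : (0 < n)%N -> 0 <= u ->
  gaussP n.+1 u = gaussP n u * ((1 + n%:R^-1) `^ u * (n.+1%:R / (n.+1%:R + u))).
Proof.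
move=> n0 u0; rewrite /gaussP big_ord_recr/= factS natrM.
have nE : n.+1%:R = n%:R * (1 + n%:R^-1) :> R.
  by rewrite mulrDr mulr1 divff ?natr1// pnatr_eq0 -lt0n.
rewrite [in X in _ * X `^ _]nE powRM ?addr_ge0//.
have ? : n.+1%:R + u != 0 by rewrite gt_eqF// ltr_pwDl.
have ? := lt0r_neq0 (gaussP_den_gt0 n u0).
field.
by rewrite nat1r; apply/andP.
Qed.

(** From exp(1 / (n+1)) <= 1 + 1 / n and exp(x) >= 1 + x. This makes Gauss's
    products nondecreasing in n, so that each of them is a lower bound for the
    Gamma function. *)
Lemma gaussP_ratio_ge1 n u : (0 < n)%N -> 0 <= u ->
  1 <= (1 + n%:R^-1) `^ u * (n.+1%:R / (n.+1%:R + u)).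
Proof.
move=> n0 u0; have n0R : 0 < n%:R :> R by rewrite ltr0n.
have n1R : n.+1%:R = n%:R + 1 :> R by rewrite -natr1.
rewrite mulrA ler_pdivlMr ?ltr_pwDl// mul1r.
have e1 : expR (n.+1%:R^-1) <= 1 + n%:R^-1 :> R.
  have x1 : 0 < 1 - n.+1%:R^-1 :> R by rewrite subr_gt0 invf_lt1// ltr1n.
  have -> : 1 + n%:R^-1 = (1 - n.+1%:R^-1)^-1 :> R.
    have nn : n%:R + 1 != 0 :> R by rewrite gt_eqF ?addr_gt0.
    by rewrite n1R; field; rewrite addrK (gt_eqF n0R) nn.
  rewrite -(ler_pM2r x1) mulVf ?gt_eqF//.
  apply: (le_trans (ler_wpM2l (expR_ge0 _) (expR_ge1Dx (- n.+1%:R^-1)))).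
  by rewrite -expRD subrr expR0.
apply: (@le_trans _ _ (expR (n.+1%:R^-1) `^ u * n.+1%:R)).
  rewrite -expRM; apply: (@le_trans _ _ ((1 + n.+1%:R^-1 * u) * n.+1%:R)).
    by rewrite mulrDl mul1r mulrAC mulVf ?mul1r.
  by rewrite ler_wpM2r// expR_ge1Dx.
by rewrite ler_wpM2r// ge0_ler_powR// nnegrE ?expR_ge0// addr_ge0// invr_ge0.
Qed.

Lemma gaussP_homo m n u : 0 <= u -> (0 < m <= n)%N -> gaussP m u <= gaussP n u.
Proof.
move=> u0 /andP[m0]; elim: n => [|n IH].
  by rewrite leqn0 => /eqP m00; rewrite m00 in m0.
rewrite leq_eqVlt => /orP[/eqP <-//|]; rewrite ltnS => mn.
have n0 : (0 < n)%N by exact: leq_trans mn.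
by rewrite gaussPS// (le_trans (IH mn))// ler_peMr ?gaussP_ratio_ge1// ltW// gaussP_gt0.
Qed.

Lemma gaussP_natS n j : (0 < n)%N ->
  gaussP n j.+1%:R = gaussP n j%:R * (j.+1%:R * (n%:R / (n%:R + j.+1%:R))).
Proof.
move=> n0; have n0R : 0 < n%:R :> R by rewrite ltr0n.
rewrite /gaussP -[in n%:R `^ _]natr1 powRD ?(gt_eqF n0R) ?implybT// powRr1 ?(ltW n0R)//.
have E : j.+1%:R * \prod_(i < n) (i.+1%:R + j.+1%:R) =
    (\prod_(i < n) (i.+1%:R + j%:R)) * (n%:R + j.+1%:R) :> R.
  elim: n {n0 n0R} => [|n IH]; first by rewrite !big_ord0 mul1r add0r mulr1.
  by rewrite !big_ord_recr/= mulrA IH -!natr1; ring.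
have d1 := gaussP_den_gt0 n (ler0n R j.+1).
have d2 := gaussP_den_gt0 n (ler0n R j).
apply: (mulIf (lt0r_neq0 d1)); rewrite divfK ?lt0r_neq0//.
rewrite !mulrA mulrAC.
have -> : n`!%:R * n%:R `^ j%:R / \prod_(i < n) (i.+1%:R + j%:R) *
  j.+1%:R * n%:R / (n%:R + j.+1%:R) * \prod_(i < n) (i.+1%:R + j.+1%:R) =
  n`!%:R * n%:R `^ j%:R / \prod_(i < n) (i.+1%:R + j%:R) * n%:R / (n%:R + j.+1%:R) *
  (j.+1%:R * \prod_(i < n) (i.+1%:R + j.+1%:R)) :> R by ring.
rewrite E; field; rewrite (gt_eqF d2)/= gt_eqF// addr_gt0//.
Qed.

Lemma gaussP0 n : gaussP n 0 = 1.
Proof.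
rewrite /gaussP powRr0 mulr1 (_ : \prod_(i < n) _ = n`!%:R) ?divff ?pnatr_eq0 -?lt0n ?fact_gt0//.
by rewrite fact_prod big_add1/= big_mkord natr_prod; apply: eq_bigr => i _; rewrite addr0.
Qed.

Lemma gaussP_nat_le n j : (0 < n)%N -> gaussP n j%:R <= j`!%:R.
Proof.
move=> n0; have n0R : 0 < n%:R :> R by rewrite ltr0n.
elim: j => [|j IH].
  by rewrite gaussP0.
rewrite gaussP_natS// factS natrM mulrC -mulrA ler_wpM2l//.
rewrite -[leRHS]mul1r ler_pM//.
- by rewrite ltW// gaussP_gt0.
- by rewrite ler_pdivrMr ?addr_gt0// mul1r lerDl.
Qed.

Lemma gaussP_nat_cvg j : gaussP n j%:R @[n --> \oo] --> (j`!%:R : R).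
Proof.
elim: j => [|j IH].
  by apply: cvg_near_cst; apply: nearW => n; exact: gaussP0.
rewrite factS natrM mulrC -(@cvg_shiftS _ (gaussP ^~ _)).
under eq_fun do rewrite /= gaussP_natS//.
apply: cvgM; first by rewrite (@cvg_shiftS _ (gaussP ^~ _)).
rewrite -[X in _ --> X]mulr1; apply: cvgMl_tmp.
have E n : n.+1%:R / (n.+1%:R + j.+1%:R) = (1 + j.+1%:R * n.+1%:R^-1)^-1 :> R.
  by apply: (can_inj invrK); rewrite invfM !invrK mulrDr mulVf// mulrC.
under eq_fun do rewrite E.
have : (1 + j.+1%:R * n.+1%:R^-1)^-1 @[n --> \oo] --> ((1 + 0)^-1 : R).
  apply: cvgV; first by rewrite addr0 oner_eq0.
  apply: cvgD; first exact: cvg_cst.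
  by rewrite -(mulr0 j.+1%:R); apply: cvgMl_tmp; exact: cvg_harmonic.
by rewrite addr0 invr1.
Qed.

(** A bound that is geometric in j when u = alpha j, with a ratio proportional
    to m^(- alpha): it is summable against z^j once m is large. *)
Lemma gaussP_inv_le m u j : (0 < m)%N -> 0 <= u -> u <= j%:R ->
  (gaussP m u)^-1 <= m%:R ^+ m * expR 1 ^+ j * m%:R `^ (- u).
Proof.
move=> m0 u0 uj; have m0R : 0 < m%:R :> R by rewrite ltr0n.
have prodE : \prod_(i < m) (i.+1%:R + u) = m`!%:R * \prod_(i < m) (1 + u / i.+1%:R) :> R.
  rewrite fact_prod big_add1/= big_mkord natr_prod -big_split/=; apply: eq_bigr => i _.
  by rewrite mulrDr mulr1 mulrCA divff// mulr1.
have mf0 : m`!%:R != 0 :> R by rewrite pnatr_eq0 -lt0n fact_gt0.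
have -> : (gaussP m u)^-1 = \prod_(i < m) (1 + u / i.+1%:R) * m%:R `^ (- u).
  by rewrite /gaussP invfM invrK prodE powRN invfM mulrACA mulVf// mul1r mulrC.
rewrite ler_wpM2r ?powR_ge0//.
(* each factor is at most m (1 + j / m), since m >= 1 and i >= 0 *)
have P1 (i : 'I_m) : 1 + u / i.+1%:R <= m%:R * expR (j%:R / m%:R).
  apply: (@le_trans _ _ (m%:R * (1 + j%:R / m%:R))); last first.
    by rewrite ler_wpM2l// expR_ge1Dx.
  rewrite mulrDr mulr1 mulrCA divff ?gt_eqF// mulr1 lerD//; first by rewrite ler1n.
  by rewrite (le_trans _ uj)// ler_pdivrMr// ler_peMr// ler1n.
apply: (@le_trans _ _ (\prod_(i < m) (m%:R * expR (j%:R / m%:R)))).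
  by apply: ler_prod => i _; rewrite P1 addr_ge0// divr_ge0.
rewrite prodr_const card_ord exprMn -!expRM_natl.
by rewrite mulrCA divff ?gt_eqF// !mulr1.
Qed.

End gauss_product.

Section gauss_limit.
Variable R : realType.
Notation mu := (@lebesgue_measure R).
Implicit Types (u a x : R) (n m : nat).

Lemma powR_LRcontinuous u a : 0 <= u -> 0 < a ->
  derivable_oo_LRcontinuous (@powR R ^~ u) 0 a.
Proof.
move=> u0 a0; split.
- move=> x; rewrite in_itv/= => /andP[x0 _].
  by apply: derivable_powR; rewrite in_itv/= x0.
- have [->|un0] := eqVneq u 0.
    by rewrite powRr0; under eq_fun do rewrite powRr0; exact: cvg_cst.
  by rewrite powR0//; apply: powR_cvg0; rewrite lt0r un0.
- have /derivable1_diffP/differentiable_continuous H : derivable (@powR R ^~ u) a 1.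
    by apply: derivable_powR; rewrite in_itv/= a0.
  exact: cvg_at_left_filter H.
Qed.

Lemma onem_div_is_derive m a x : a != 0 ->
  is_derive x 1 (fun y => (1 - y / a) ^+ m) (- (m%:R / a * (1 - x / a) ^+ m.-1)).
Proof.
move=> a0; pose f : R -> R := cst 1 - (a^-1 *: id).
have df : is_derive x 1 f (0 - a^-1 *: 1) by apply: is_deriveB.
have -> : (fun y => (1 - y / a) ^+ m) = f ^+ m.
  apply/funext => y; transitivity ((1 - a^-1 * y) ^+ m); first by rewrite mulrC.
  by rewrite exprfctE.
have := @is_deriveX _ _ _ m x 1 _ df; congr is_derive.
rewrite sub0r scalerN; congr (- _).
have -> : f x = 1 - x / a by rewrite mulrC.
by rewrite /GRing.scale/=; ring.
Qed.

Lemma onem_div_continuous m a : a != 0 -> continuous (fun y : R => (1 - y / a) ^+ m).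
Proof.
move=> a0 x.
by have [/derivable1_diffP/differentiable_continuous] := @onem_div_is_derive m a x a0.
Qed.

Lemma onem_div_LRcontinuous m a : 0 < a ->
  derivable_oo_LRcontinuous (fun y => (1 - y / a) ^+ m) 0 a.
Proof.
move=> a0; have d x := @onem_div_is_derive m a x (lt0r_neq0 a0).
have c := @onem_div_continuous m a (lt0r_neq0 a0).
split.
- by move=> x _; have [] := d x.
- exact: cvg_at_right_filter (c 0).
- exact: cvg_at_left_filter (c a).
Qed.

Lemma beta_integrable m a u : 0 < a -> 0 <= u ->
  mu.-integrable `[0, a] (EFin \o (fun x => (1 - x / a) ^+ m * x `^ u)).
Proof.
move=> a0 u0; apply: continuous_compact_integrable; first exact: segment_compact.
apply/subspace_continuousP => x abx; apply: cvgM.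
  have := continuous_subspaceT (@onem_div_continuous m a (lt0r_neq0 a0)) (A := `[0, a]).
  by move/subspace_continuousP; exact.
have := derivable_oo_LRcontinuous_within (powR_LRcontinuous u0 a0).
by move/subspace_continuousP; exact.
Qed.

(** Induction on m, integrating by parts. *)
Lemma beta_integral m : forall a u, 0 < a -> 0 <= u ->
  \int[mu]_(x in `[0, a]) ((1 - x / a) ^+ m * x `^ u) =
  a `^ (u + 1) * m`!%:R / \prod_(i < m.+1) (i.+1%:R + u).
Proof.
have powE (u : R) a : 0 <= u -> {in `]0, a[, (fun x : R => x `^ (u + 1) / (u + 1))^`()%classic =1 (@powR R ^~ u)}.
  move=> u0 x; rewrite in_itv/= => /andP[x0 _].
  rewrite derive1Mr; last by apply: derivable_powR; rewrite in_itv/= x0.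
  rewrite powR_derive1; last by rewrite in_itv/= x0.
  by rewrite addrK mulrAC divff ?mul1r// gt_eqF// ltr_wpDl.
have powLR (u : R) a : 0 <= u -> 0 < a ->
    derivable_oo_LRcontinuous (fun x => x `^ (u + 1) / (u + 1)) 0 a.
  move=> u0 a0; have [h1 h2 h3] := @powR_LRcontinuous (u + 1) a (addr_ge0 u0 ler01) a0.
  split; [|exact: cvgMr_tmp|exact: cvgMr_tmp].
  by move=> x xa; apply: derivableM; [exact: h1|exact: derivable_cst].
elim: m => [|m IH] a u a0 u0.
  rewrite big_ord1 mulr1 addrC.
  under eq_Rintegral do rewrite expr0 mul1r.
  rewrite /Rintegral (@continuous_FTC2 _ _ (fun x => x `^ (u + 1) / (u + 1)))//=.
  - by rewrite powR0 ?gt_eqF ?ltr_wpDl// mul0r subr0 addrC.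
  - exact: derivable_oo_LRcontinuous_within (powR_LRcontinuous u0 a0).
  - exact: powLR.
  - exact: powE.
have dF x := @onem_div_is_derive m.+1 a x (lt0r_neq0 a0).
rewrite (@Rintegration_by_parts _ _ (fun x => x `^ (u + 1) / (u + 1))
  (fun x => - (m.+1%:R / a * (1 - x / a) ^+ m)) _ _ _ a0).
- rewrite divff ?gt_eqF// subrr expr0n/= mul0r powR0 ?gt_eqF ?ltr_wpDl// mul0r.
  rewrite mul0r mulr0 subrr sub0r.
  pose c := m.+1%:R / a / (u + 1).
  pose k x := (1 - x / a) ^+ m * x `^ (u + 1).
  have ik : mu.-integrable `[0, a] (EFin \o k).
    by apply: beta_integrable => //; rewrite addr_ge0.
  have -> : \int[mu]_(x in `[0, a]) (- (m.+1%:R / a * (1 - x / a) ^+ m) * (x `^ (u + 1) / (u + 1))) =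
      \int[mu]_(x in `[0, a]) ((- c) * k x).
    by apply: eq_Rintegral => x _; rewrite /c /k; ring.
  rewrite RintegralZl//.
  rewrite /k IH ?addr_ge0// [in RHS]big_ord_recl/=.
  have prodE : \prod_(i < m.+1) (i.+1%:R + (u + 1)) = \prod_(i < m.+1) ((bump 0 i).+1%:R + u).
    by apply: eq_bigr => i _; rewrite /bump/= add1n -[in RHS]natr1; ring.
  rewrite prodE.
  rewrite powRD ?(gt_eqF a0) ?implybT// powRr1 ?(ltW a0)// /c factS natrM.
  have := @gaussP_den_gt0 R m.+1 (u + 1) (addr_ge0 u0 ler01).
  rewrite prodE.
  move=> p0; have u1 : u + 1 != 0 by rewrite gt_eqF// ltr_wpDl.
  field.
  by rewrite (gt_eqF p0) (gt_eqF a0) (addrC 1) u1.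
- apply: continuous_subspaceT => x; apply: cvgN; apply: cvgMl_tmp.
  exact: (@onem_div_continuous m a (lt0r_neq0 a0)).
- exact: onem_div_LRcontinuous.
- by move=> x _; rewrite derive1E; have [_ ->] := dF x.
- exact: derivable_oo_LRcontinuous_within (powR_LRcontinuous u0 a0).
- exact: powLR.
- exact: powE.
Qed.

Lemma bernoulli_le (t : R) n : 0 <= t <= 1 -> 1 - n%:R * t <= (1 - t) ^+ n.
Proof.
move=> /andP[t0 t1]; elim: n => [|n IH]; first by rewrite mul0r subr0 expr0.
have h : 0 <= n%:R * t by rewrite mulr_ge0.
rewrite exprS -natr1; apply: (@le_trans _ _ ((1 - t) * (1 - n%:R * t))); first by nra.
by rewrite ler_wpM2l// subr_ge0.
Qed.

Lemma onem_div_exp_le x n : 0 <= x <= n%:R -> (0 < n)%N ->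
  (1 - x / n%:R) ^+ n <= expR (- x).
Proof.
move=> /andP[x0 xn] n0; have n0R : 0 < n%:R :> R by rewrite ltr0n.
have -> : - x = n%:R * (- (x / n%:R)) by field; rewrite gt_eqF.
rewrite expRM_natl lerXn2r ?nnegrE ?expR_ge0 ?subr_ge0 ?ler_pdivrMr ?mul1r//.
exact: expR_ge1Dx.
Qed.

Lemma onem_div_exp_ge x n : 0 <= x <= n%:R -> (0 < n)%N ->
  expR (- x) * (1 - x ^+ 2 / n%:R) <= (1 - x / n%:R) ^+ n.
Proof.
move=> /andP[x0 xn] n0; have n0R : 0 < n%:R :> R by rewrite ltr0n.
rewrite expRN mulrC ler_pdivrMr ?expR_gt0//.
have xn1 : x / n%:R <= 1 by rewrite ler_pdivrMr// mul1r.
have xn0 : 0 <= x / n%:R by rewrite divr_ge0.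
have e : (1 + x / n%:R) ^+ n <= expR x.
  have -> : expR x = expR (n%:R * (x / n%:R)) by congr expR; field; rewrite gt_eqF.
  rewrite expRM_natl lerXn2r ?nnegrE ?expR_ge0 ?addr_ge0//.
  exact: expR_ge1Dx.
apply: (@le_trans _ _ ((1 - x / n%:R) ^+ n * (1 + x / n%:R) ^+ n)); last first.
  by rewrite ler_wpM2l// exprn_ge0// subr_ge0.
rewrite -exprMn -subr_sqr expr1n.
apply: le_trans (@bernoulli_le ((x / n%:R) ^+ 2) n _).
  by rewrite lerD2l lerN2 le_eqVlt; apply/orP; left; apply/eqP; field; rewrite gt_eqF.
by rewrite exprn_ge0//= exprn_ile1.
Qed.

Lemma integrable_powR_exp u : 0 <= u ->
  mu.-integrable `]0, +oo[ (EFin \o (fun x => x `^ u * expR (- x))).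
Proof.
move=> u0; (* dominate by the exponential density of rate 1/2 *)
pose k := (Num.truncn u).+1.
have uk : u <= k%:R by rewrite ltW// truncnS_gt.
pose C : R := (1 + k`!%:R * 2 ^+ k) * 2.
apply: (@Rle_integrable _ _ _ mu _ _ (fun x => C * exponential_pdf (2^-1) x)).
- exact: measurable_itv.
- apply: measurable_funTS; apply: measurable_funM; first exact: measurable_powR.
  by apply: measurableT_comp => //; exact: measurableT_comp.
- move=> x /=; rewrite in_itv/= andbT => x0.
  rewrite exponential_pdfE ?(ltW x0)// ger0_norm ?mulr_ge0 ?powR_ge0 ?expR_ge0//.
  have -> : C * (2^-1 * expR (- 2^-1 * x)) = (1 + k`!%:R * 2 ^+ k) * expR (- 2^-1 * x).
    by rewrite /C; field.
  have -> : expR (- x) = expR (- 2^-1 * x) * expR (- 2^-1 * x).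
    by rewrite -expRD; congr expR; field.
  rewrite mulrA ler_wpM2r ?expR_ge0//.
  rewrite mulNr expRN ler_pdivrMr ?expR_gt0//.
  apply: (@le_trans _ _ (1 + x ^+ k)).
    have [x1|x1] := leP x 1.
      rewrite (@le_trans _ _ 1) ?lerDl ?exprn_ge0 ?(ltW x0)//.
      rewrite -(powRr0 x) ger_powR// x0//.
    rewrite -powR_mulrn ?(ltW x0)// (le_trans (ler_powR (ltW x1) uk))//.
    by rewrite lerDr.
  have h1 : 1 <= expR (2^-1 * x).
    by rewrite -expR0 ler_expR mulr_ge0 ?(ltW x0)// invr_ge0.
  have h2 : x ^+ k <= k`!%:R * 2 ^+ k * expR (2^-1 * x).
    have := @expR_ge1Dxn _ (2^-1 * x) k.-1.
    rewrite mulr_ge0 ?invr_ge0 ?(ltW x0)// => /(_ isT).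
    rewrite exprMn exprVn.
    have kf : 0 < k`!%:R :> R by rewrite ltr0n fact_gt0.
    have k2 : 0 < 2 ^+ k :> R by rewrite exprn_gt0.
    move=> h; rewrite -ler_pdivrMl ?mulr_gt0//.
    rewrite invfM -mulrA (mulrC (k`!%:R^-1)); apply: le_trans h.
    by rewrite lerDr.
  by rewrite mulrDl mul1r lerD.
- have r0 : 0 < 2^-1 :> R by rewrite invr_gt0.
  have /(integrableZl measurableT C) := integrable_exponential_pdf r0.
  by apply: integrableS => //; exact: measurable_itv.
Qed.

(** Up to a factor that tends to 1, Gauss's product is the integral over [0, n]
    of (1 - x / n)^n x^u ([beta_integral]). The integrand converges to
    exp(- x) x^u and is dominated by it. *)
Lemma Gamma_gauss u : 0 <= u -> gaussP n u @[n --> \oo] --> Gamma (u + 1).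
Proof.
move=> u0.
pose f n x := ((1 - x / n.+1%:R) ^+ n.+1 * x `^ u) * \1_(`[0, n.+1%:R]) x.
have mf n : measurable_fun [set: R] (fun x => (1 - x / n.+1%:R) ^+ n.+1 * x `^ u).
  apply: measurable_funM; last exact: measurable_powR.
  apply: continuous_measurable_fun; exact: onem_div_continuous.
have fE n : \int[mu]_(x in `]0, +oo[) f n x =
    gaussP n.+1 u * (n.+1%:R / (n.+2%:R + u)).
  transitivity (\int[mu]_(x in `[0, n.+1%:R]) ((1 - x / n.+1%:R) ^+ n.+1 * x `^ u)).
    rewrite -[in RHS]Rintegral_itv_obnd_cbnd//; last first.
      apply: integrableS (beta_integrable n.+1 _ u0) => //; apply: subset_itvr.
      by rewrite bnd_simp.
    rewrite [LHS]Rintegral_mkcond [RHS]Rintegral_mkcond.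
    apply: eq_Rintegral => x _; rewrite !patchE /f indicE.
    rewrite !mem_setE/= !in_itv/= andbT.
    case: (ltP 0 x) => x0 //=; rewrite (ltW x0)/=.
    by case: (x <= _); rewrite ?mulr1 ?mulr0.
  rewrite beta_integral// /gaussP big_ord_recr/=.
  have n1 : 0 < n.+1%:R :> R by [].
  rewrite powRD ?(gt_eqF n1) ?implybT// powRr1//.
  have ? := lt0r_neq0 (gaussP_den_gt0 n.+1 u0).
  have ? : n.+2%:R + u != 0 by rewrite gt_eqF// ltr_pwDl.
  field.
  by rewrite -natrD; apply/andP.
have [] := @Rdominated_cvg _ _ _ mu `]0, +oo[ f (fun x => x `^ u * expR (- x))
  (fun x => x `^ u * expR (- x)).
- exact: measurable_itv.
- move=> n; apply: measurable_funTS; apply: measurable_funM => //.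
  exact: mf.
- move=> x /=; rewrite in_itv/= andbT => x0.
  have ev : \forall n \near \oo, x <= n.+1%:R.
    near=> n; rewrite ltW//; near: n.
    exists (Num.truncn x) => // n /= nx.
    by rewrite (lt_le_trans (truncnS_gt x))// ler_nat ltnS.
  apply: (@squeeze_cvgr _ _ _ _ (fun n => x `^ u * (expR (- x) * (1 - x ^+ 2 / n.+1%:R)))
    (fun=> x `^ u * expR (- x))).
  + near=> n; have xn : x <= n.+1%:R by near: n.
    rewrite /f indicE mem_set/= ?mulr1; last by rewrite in_itv/= (ltW x0).
    rewrite [X in _ <= X <= _]mulrC !ler_wpM2l ?powR_ge0//.
      by rewrite onem_div_exp_le// (ltW x0).
    by rewrite onem_div_exp_ge// (ltW x0).
  + apply: cvgMl_tmp; rewrite -[X in _ --> X]mulr1; apply: cvgMl_tmp.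
    rewrite -[X in _ --> X]subr0; apply: cvgB; first exact: cvg_cst.
    rewrite -(mulr0 (x ^+ 2)); apply: cvgMl_tmp; exact: cvg_harmonic.
  + exact: cvg_cst.
- exact: integrable_powR_exp.
- move=> n x /=; rewrite in_itv/= andbT => x0; rewrite /f indicE mem_setE/= in_itv/= (ltW x0)/=.
  case: (leP x n.+1%:R) => xn; last first.
    by rewrite mulr0 normr0 mulr_ge0 ?powR_ge0 ?expR_ge0.
  rewrite mulr1 mulrC ger0_norm; last first.
    by rewrite mulr_ge0 ?powR_ge0// exprn_ge0// subr_ge0 ler_pdivrMr// mul1r.
  by rewrite ler_wpM2l ?powR_ge0// onem_div_exp_le// (ltW x0).
move=> _; rewrite (_ : \int[mu]_(x in `]0, +oo[) _ = Gamma (u + 1)); last first.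
  by rewrite /Gamma addrK.
under eq_fun do rewrite fE.
move=> H.
have r1 : (n.+2%:R + u) / n.+1%:R @[n --> \oo] --> (1 : R).
  have E n : (n.+2%:R + u) / n.+1%:R = 1 + (1 + u) * n.+1%:R^-1 :> R.
    by rewrite -natr1; field.
  under eq_fun do rewrite E.
  have : 1 + (1 + u) * n.+1%:R^-1 @[n --> \oo] --> (1 + (1 + u) * 0 : R).
    apply: cvgD; first exact: cvg_cst.
    by apply: cvgMl_tmp; exact: cvg_harmonic.
  by rewrite mulr0 addr0.
have := cvgM H r1; rewrite mulr1 => {}H.
suff : gaussP n.+1 u @[n --> \oo] --> Gamma (u + 1).
  by rewrite (@cvg_shiftS _ (fun n => gaussP n u)).
rewrite (_ : (fun n => gaussP n.+1 u) = (fun n => gaussP n.+1 u * (n.+1%:R / (n.+2%:R + u))) \*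
  (fun n => (n.+2%:R + u) / n.+1%:R)); first exact: H.
apply/funext => n /=; have n2 : n.+2%:R + u != 0 by rewrite gt_eqF// ltr_pwDl.
by rewrite -mulrA mulf_div (mulrC n.+1%:R) divff ?mulr1// mulf_neq0.
Unshelve. all: by end_near. Qed.

Lemma Gamma1_gt0 u : 0 <= u -> 0 < Gamma (u + 1).
Proof.
move=> u0; apply: (lt_le_trans (gaussP_gt0 (ltn0Sn 0) u0)).
apply: (cvgr_to_ge (Gamma_gauss u0)).
by exists 1%N => // n /= n0; rewrite gaussP_homo.
Qed.

Lemma gaussP_le_Gamma m u : (0 < m)%N -> 0 <= u -> gaussP m u <= Gamma (u + 1).
Proof.
move=> m0 u0; apply: (cvgr_to_ge (Gamma_gauss u0)).
by exists m => // n /= mn; rewrite gaussP_homo// m0.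
Qed.

End gauss_limit.

(** * The Mittag-Leffler function on the negative half-line *)

Section mittag_leffler.
Variables (R : realType) (alpha : R).
Hypothesis alpha01 : 0 < alpha < 1.

Let alpha0 : 0 < alpha. Proof. by case/andP: alpha01. Qed.
Let alpha1 : alpha < 1. Proof. by case/andP: alpha01. Qed.

(** Each factor equals alpha + (1 - alpha) (i+1) / (i+1 + j): multiplying the
    coefficients of a generating series by it mixes the series with an average
    of its dilations. *)
Definition mlmom (n j : nat) : R :=
  \prod_(i < n) ((i.+1%:R + alpha * j%:R) / (i.+1%:R + j%:R)).

Lemma mlmom_bound n j : `|mlmom n j| <= 1.
Proof.
rewrite ger0_norm /mlmom; last first.
  by apply: prodr_ge0 => i _; rewrite divr_ge0// addr_ge0// mulr_ge0// ltW.
apply: prodr_ile1 => i _; rewrite divr_ge0 ?addr_ge0 ?mulr_ge0// ?(ltW alpha0)//=.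
rewrite ler_pdivrMr ?ltr_pwDl// mul1r lerD2l ler_piMl// ltW//.
Qed.

Lemma cm_mlmom n : cm (egf (mlmom n)).
Proof.
elim: n => [|n IH].
  rewrite (_ : egf _ = fun z => expR (- (1 * z))); first exact: cm_exp.
  apply/funext => z; rewrite mul1r -egf_cst1; congr egf; apply/funext => j.
  by rewrite /mlmom big_ord0.
have -> : egf (mlmom n.+1) = fun z => alpha * egf (mlmom n) z +
    (1 - alpha) * egf (fun j => mlmom n j * (n.+1%:R / (n.+1%:R + j%:R))) z.
  have B1 j : `|mlmom n j * (n.+1%:R / (n.+1%:R + j%:R))| <= 1.
    rewrite normrM -[leRHS]mulr1 ler_pM ?mlmom_bound// ger0_norm.
      by rewrite ler_pdivrMr ?ltr_pwDl// mul1r lerDl.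
    by rewrite divr_ge0// addr_ge0.
  apply/funext => z; rewrite -!(egfZ _ _ (mlmom_bound n)) -(egfZ _ _ B1).
  rewrite -(@egfD _ _ _ _ (`|alpha| * 1) (`|1 - alpha| * 1)).
  - congr egf; apply/funext => j; rewrite /mlmom big_ord_recr/=.
    have ? : n.+1%:R + j%:R != 0 :> R by rewrite gt_eqF// ltr_pwDl.
    by field.
  - by move=> j; rewrite normrM ler_wpM2l// mlmom_bound.
  - by move=> j; rewrite normrM ler_wpM2l.
apply: cm_add; apply: cm_scale => //; rewrite ?subr_ge0 ?(ltW alpha1) ?(ltW alpha0)//.
exact: cm_egf_beta (mlmom_bound n) IH.
Qed.

(** Both sides converge to j! / Gamma (alpha j + 1), the ratio between the
    coefficients of the Mittag-Leffler series and those of the exponential. *)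
Lemma mlmom_gauss n j : (0 < n)%N ->
  (n%:R `^ (1 - alpha)) ^+ j * mlmom n j = gaussP n j%:R / gaussP n (alpha * j%:R).
Proof.
move=> n0; have n0R : 0 < n%:R :> R by rewrite ltr0n.
have aj0 : 0 <= alpha * j%:R by rewrite mulr_ge0// ltW.
rewrite /mlmom big_split/= -powR_mulrn ?powR_ge0// -powRrM mulrBl mul1r.
rewrite powRB ?(gt_eqF n0R) ?implybT// prodfV /gaussP.
have ? := lt0r_neq0 (gaussP_den_gt0 n aj0).
have ? := lt0r_neq0 (gaussP_den_gt0 n (ler0n R j)).
have ? : n%:R `^ (alpha * j%:R) != 0 by rewrite gt_eqF// powR_gt0.
have ? : n`!%:R != 0 :> R by rewrite pnatr_eq0 -lt0n fact_gt0.
by field; do ?[apply/andP; split].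
Qed.

Lemma ml_term_bound m n j (z : R) : (0 < m <= n)%N -> 0 <= z ->
  z ^+ j * (gaussP n (alpha * j%:R))^-1 <=
  geometric (m%:R ^+ m) (z * expR 1 * m%:R `^ (- alpha)) j.
Proof.
move=> /andP[m0 mn] z0; have aj0 : 0 <= alpha * j%:R by rewrite mulr_ge0// ltW.
rewrite /geometric/= !exprMn.
apply: (@le_trans _ _ (z ^+ j * (gaussP m (alpha * j%:R))^-1)).
  rewrite ler_wpM2l ?exprn_ge0// lef_pV2 ?posrE ?gaussP_gt0 ?gaussP_homo ?m0//.
  exact: leq_trans mn.
rewrite -!mulrA [leRHS]mulrCA ler_wpM2l ?exprn_ge0//.
rewrite (le_trans (@gaussP_inv_le _ _ _ j m0 aj0 _))//.
  by rewrite ler_piMl// ltW.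
by rewrite -[_ `^ _ ^+ j]powR_mulrn ?powR_ge0// -powRrM mulNr mulrA.
Qed.

Lemma ml_ratio_lt1 (z : R) : 0 <= z -> exists m : nat,
  (0 < m)%N /\ `|z * expR 1 * m%:R `^ (- alpha)| < 1.
Proof.
move=> z0; pose y := (z * expR 1) `^ (alpha^-1).
have y0 : 0 <= y by exact: powR_ge0.
exists (Num.truncn y).+1; split => //.
have ym := truncnS_gt y.
have m0 : 0 < (Num.truncn y).+1%:R `^ alpha :> R by rewrite powR_gt0.
rewrite ger0_norm; last by rewrite !mulr_ge0 ?powR_ge0 ?expR_ge0.
rewrite powRN ltr_pdivrMr// mul1r.
have -> : z * expR 1 = y `^ alpha.
  by rewrite /y -powRrM mulVf ?gt_eqF// powRr1 ?mulr_ge0 ?expR_ge0.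
by rewrite gt0_ltr_powR// nnegrE.
Qed.

(** The power n^((1-alpha) j) in [mlmom_gauss] is a dilation of the variable,
    so E_alpha(- z) is the limit of completely monotone functions, by Tannery's
    theorem. *)
Lemma cm_mittag_leffler : cm (fun z => mittag_leffler alpha (- z)).
Proof.
apply: (@cm_lim _ (fun n z => egf (mlmom n) (n%:R `^ (1 - alpha) * z))).
  by move=> n; apply: cm_dilate; [exact: powR_ge0|exact: cm_mlmom].
move=> z z0; have [m [m0 mz]] := ml_ratio_lt1 z0.
apply: (@tannery _ (fun n j => (- (n%:R `^ (1 - alpha) * z)) ^+ j / j`!%:R * mlmom n j)
  _ (geometric (m%:R ^+ m) (z * expR 1 * m%:R `^ (- alpha))) m).
- move=> n j mn; have n0 : (0 < n)%N by exact: leq_trans mn.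
  have aj0 : 0 <= alpha * j%:R by rewrite mulr_ge0// ltW.
  have -> : (- (n%:R `^ (1 - alpha) * z)) ^+ j / j`!%:R * mlmom n j =
      (- z) ^+ j * (gaussP n (alpha * j%:R))^-1 * (gaussP n j%:R / j`!%:R).
    rewrite -mulrN exprMn [RHS](_ : _ = (- z) ^+ j / j`!%:R *
        (gaussP n j%:R / gaussP n (alpha * j%:R))); last ring.
    by rewrite -mlmom_gauss//; ring.
  rewrite normrM -[leRHS]mulr1 ler_pM//.
    rewrite normrM normrX normrN (ger0_norm z0) ger0_norm ?invr_ge0 ?(ltW (gaussP_gt0 _ _))//.
    by rewrite ml_term_bound// m0.
  have j0 : 0 < j`!%:R :> R by rewrite ltr0n fact_gt0.
  have g0 : 0 <= gaussP n j%:R :> R by rewrite ltW// gaussP_gt0.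
  by rewrite ger0_norm ?(divr_ge0 g0 (ltW j0))// ler_pdivrMr// mul1r gaussP_nat_le.
- by apply: is_cvg_geometric_series.
- move=> j; have aj0 : 0 <= alpha * j%:R by rewrite mulr_ge0// ltW.
  have j0 : 0 < j`!%:R :> R by rewrite ltr0n fact_gt0.
  rewrite -(@cvg_shiftS _ (fun n => (- (n%:R `^ (1 - alpha) * z)) ^+ j / j`!%:R * mlmom n j)).
  have E n : (- (n.+1%:R `^ (1 - alpha) * z)) ^+ j / j`!%:R * mlmom n.+1 j =
      (- z) ^+ j * (gaussP n.+1 (alpha * j%:R))^-1 * (gaussP n.+1 j%:R / j`!%:R).
    rewrite -mulrN exprMn [RHS](_ : _ = (- z) ^+ j / j`!%:R *
        (gaussP n.+1 j%:R / gaussP n.+1 (alpha * j%:R))); last ring.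
    by rewrite -mlmom_gauss//; ring.
  under eq_fun do rewrite E.
  have L1 : (- z) ^+ j * (gaussP n.+1 (alpha * j%:R))^-1 @[n --> \oo] -->
      (- z) ^+ j / Gamma (alpha * j%:R + 1).
    apply: cvgMl_tmp; apply: cvgV; first by rewrite gt_eqF// Gamma1_gt0.
    by rewrite (@cvg_shiftS _ (fun n => gaussP n (alpha * j%:R))); exact: Gamma_gauss.
  have L2 : gaussP n.+1 j%:R / j`!%:R @[n --> \oo] --> (j`!%:R / j`!%:R : R).
    apply: cvgMr_tmp.
    by rewrite (@cvg_shiftS _ (fun n => gaussP n j%:R)); exact: gaussP_nat_cvg.
  have := cvgM L1 L2; rewrite (divff (lt0r_neq0 j0)) mulr1 => L; exact: L.
Qed.

Let coef j : R := (Gamma (alpha * j%:R + 1))^-1.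

Let coef_gt0 j : 0 < coef j.
Proof. by rewrite invr_gt0 Gamma1_gt0// mulr_ge0// ltW. Qed.

Lemma cvg_series_mlcoef (z : R) : 0 <= z -> cvgn (series (fun j => z ^+ j * coef j)).
Proof.
move=> z0; have [m [m0 mz]] := ml_ratio_lt1 z0.
apply: (@dominated_is_cvg _ _ (geometric (m%:R ^+ m) (z * expR 1 * m%:R `^ (- alpha)))).
  move=> j; have aj0 : 0 <= alpha * j%:R by rewrite mulr_ge0// ltW.
  rewrite ger0_norm ?mulr_ge0 ?exprn_ge0 ?(ltW (coef_gt0 _))//.
  rewrite (le_trans _ (@ml_term_bound m m j z _ z0)) ?m0 ?leqnn//.
  rewrite ler_wpM2l ?exprn_ge0// lef_pV2 ?posrE ?Gamma1_gt0 ?gaussP_gt0//.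
  exact: gaussP_le_Gamma.
by apply: is_cvg_geometric_series.
Qed.

Lemma mittag_leffler_expand : exists2 K : R, 1 <= K & forall z : R, 0 <= z <= 1 ->
  `|mittag_leffler alpha (- z) - (1 - z / Gamma (alpha + 1))| <= K * z ^+ 2.
Proof.
have coef0 : coef 0%N = 1.
  have G0 : gaussP n 0 @[n --> \oo] --> Gamma (0 + 1 : R) by apply: Gamma_gauss.
  have G1 : gaussP n 0 @[n --> \oo] --> (1 : R) by exact: (@gaussP_nat_cvg R 0).
  by rewrite /coef mulr0 (cvg_unique (@Rhausdorff R) G0 G1) invr1.
have cg : cvgn (series coef).
  have := cvg_series_mlcoef ler01.
  by congr (cvgn (series _)); apply/funext => j; rewrite expr1n mul1r.
exists (limn (series coef)).
  have cg' : series coef n @[n --> \oo] --> limn (series coef) by exact: cg.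
  apply: (cvgr_to_ge cg'); exists 1%N => // -[//|n] _.
  rewrite seriesEord /= big_ord_recl coef0 lerDl sumr_ge0// => i _.
  exact/ltW/coef_gt0.
move=> z /andP[z0 z1].
(* the series without its first two terms *)
pose y j := if (j < 2)%N then 0 else (- z) ^+ j * coef j.
have yM j : `|y j| <= (z ^+ 2 *: coef) j.
  rewrite /y /=; case: ltnP => j2.
    by rewrite normr0 mulr_ge0 ?exprn_ge0 ?(ltW (coef_gt0 _)).
  rewrite normrM normrX normrN (ger0_norm z0) (ger0_norm (ltW (coef_gt0 _))).
  by rewrite ler_wpM2r ?(ltW (coef_gt0 _))// ler_wiXn2l.
have cM : cvgn (series (z ^+ 2 *: coef)) by apply: is_cvg_seriesZ.
have := series_tail_le 0 yM cM.
have s0 (f : nat -> R) : series f 0%N = 0 by rewrite seriesEord/= big_ord0.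
rewrite !s0 !subr0 (lim_seriesZ _ cg) => H.
suff E : limn (series y) = mittag_leffler alpha (- z) - (1 - z / Gamma (alpha + 1)).
  by rewrite -E [leRHS]mulrC; exact: H.
have cz : cvgn (series (fun j => (- z) ^+ j / Gamma (alpha * j%:R + 1))).
  apply: (dominated_is_cvg _ (cvg_series_mlcoef z0)) => j.
  by rewrite normrM normrX normrN (ger0_norm z0) (ger0_norm (ltW (coef_gt0 _))).
apply: cvg_lim; first exact: Rhausdorff.
have : series (fun j => (- z) ^+ j / Gamma (alpha * j%:R + 1)) n - (1 - z / Gamma (alpha + 1))
    @[n --> \oo] --> mittag_leffler alpha (- z) - (1 - z / Gamma (alpha + 1)).
  by apply: cvgB; [exact: cz|exact: cvg_cst].
apply: cvg_trans; apply: near_eq_cvg; exists 2%N => // -[//|[//|n]] _.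
rewrite !seriesEord/= !big_ord_recl/= /y/= !add0r.
have -> : (- z) ^+ 0 / Gamma (alpha * 0 + 1) = 1.
  by move: coef0; rewrite /coef expr0 mul1r.
have -> : (- z) ^+ bump 0 0 / Gamma (alpha * (bump 0 0)%:R + 1) = - (z / Gamma (alpha + 1)).
  by rewrite /bump/= expr1 mulr1 mulNr.
rewrite -[RHS]/(\sum_(i < n) (- z) ^+ bump 0 (bump 0 i) / Gamma (alpha * (bump 0 (bump 0 i))%:R + 1)).
by ring.
Qed.

Lemma mittag_leffler0 : mittag_leffler alpha 0 = 1.
Proof.
have [K _ /(_ 0)] := mittag_leffler_expand.
rewrite lexx ler01 oppr0 mul0r subr0 expr0n/= mulr0 normr_le0 subr_eq0 => H.
exact/eqP/H.
Qed.

Lemma mittag_leffler_bounds z : 0 <= z -> 0 <= mittag_leffler alpha (- z) <= 1.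
Proof.
move=> z0; have := cm_bounds cm_mittag_leffler z0.
by rewrite oppr0 mittag_leffler0.
Qed.

(** Near 0 the linear term z / Gamma (alpha + 1) dominates; away from 0 the
    upper bound holds because the left-hand side is at most 1. *)
Lemma onem_mittag_leffler : exists c C z0 : R, [/\ 0 < c, 0 < C, 0 < z0,
  forall z, 0 <= z <= z0 -> c * z <= 1 - mittag_leffler alpha (- z) &
  forall z, 0 <= z -> 1 - mittag_leffler alpha (- z) <= C * z].
Proof.
have [K K1 HK] := mittag_leffler_expand.
pose g := (Gamma (alpha + 1))^-1.
have g0 : 0 < g by rewrite invr_gt0 Gamma1_gt0// ltW.
have K0 : 0 < K by exact: lt_le_trans K1.
exists (g / 2), (g + K), (Num.min 1 (g / (2 * K))); split.
- by rewrite divr_gt0.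
- by rewrite addr_gt0.
- by rewrite lt_min ltr01/= divr_gt0// mulr_gt0.
- move=> z /andP[z0]; rewrite le_min => /andP[z1 zg].
  have := HK z; rewrite z0 z1 => /(_ isT); rewrite ler_norml => /andP[_].
  rewrite -/g.
  have : K * z ^+ 2 <= g / 2 * z.
    rewrite expr2 mulrA ler_wpM2r//.
    move: zg; rewrite ler_pdivlMr ?mulr_gt0//; lra.
  rewrite -/g; move: (mittag_leffler _ _) (K * _) => a b.
  have -> : z / Gamma (alpha + 1) = g * z by rewrite mulrC.
  by nra.
- move=> z z0; have [z1|z1] := leP z 1.
    have := HK z; rewrite z0 z1 => /(_ isT); rewrite ler_norml => /andP[+ _].
    have -> : z / Gamma (alpha + 1) = g * z by rewrite mulrC.
    have : K * z ^+ 2 <= K * z.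
      by rewrite ler_wpM2l ?(ltW K0)// expr2 ler_piMl.
    by move: (mittag_leffler _ _) (K * _) => a b; nra.
  have /andP[h _] := mittag_leffler_bounds z0.
  apply: (@le_trans _ _ 1); first by rewrite gerBl.
  by nra.
Qed.

End mittag_leffler.

(** * Gaussian integrals on the line *)

Section gaussian1d.
Variable R : realType.
Notation mu := (@lebesgue_measure R).
Implicit Types (a k x th : R).

Definition gau a k : R := expR (- (a * k ^+ 2)).

Lemma measurable_gau a : measurable_fun setT (gau a).
Proof.
apply: measurableT_comp => //; apply: measurableT_comp => //.
by apply: measurable_funM => //; exact: measurable_funX.
Qed.

Lemma gau_ge0 a k : 0 <= gau a k. Proof. exact: expR_ge0. Qed.

Lemma gau_normal a : 0 < a -> exists2 s : R, s != 0 &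
  forall k, gau a k = Num.sqrt (pi / a) * normal_pdf 0 s k.
Proof.
move=> a0; pose s := Num.sqrt ((2 * a)^-1).
have s0 : 0 < s by rewrite sqrtr_gt0 invr_gt0 mulr_gt0.
have s2 : s ^+ 2 = (2 * a)^-1 by rewrite sqr_sqrtr// invr_ge0 mulr_ge0// ltW.
exists s; first by rewrite gt_eqF.
move=> k; rewrite normal_pdfE ?gt_eqF// /normal_peak /normal_fun subr0 s2.
have -> : (2 * a)^-1 * pi *+ 2 = pi / a by rewrite -mulr_natr; field; rewrite gt_eqF.
rewrite mulVKf; last by rewrite gt_eqF// sqrtr_gt0 divr_gt0// pi_gt0.
by congr expR; rewrite -mulr_natr; field; rewrite gt_eqF.
Qed.

Lemma integrable_gau a : 0 < a -> mu.-integrable setT (EFin \o gau a).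
Proof.
move=> a0; have [s s0 gE] := gau_normal a0.
rewrite (_ : EFin \o gau a =
    fun k => ((Num.sqrt (pi / a))%:E * (normal_pdf 0 s k)%:E)%E).
  by apply: integrableZl => //; exact: integrable_normal_pdf.
by apply/funext => k; rewrite /= gE.
Qed.

Lemma Rintegral_gau a : 0 < a -> \int[mu]_k gau a k = Num.sqrt (pi / a).
Proof.
move=> a0; have [s s0 gE] := gau_normal a0.
under eq_Rintegral do rewrite gE.
rewrite RintegralZl//; last exact: integrable_normal_pdf.
by rewrite /Rintegral integral_normal_pdf// mulr1.
Qed.

Lemma gau_half a k : gau a k = gau (a / 2) k * gau (a / 2) k.
Proof. by rewrite -expRD; congr expR; field. Qed.

Lemma mul_gau_le a k : 0 < a -> `|k| * gau a k <= (1 + 2 / a) * gau (a / 2) k.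
Proof.
move=> a0; rewrite gau_half mulrA ler_wpM2r ?gau_ge0//.
rewrite /gau expRN ler_pdivrMr ?expR_gt0//.
have e1 := expR_ge1Dx (a / 2 * k ^+ 2).
have k1 : `|k| <= 1 + k ^+ 2 by rewrite -real_normK ?num_real//; have := sqr_ge0 (`|k| - 1); nra.
have ak : 0 <= a / 2 * k ^+ 2 by rewrite mulr_ge0 ?sqr_ge0// divr_ge0// ltW.
have k2 : k ^+ 2 = 2 / a * (a / 2 * k ^+ 2) by field; rewrite gt_eqF.
apply: (le_trans k1); rewrite mulrDl mul1r; apply: lerD.
  by apply: le_trans e1; rewrite lerDl.
rewrite {1}k2 ler_wpM2l//; first by rewrite divr_ge0// ltW.
by apply: le_trans e1; rewrite lerDr.
Qed.

Lemma integrable_mul_gau a : 0 < a -> mu.-integrable setT (EFin \o (fun k => `|k| * gau a k)).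
Proof.
move=> a0; have a20 : 0 < a / 2 by rewrite divr_gt0.
apply: (@Rle_integrable _ _ _ mu _ _ (fun k => (1 + 2 / a) * gau (a / 2) k)) => //.
- by apply: measurable_funM; [exact: normr_measurable|exact: measurable_gau].
- by move=> k _; rewrite ger0_norm ?mulr_ge0 ?gau_ge0// mul_gau_le.
- by have /(integrableZl measurableT (1 + 2 / a)) := integrable_gau a20.
Qed.

Lemma is_derive_affine (k th x : R) : is_derive x 1 (fun y : R => k * y + th) k.
Proof.
have : is_derive x 1 ((k *: id) + cst th : R -> R) (k *: 1 + 0) by apply: is_deriveD.
by rewrite addr0 /GRing.scale/= mulr1.
Qed.

Lemma is_derive_cos_affine k th c x :
  is_derive x 1 (fun y : R => cos (k * y + th) * c) (- (k * sin (k * x + th)) * c).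
Proof.
have h1 := is_derive_affine k th x.
have h2 : is_derive x 1 (cos \o (fun y : R => k * y + th)) (- sin (k * x + th) * k).
  exact: is_derive1_comp.
have := @is_deriveZ _ _ _ _ c _ _ _ h2.
rewrite (_ : c *: (- sin (k * x + th) * k) = - (k * sin (k * x + th)) * c); last first.
  by rewrite /GRing.scale/=; ring.
by congr is_derive; apply/funext => y; rewrite [LHS]mulrC.
Qed.

Lemma continuous_affine x th : continuous (fun k : R => k * x + th).
Proof.
move=> k; have [/derivable1_diffP/differentiable_continuous + _] := is_derive_affine x th k.
by rewrite (_ : (fun k : R => k * x + th) = (fun y => x * y + th))//; apply/funext => y; rewrite mulrC.
Qed.

Lemma continuous_cos_affine x th : continuous (fun k : R => cos (k * x + th)).
Proof.
move=> k; apply: (@continuous_comp _ _ _ (fun k : R => k * x + th) cos).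
  exact: continuous_affine.
exact: continuous_cos.
Qed.

Lemma continuous_sin_affine x th : continuous (fun k : R => sin (k * x + th)).
Proof.
move=> k; apply: (@continuous_comp _ _ _ (fun k : R => k * x + th) sin).
  exact: continuous_affine.
exact: continuous_sin.
Qed.

Lemma gau_is_derive a (k : R) : is_derive k 1 (gau a) (- (2 * a * k) * gau a k).
Proof.
have h3 : is_derive k 1 (fun y : R => - (a * y ^+ 2)) (- (2 * a * k)).
  have h : is_derive k 1 (id ^+ 2 : R -> R) ((2%:R * k ^+ 1) *: 1) by apply: is_deriveX.
  have := @is_deriveZ _ _ _ _ (- a) _ _ _ h.
  rewrite /GRing.scale/= !mulr1 expr1 => h'.
  have -> : - (2 * a * k) = - a * (2 * k) by ring.
  move: h'; congr is_derive; apply/funext => y /=.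
  by rewrite -mulNr.
rewrite mulrC; exact: (is_derive1_comp _ h3).
Qed.

Lemma continuous_gau a : continuous (gau a).
Proof.
by move=> k; have [/derivable1_diffP/differentiable_continuous] := gau_is_derive a k.
Qed.

(** The phase [th] lets the other coordinates of a vector enter the argument of
    the cosine, when the coordinates are integrated out one by one. *)
Definition gau_cosine a th x : R := \int[mu]_k (cos (k * x + th) * gau a k).

Lemma measurable_cos_affine x th : measurable_fun setT (fun k : R => cos (k * x + th)).
Proof.
apply: measurableT_comp; first exact: continuous_measurable_fun (@continuous_cos R).
by apply: measurable_funD => //; exact: measurable_funM.
Qed.

Lemma measurable_sin_affine x th : measurable_fun setT (fun k : R => sin (k * x + th)).
Proof.
apply: measurableT_comp; first exact: continuous_measurable_fun (@continuous_sin R).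
by apply: measurable_funD => //; exact: measurable_funM.
Qed.

Lemma integrable_cos_gau a th x : 0 < a ->
  mu.-integrable setT (EFin \o (fun k => cos (k * x + th) * gau a k)).
Proof.
move=> a0; apply: (Rle_integrable _ _ _ (integrable_gau a0)) => //.
  by apply: measurable_funM; [exact: measurable_cos_affine|exact: measurable_gau].
by move=> k _; rewrite normrM (ger0_norm (gau_ge0 _ _)) ler_piMl ?gau_ge0// cos_max.
Qed.

Lemma integrable_sin_gau a th x : 0 < a ->
  mu.-integrable setT (EFin \o (fun k => k * sin (k * x + th) * gau a k)).
Proof.
move=> a0; apply: (Rle_integrable _ _ _ (integrable_mul_gau a0)) => //.
  apply: measurable_funM; last exact: measurable_gau.
  by apply: measurable_funM => //; exact: measurable_sin_affine.
move=> k _; rewrite !normrM (ger0_norm (gau_ge0 _ _)) ler_wpM2r ?gau_ge0//.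
by rewrite ler_piMr// sin_max.
Qed.

Lemma gau_cosine_derive a th x : 0 < a ->
  is_derive x 1 (gau_cosine a th) (- \int[mu]_k (k * sin (k * x + th) * gau a k)).
Proof.
move=> a0.
pose f x k := cos (k * x + th) * gau a k.
have xI : `]x - 1, x + 1[%classic x by rewrite /= in_itv/= ltrBlDr ltrDl ltr01.
have df (y k : R) : is_derive y 1 (f ^~ k) (- (k * sin (k * y + th)) * gau a k).
  exact: is_derive_cos_affine.
have i1 y : `]x - 1, x + 1[%classic y -> mu.-integrable setT (EFin \o f y).
  by move=> _; exact: integrable_cos_gau.
have i2 y (k : R) : `]x - 1, x + 1[%classic y -> setT k -> derivable (f ^~ k) y 1.
  by move=> _ _; have [] := df y k.
have i3 k : 0 <= `|k| * gau a k by rewrite mulr_ge0 ?gau_ge0.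
have dE y k : (f ^~ k)^`()%classic y = - (k * sin (k * y + th)) * gau a k.
  by rewrite derive1E; have [_ ->] := df y k.
have i4 y k : `]x - 1, x + 1[%classic y -> setT k ->
    `|(f ^~ k)^`()%classic y| <= `|k| * gau a k.
  move=> _ _; rewrite dE !normrM normrN (ger0_norm (gau_ge0 _ _)) ler_wpM2r ?gau_ge0//.
  by rewrite normrM ler_piMr// sin_max.
have D1 := derivable_under_integral measurableT xI i1 i2 i3 (integrable_mul_gau a0) i4.
have D2 := differentiation_under_integral measurableT xI i1 i2 i3 (integrable_mul_gau a0) i4.
apply: DeriveDef; first exact: D1.
rewrite -derive1E [LHS]D2.
rewrite -mulN1r -RintegralZl//; last exact: integrable_sin_gau.
apply: eq_Rintegral => k _; rewrite /partial1of2 dE; ring.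
Qed.

Lemma sin_gau_derive a th x k :
  is_derive k 1 (fun k => sin (k * x + th) * gau a k)
    (x * (cos (k * x + th) * gau a k) - 2 * a * (k * sin (k * x + th) * gau a k)).
Proof.
have h1 : is_derive k 1 (fun y : R => y * x + th) x.
  have := is_derive_affine x th k; congr is_derive.
  by apply/funext => y; rewrite mulrC.
have h2 : is_derive k 1 (sin \o (fun y : R => y * x + th)) (cos (k * x + th) * x).
  exact: is_derive1_comp.
have h4 := gau_is_derive a k.
have := is_deriveM h2 h4.
rewrite /GRing.scale/=; move=> h; apply: (is_derive_eq h).
by rewrite /=; ring.
Qed.

Lemma gau_le_inv a (n : nat) : 0 < a -> gau a n.+1%:R <= a^-1 * n.+1%:R^-1.
Proof.
move=> a0; rewrite /gau expRN -invfM lef_pV2 ?posrE ?expR_gt0 ?mulr_gt0//.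
apply: (le_trans _ (expR_ge1Dx _)).
apply: (@le_trans _ _ (a * n.+1%:R ^+ 2)); last by rewrite lerDr.
by rewrite ler_wpM2l ?(ltW a0)// expr2 ler_peMr// ler1n.
Qed.

(** The difference of the two integrands is the derivative of
    sin (k x + th) exp(- a k^2), which vanishes at infinity. *)
Lemma gau_cosine_parts a th x : 0 < a ->
  2 * a * \int[mu]_k (k * sin (k * x + th) * gau a k) = x * gau_cosine a th x.
Proof.
move=> a0.
pose f k := x * (cos (k * x + th) * gau a k) - 2 * a * (k * sin (k * x + th) * gau a k).
pose F k := sin (k * x + th) * gau a k.
have i1 : mu.-integrable setT (EFin \o (fun k => x * (cos (k * x + th) * gau a k))).
  by have /(integrableZl measurableT x) := @integrable_cos_gau a th x a0.
have i2 : mu.-integrable setT (EFin \o (fun k => 2 * a * (k * sin (k * x + th) * gau a k))).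
  by have /(integrableZl measurableT (2 * a)) := @integrable_sin_gau a th x a0.
have if_ : mu.-integrable setT (EFin \o f).
  by have := integrableB measurableT i1 i2.
suff : \int[mu]_k f k = 0.
  rewrite /f RintegralB// RintegralZl//; last exact: integrable_cos_gau.
  rewrite RintegralZl//; last exact: integrable_sin_gau.
  by move/eqP; rewrite subr_eq0 => /eqP <-.
(* the integral over [- n, n] tends to the full one, and to 0 by the
   fundamental theorem of calculus *)
have cvg1 : \int[mu]_k (f k * \1_`[- n.+1%:R, n.+1%:R] k) @[n --> \oo] --> \int[mu]_k f k.
  have [|||||_] := @Rdominated_cvg _ _ _ mu setT
    (fun (n : nat) k => f k * \1_`[- n.+1%:R, n.+1%:R] k) f (fun k => `|f k|).
  - exact: measurableT.
  - move=> n; apply: measurable_funM; last exact: measurable_indic.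
    by have /integrableP[/measurable_EFinP] := if_.
  - move=> k _; apply: cvg_near_cst; exists (Num.truncn `|k|) => // n /= nk.
    rewrite indicE mem_set ?mulr1//= in_itv/= -ler_norml ltW//.
    by rewrite (lt_le_trans (truncnS_gt _))// ler_nat ltnS.
  - exact: (integrable_norm if_).
  - move=> n k _; rewrite normrM ler_piMr// indicE.
    by case: (_ \in _); rewrite ?normr1 ?normr0.
  - exact.
have cvg0 : \int[mu]_k (f k * \1_`[- n.+1%:R, n.+1%:R] k) @[n --> \oo] --> (0 : R).
  have E n : \int[mu]_k (f k * \1_`[- n.+1%:R, n.+1%:R] k) = F n.+1%:R - F (- n.+1%:R).
    have -> : \int[mu]_k (f k * \1_`[- n.+1%:R, n.+1%:R] k) =
        \int[mu]_(k in `[- n.+1%:R, n.+1%:R]) f k.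
      rewrite [RHS]Rintegral_mkcond; apply: eq_Rintegral => k _.
      by rewrite patchE indicE; case: (_ \in _); rewrite ?mulr1 ?mulr0.
    have dF k := sin_gau_derive a th x k.
    have cF : continuous F.
      by move=> k; have [/derivable1_diffP/differentiable_continuous] := dF k.
    rewrite /Rintegral (@continuous_FTC2 _ f F)//.
    - by rewrite gtrN.
    - apply: continuous_subspaceT => k.
      apply: cvgB; apply: cvgMl_tmp; (apply: cvgM; last exact: continuous_gau).
        exact: continuous_cos_affine.
      by apply: cvgM; [exact: cvg_id|exact: continuous_sin_affine].
    - split => [k _||].
      + by have [] := dF k.
      + exact: cvg_at_right_filter (cF _).
      + exact: cvg_at_left_filter (cF _).
    - by move=> k _; rewrite derive1E; have [_ ->] := dF k.
  under eq_fun do rewrite E.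
  apply/norm_cvg0P.
  apply: (@squeeze_cvgr _ _ _ _ (fun=> 0) (fun n => (2 / a) * n.+1%:R^-1)).
  - apply: nearW => n; rewrite normr_ge0/= (le_trans (ler_normB _ _))//.
    have b k : `|F k| <= gau a k.
      by rewrite normrM (ger0_norm (gau_ge0 _ _)) ler_piMl ?gau_ge0// sin_max.
    have g := gau_le_inv n a0.
    have e : gau a (- n.+1%:R) = gau a n.+1%:R by rewrite /gau sqrrN.
    rewrite (le_trans (lerD (b _) (b _)))// e.
    have -> : 2 / a = a^-1 + a^-1 by ring.
    by rewrite mulrDl lerD.
  - exact: cvg_cst.
  - by rewrite -(mulr0 (2 / a)); apply: cvgMl_tmp; exact: cvg_harmonic.
exact: (cvg_unique (@Rhausdorff R) cvg1 cvg0).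
Qed.

(** Differentiation under the integral and integration by parts show that the
    transform g satisfies g' = - x / (2 a) g. *)
Lemma gau_cosineE a th x : 0 < a ->
  gau_cosine a th x = cos th * (Num.sqrt (pi / a) * expR (- (x ^+ 2 / (4 * a)))).
Proof.
move=> a0.
(* the quotient of the transform by the expected Gaussian is constant *)
pose H y := gau_cosine a th y * expR (y ^+ 2 / (4 * a)).
have dH (y : R) : is_derive y 1 H 0.
  have h1 := @gau_cosine_derive a th y a0.
  have h3 : is_derive y 1 (fun y : R => y ^+ 2 / (4 * a)) (y / (2 * a)).
    have h : is_derive y 1 (id ^+ 2 : R -> R) ((2%:R * y ^+ 1) *: 1) by apply: is_deriveX.
    have := @is_deriveZ _ _ _ _ ((4 * a)^-1) _ _ _ h.
    rewrite /GRing.scale/= !mulr1 expr1 => h'.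
    have -> : y / (2 * a) = (4 * a)^-1 * (2 * y) by field; rewrite gt_eqF.
    move: h'; congr is_derive; apply/funext => z /=.
    by rewrite [RHS]mulrC.
  have h4 : is_derive y 1 (expR \o (fun y : R => y ^+ 2 / (4 * a))) (expR (y ^+ 2 / (4 * a)) * (y / (2 * a))).
    exact: is_derive1_comp.
  have h := is_deriveM h1 h4.
  apply: (is_derive_eq h); rewrite /GRing.scale/=.
  have := @gau_cosine_parts a th y a0.
  set I := \int[mu]_k _ => e.
  have -> : I = y / (2 * a) * gau_cosine a th y.
    have -> : y / (2 * a) * gau_cosine a th y = (2 * a)^-1 * (y * gau_cosine a th y) by ring.
    by rewrite -e mulKf// gt_eqF// mulr_gt0.
  by rewrite /=; ring.
have HE : H x = H 0 by exact: is_derive_0_is_cst.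
have H0 : H 0 = cos th * Num.sqrt (pi / a).
  rewrite /H expr0n/= mul0r expR0 mulr1 /gau_cosine -(Rintegral_gau a0) -RintegralZl//; last exact: integrable_gau.
  by apply: eq_Rintegral => k _; rewrite mulr0 add0r.
have e0 : expR (x ^+ 2 / (4 * a)) != 0 by rewrite gt_eqF// expR_gt0.
apply: (mulIf e0); rewrite -[LHS]/(H x) HE H0 expRN.
by rewrite -[RHS]mulrA -mulrA mulVf// mulr1.
Qed.

End gaussian1d.

(** * Integration on row vectors *)

Section lebesgue1d.
Variable R : realType.
Notation mu := (@lebesgue_measure R).

Lemma measurable_subl (c : R) : measurable_fun [set: measurableTypeR R] (fun x : R => c - x : measurableTypeR R).
Proof. exact: measurable_funB. Qed.

Lemma lebesgue_measure_subl (c : R) (A : set R) : measurable A ->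
  pushforward mu (fun x : R => c - x : measurableTypeR R) A = mu A.
Proof.
move=> mA; apply/esym.
apply: (@lebesgue_measure_unique R
  (measure_function_pushforward__canonical__measure_function_Measure mu (measurable_subl c))) => //.
move=> _ [[a b]] _ <-; rewrite /= /pushforward.
have -> : (fun x : R => c - x) @^-1` `]a, b]%classic = `[c - b, c - a[%classic.
  by apply/seteqP; split => x /=; rewrite !in_itv/= => /andP[? ?]; apply/andP; split; lra.
rewrite !lebesgue_measure_itv/= !lte_fin.
rewrite (_ : (c - b < c - a) = (a < b)); last by apply/idP/idP; lra.
by case: ifP => // _; rewrite -!EFinB; congr EFin; ring.
Qed.

Lemma ge0_integral_subl (c : R) (f : R -> \bar R) : measurable_fun setT f ->
  (forall x, 0 <= f x)%E ->
  (\int[mu]_x f (c - x)%R = \int[mu]_x f x)%E.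
Proof.
move=> mf f0.
transitivity (\int[pushforward mu (fun x : R => (c - x)%R : measurableTypeR R)]_x f x)%E.
  by rewrite ge0_integral_pushforward//; exact: measurable_subl.
apply: eq_measure_integral => [|mf' A mA _]; first exact: measurable_subl.
exact: lebesgue_measure_subl.
Qed.
End lebesgue1d.

Section rV.
Variable R : realType.
Notation mu := (@lebesgue_measure R).
Notation leb := (lebesgue_rV R).

Lemma ge0_integral_rVS n (f : 'rV[R]_n.+1 -> \bar R) : measurable_fun setT f ->
  (forall x, 0 <= f x)%E ->
  (\int[leb n.+1]_y f y = \int[mu]_x \int[leb n]_v f (cons_rV (x, v)))%E.
Proof.
move=> mf f0.
transitivity (\int[pushforward (mu \x leb n) (@cons_rV R n)]_y f y)%E; first by [].
rewrite ge0_integral_pushforward//; last exact: measurable_cons_rV.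
rewrite preimage_setT fubini_tonelli1//.
  by apply: measurableT_comp => //; exact: measurable_cons_rV.
by move=> x; exact: f0.
Qed.

Lemma integral_rVS n (f : 'rV[R]_n.+1 -> \bar R) : (leb n.+1).-integrable setT f ->
  (\int[leb n.+1]_y f y = \int[mu]_x \int[leb n]_v f (cons_rV (x, v)))%E.
Proof.
move=> intf; have /integrableP[mf foo] := intf.
have intfc : (mu \x leb n)%E.-integrable setT (f \o @cons_rV R n).
  apply/integrableP; split.
    by apply: measurableT_comp => //; exact: measurable_cons_rV.
  apply: le_lt_trans foo.
  rewrite (_ : (\int[leb n.+1]_x `|f x|)%E =
    \int[pushforward (mu \x leb n) (@cons_rV R n)]_x `|f x|)%E//.
  rewrite ge0_integral_pushforward//; first exact: measurable_cons_rV.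
  exact: measurableT_comp.
transitivity (\int[pushforward (mu \x leb n) (@cons_rV R n)]_y f y)%E; first by [].
rewrite integral_pushforward//; last exact: measurable_cons_rV.
by rewrite preimage_setT -integral12_prod_meas1.
Qed.

Lemma cons_rV_sub n (c : 'rV[R]_n.+1) (p : measurableTypeR R * 'rV[R]_n) :
  c - cons_rV p = cons_rV ((uncons_rV c).1 - p.1, (uncons_rV c).2 - p.2).
Proof.
apply/rowP => i; rewrite !mxE; case: (unliftP ord0 i) => [j ->|->]; rewrite /= ?mxE//.
Qed.

Lemma measurable_coord n i : measurable_fun setT (fun v : 'rV[R]_n => v ord0 i).
Proof. exact: (@measurable_rV_coord _ R n i). Qed.

Lemma measurable_rV_subl n (c : 'rV[R]_n) : measurable_fun setT (fun y : 'rV[R]_n => c - y).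
Proof.
apply: measurable_fun_rVP => i; under eq_fun do rewrite !mxE.
by apply: measurable_funB => //; exact: measurable_coord.
Qed.

Lemma measurable_rV_subr n (c : 'rV[R]_n) : measurable_fun setT (fun y : 'rV[R]_n => y - c).
Proof.
apply: measurable_fun_rVP => i; under eq_fun do rewrite !mxE.
by apply: measurable_funB => //; exact: measurable_coord.
Qed.

Lemma ge0_integral_rV_subl n (c : 'rV[R]_n) (f : 'rV[R]_n -> \bar R) :
  measurable_fun setT f -> (forall x, 0 <= f x)%E ->
  (\int[leb n]_y f (c - y)%R = \int[leb n]_y f y)%E.
Proof.
elim: n c f => [|n IH] c f mf f0.
  by apply: eq_integral => y _; congr f; apply/rowP => -[].
have mfc : measurable_fun setT (fun y : 'rV[R]_n.+1 => f (c - y)).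
  by apply: (measurableT_comp mf); exact: measurable_rV_subl.
have mfcons : measurable_fun setT (f \o @cons_rV R n).
  by apply: measurableT_comp => //; exact: measurable_cons_rV.
rewrite !ge0_integral_rVS//.
under eq_integral => x _.
  under eq_integral do rewrite cons_rV_sub/=.
  rewrite (IH _ (fun v => f (cons_rV ((uncons_rV c).1 - x, v))))//; last first.
    apply: (measurableT_comp mfcons).
    exact: (pair1_measurable ((uncons_rV c).1 - x)).
  over.
rewrite /=.
rewrite (@ge0_integral_subl R _ (fun x => \int[leb n]_v f (cons_rV (x, v)))%E)//.
- by apply: (measurable_fun_fubini_tonelli_F _ mfcons) => // z; exact: f0.
- by move=> x; exact: integral_ge0.
Qed.

Lemma integrable_rV_subl n (c : 'rV[R]_n) (f : 'rV[R]_n -> R) :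
  (leb n).-integrable setT (EFin \o f) -> (leb n).-integrable setT (EFin \o (fun y => f (c - y))).
Proof.
move=> /integrableP[mf foo]; apply/integrableP; split.
  by apply: (measurableT_comp mf); exact: measurable_rV_subl.
rewrite (@ge0_integral_rV_subl n c (fun y => `|(f y)%:E|)%E)//.
exact: measurableT_comp.
Qed.

Lemma Rintegral_rV_subl n (c : 'rV[R]_n) (f : 'rV[R]_n -> R) :
  measurable_fun setT f ->
  \int[leb n]_y f (c - y) = \int[leb n]_y f y.
Proof.
move=> mf; rewrite /Rintegral; congr fine.
have mEf : measurable_fun setT (EFin \o f) by exact/measurable_EFinP.
rewrite integralE [RHS]integralE; congr (_ - _)%E.
  rewrite -[fun x0 => (f (c - x0))%:E]/((EFin \o f) \o (fun y => c - y)) funepos_comp.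
  exact: ge0_integral_rV_subl (measurable_funepos mEf) _.
rewrite -[fun x0 => (f (c - x0))%:E]/((EFin \o f) \o (fun y => c - y)) funeneg_comp.
exact: ge0_integral_rV_subl (measurable_funeneg mEf) _.
Qed.

Lemma dotvC n (x y : 'rV[R]_n) : dotv x y = dotv y x.
Proof. by apply: eq_bigr => i _; rewrite mulrC. Qed.

Lemma dotv_ge0 n (x : 'rV[R]_n) : 0 <= dotv x x.
Proof. by apply: sumr_ge0 => i _; rewrite -expr2 sqr_ge0. Qed.

Lemma dotv0l n (x : 'rV[R]_n) : dotv 0 x = 0.
Proof. by rewrite /dotv big1// => i _; rewrite mxE mul0r. Qed.

Lemma dotvN n (w : 'rV[R]_n) : dotv (- w) (- w) = dotv w w.
Proof. by apply: eq_bigr => i _; rewrite !mxE mulrNN. Qed.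

Lemma dotvBr n (k x y : 'rV[R]_n) : dotv k (x - y) = dotv k x - dotv k y.
Proof.
by rewrite /dotv -sumrB; apply: eq_bigr => i _; rewrite !mxE mulrBr.
Qed.

Lemma dotvZ n (a : R) (x : 'rV[R]_n) : dotv (a *: x) (a *: x) = a ^+ 2 * dotv x x.
Proof. by rewrite /dotv mulr_sumr; apply: eq_bigr => i _; rewrite !mxE; ring. Qed.

Lemma dotv_eq0 n (x : 'rV[R]_n) : (dotv x x == 0) = (x == 0).
Proof.
apply/eqP/eqP => [/eqP|->]; last by rewrite /dotv big1// => i _; rewrite mxE mul0r.
rewrite /dotv psumr_eq0 => [/allP x0|i _]; last by rewrite -expr2 sqr_ge0.
apply/rowP => i; rewrite mxE; apply/eqP.
by have := x0 i (mem_index_enum _); rewrite /= mulf_eq0 orbb.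
Qed.

Lemma dotv_gt0 n (x : 'rV[R]_n) : (0 < dotv x x) = (x != 0).
Proof. by rewrite lt0r dotv_eq0 dotv_ge0 andbT. Qed.

Lemma dotv_cons n (y : 'rV[R]_n.+1) x v :
  dotv (cons_rV (x, v)) y = x * y ord0 ord0 + dotv v (uncons_rV y).2.
Proof.
rewrite /dotv big_ord_recl cons_rV0; congr (_ + _); apply: eq_bigr => i _.
by rewrite cons_rVS mxE.
Qed.

Lemma dotv_consS n x (v : 'rV[R]_n) : dotv (cons_rV (x, v)) (cons_rV (x, v)) = x ^+ 2 + dotv v v.
Proof.
rewrite dotv_cons cons_rV0 -expr2; congr (_ + _); congr dotv.
by apply/rowP => i; rewrite mxE cons_rVS.
Qed.

Lemma dotv_uncons n (y : 'rV[R]_n.+1) :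
  dotv y y = (y ord0 ord0) ^+ 2 + dotv (uncons_rV y).2 (uncons_rV y).2.
Proof. by rewrite /dotv big_ord_recl expr2; congr (_ + _); apply: eq_bigr => i _; rewrite !mxE. Qed.

Lemma measurable_dotv d (T : measurableType d) n (f g : T -> 'rV[R]_n) :
  measurable_fun setT f -> measurable_fun setT g ->
  measurable_fun setT (fun x => dotv (f x) (g x)).
Proof.
move=> mf mg; apply: measurable_sum => i; apply: measurable_funM.
  exact: (measurableT_comp (measurable_coord i) mf).
exact: (measurableT_comp (measurable_coord i) mg).
Qed.

Lemma measurable_dotv_id n : measurable_fun setT (fun x : 'rV[R]_n => dotv x x).
Proof. by apply: measurable_dotv. Qed.

Lemma measurable_dotv_gt n (c : R) : measurable [set y : 'rV[R]_n | c < dotv y y].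
Proof.
rewrite (_ : [set y | _] = [set: 'rV[R]_n] `&` (fun y => dotv y y) @^-1` `]c, +oo[%classic).
  by apply: measurable_dotv_id => //; exact: measurable_itv.
by rewrite setTI; apply/seteqP; split => y /=; rewrite in_itv/= andbT.
Qed.

Definition gauv n (a : R) (k : 'rV[R]_n) : R := expR (- (a * dotv k k)).

Lemma gauv_ge0 n a (k : 'rV[R]_n) : 0 <= gauv a k. Proof. exact: expR_ge0. Qed.

Lemma measurable_gauv n a : measurable_fun setT (@gauv n a).
Proof.
apply: measurableT_comp => //; apply: measurableT_comp => //.
by apply: measurable_funM => //; exact: measurable_dotv_id.
Qed.

Lemma gauv_cons n a x (v : 'rV[R]_n) : gauv a (cons_rV (x, v)) = gau a x * gauv a v.
Proof. by rewrite /gauv dotv_consS mulrDr opprD expRD. Qed.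

Lemma integrable_gauv n a : 0 < a -> (leb n).-integrable setT (EFin \o @gauv n a).
Proof.
move=> a0; apply/integrableP; split; first by apply/measurable_EFinP; exact: measurable_gauv.
under eq_integral do rewrite /= ger0_norm ?gauv_ge0//.
have H m : (\int[leb m]_x (gauv a x)%:E = (Num.sqrt (pi / a) ^+ m)%:E)%E.
  elim: m => [|m IH].
    rewrite /= integral_dirac//; last by apply/measurable_EFinP; exact: measurable_gauv.
    by rewrite diracT mul1e /gauv /dotv big_ord0 mulr0 oppr0 expR0.
  rewrite ge0_integral_rVS//; last first.
  - by move=> x; rewrite lee_fin gauv_ge0.
  - by apply/measurable_EFinP; exact: measurable_gauv.
  under eq_integral => x _.
    under eq_integral do rewrite gauv_cons EFinM.
    rewrite ge0_integralZl//; last first.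
    - by rewrite lee_fin gau_ge0.
    - by move=> y _; rewrite lee_fin gauv_ge0.
    - by apply/measurable_EFinP; exact: measurable_gauv.
    rewrite IH.
    over.
  rewrite /= ge0_integralZr//; last first.
  - by move=> *; rewrite lee_fin ?exprn_ge0// ?sqrtr_ge0// gau_ge0.
  - by apply/measurable_EFinP; exact: measurable_gau.
  rewrite exprS EFinM; congr (_ * _)%E.
  rewrite -(Rintegral_gau a0) /Rintegral fineK//.
  exact: (integrable_fin_num measurableT (integrable_gau a0)).
by rewrite H ltry.
Qed.

Lemma integrable_cos_gauv n a th (y : 'rV[R]_n) : 0 < a ->
  (leb n).-integrable setT (EFin \o (fun k => cos (dotv k y + th) * gauv a k)).
Proof.
move=> a0; apply: (Rle_integrable _ _ _ (integrable_gauv n a0)) => //.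
  apply: measurable_funM; last exact: measurable_gauv.
  apply: measurableT_comp; first exact: continuous_measurable_fun (@continuous_cos R).
  by apply: measurable_funD => //; exact: measurable_dotv.
by move=> k _; rewrite normrM (ger0_norm (gauv_ge0 _ _)) ler_piMl ?gauv_ge0// cos_max.
Qed.

(** Induction on the dimension: integrating the other coordinates first, the
    contribution of the first one to dotv k y is absorbed by the phase. *)
Lemma gauv_fourier n a th (y : 'rV[R]_n) : 0 < a ->
  \int[leb n]_k (cos (dotv k y + th) * gauv a k) =
  cos th * (Num.sqrt (pi / a) ^+ n * expR (- (dotv y y / (4 * a)))).
Proof.
move=> a0; elim: n th y => [|n IH] th y.
  rewrite /Rintegral /= integral_dirac//; last first.
    apply/measurable_EFinP; apply: measurable_funM; last exact: measurable_gauv.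
    apply: measurableT_comp; first exact: continuous_measurable_fun (@continuous_cos R).
    by apply: measurable_funD => //; exact: measurable_dotv.
  rewrite diracT mul1e /gauv /dotv !big_ord0 mulr0 oppr0 expR0.
  rewrite mul0r.
  by rewrite /= oppr0 expR0 add0r !mulr1.
rewrite {1}/Rintegral integral_rVS; last exact: integrable_cos_gauv.
under eq_integral => x _.
  under eq_integral do rewrite dotv_cons gauv_cons.
  rewrite (_ : (\int[leb n]_v _)%E = (gau a x *
     (cos (x * y ord0 ord0 + th) * (Num.sqrt (pi / a) ^+ n * expR (- (dotv (uncons_rV y).2 (uncons_rV y).2 / (4 * a))))))%:E); last first.
    rewrite -IH -RintegralZl//; last exact: integrable_cos_gauv.
    rewrite /Rintegral fineK.
      by apply: eq_integral => v _; congr EFin; rewrite mulrCA; congr (_ * (cos _ * _)); ring.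
    apply: (integrable_fin_num measurableT).
    by have /(integrableZl measurableT (gau a x)) := @integrable_cos_gauv n a (x * y ord0 ord0 + th) (uncons_rV y).2 a0.
  over.
rewrite -/(Rintegral _ _ _) /=.
under eq_Rintegral do rewrite mulrCA mulrA.
rewrite RintegralZr//; last exact: integrable_cos_gau.
rewrite -/(gau_cosine a th (y ord0 ord0)) gau_cosineE// dotv_uncons.
set D := dotv (uncons_rV y).2 _.
have -> : - ((y ord0 ord0 ^+ 2 + D) / (4 * a)) = - (y ord0 ord0 ^+ 2 / (4 * a)) + - (D / (4 * a)) by ring.
rewrite expRD [_ ^+ n.+1]exprS.
by ring.
Qed.

Lemma Rintegral_gauv n a : 0 < a -> \int[leb n]_k gauv a k = Num.sqrt (pi / a) ^+ n.
Proof.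
move=> a0; have := @gauv_fourier n a 0 0 a0.
have d0 (k : 'rV[R]_n) : dotv k 0 = 0 by rewrite dotvC dotv0l.
rewrite cos0 mul1r d0 mul0r oppr0 expR0 mulr1 => <-.
by apply: eq_Rintegral => k _; rewrite d0 addr0 cos0 mul1r.
Qed.

End rV.

(** * Radially convex functions and Gaussian regularisation *)

Section radconv.
Variables (R : realType) (n : nat).
Implicit Types (A : set 'rV[R]_n) (f g : 'rV[R]_n -> R).

(** [f] is a nonnegative, nonincreasing and convex function of |x|^2 on [A].
    Comparing points through their squared norms avoids the choice of a profile
    on the half-line, and is stable under pointwise limits. *)
Definition radconv A f : Prop := [/\ forall x, A x -> 0 <= f x,
  forall x y, A x -> A y -> dotv x x <= dotv y y -> f y <= f x &
  forall x y z t, A x -> A y -> A z -> 0 <= t <= 1 ->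
    dotv z z = (1 - t) * dotv x x + t * dotv y y ->
    f z <= (1 - t) * f x + t * f y].

Lemma radconvD A f g : radconv A f -> radconv A g -> radconv A (fun x => f x + g x).
Proof.
move=> [f0 fd fc] [g0 gd gc]; split.
- by move=> x Ax; rewrite addr_ge0 ?f0 ?g0.
- by move=> x y Ax Ay xy; rewrite lerD ?fd ?gd.
- move=> x y z t Ax Ay Az t01 zE.
  by have := fc _ _ _ _ Ax Ay Az t01 zE; have := gc _ _ _ _ Ax Ay Az t01 zE; lra.
Qed.

Lemma radconvZ A c f : 0 <= c -> radconv A f -> radconv A (fun x => c * f x).
Proof.
move=> c0 [f0 fd fc]; split.
- by move=> x Ax; rewrite mulr_ge0 ?f0.
- by move=> x y Ax Ay xy; rewrite ler_wpM2l ?fd.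
- move=> x y z t Ax Ay Az t01 zE.
  rewrite mulrCA (mulrCA t) -mulrDr ler_wpM2l//; exact: fc.
Qed.

Lemma radconv_lim A (f_ : nat -> 'rV[R]_n -> R) f : (forall m, radconv A (f_ m)) ->
  (forall x, A x -> f_ m x @[m --> \oo] --> f x) -> radconv A f.
Proof.
move=> rf ff; split.
- move=> x Ax; apply: (cvgr_to_ge (ff x Ax)); apply: nearW => m.
  by have [+ _ _] := rf m; exact.
- move=> x y Ax Ay xy; apply: (ler_cvg_to (ff y Ay) (ff x Ax)); apply: nearW => m.
  by have [_ + _] := rf m; exact.
- move=> x y z t Ax Ay Az t01 zE.
  have L : (1 - t) * f_ m x + t * f_ m y @[m --> \oo] --> (1 - t) * f x + t * f y.
    by apply: cvgD; apply: cvgMl_tmp; exact: ff.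
  apply: (ler_cvg_to (ff z Az) L); apply: nearW => m.
  by have [_ _] := rf m; exact.
Qed.

Lemma radconvS A B f : A `<=` B -> radconv B f -> radconv A f.
Proof.
move=> AB [f0 fd fc]; split.
- by move=> x /AB; exact: f0.
- by move=> x y /AB Ax /AB Ay; exact: fd.
- by move=> x y z t /AB Ax /AB Ay /AB Az; exact: fc.
Qed.

Lemma expR_convex (u v t : R) : 0 <= t <= 1 ->
  expR ((1 - t) * u + t * v) <= (1 - t) * expR u + t * expR v.
Proof.
move=> /andP[t0 t1]; set m := (1 - t) * u + t * v.
have tangent w : expR m * (1 + (w - m)) <= expR w.
  rewrite [leRHS](_ : _ = expR m * expR (w - m)); last by rewrite -expRD addrC subrK.
  by rewrite ler_wpM2l ?expR_ge0// expR_ge1Dx.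
have h1 : (1 - t) * (expR m * (1 + (u - m))) <= (1 - t) * expR u.
  by rewrite ler_wpM2l// subr_ge0.
have h2 : t * (expR m * (1 + (v - m))) <= t * expR v by rewrite ler_wpM2l.
apply: (le_trans _ (lerD h1 h2)).
rewrite [leRHS](_ : _ = expR m * (1 + ((1 - t) * u + t * v - m))); last by ring.
by rewrite -/m subrr addr0 mulr1.
Qed.

Lemma radconv_gauss (c : R) : 0 <= c -> radconv setT (fun y => expR (- (c * dotv y y))).
Proof.
move=> c0; split.
- by move=> x _; exact: expR_ge0.
- by move=> x y _ _ xy; rewrite ler_expR lerN2 ler_wpM2l.
- move=> x y z t _ _ _ t01 ->; apply: le_trans (expR_convex _ _ t01).
  by rewrite le_eqVlt; apply/orP; left; apply/eqP; congr expR; ring.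
Qed.
End radconv.

Section transform.
Variables (R : realType) (n : nat).
Notation leb := (lebesgue_rV R n).
Implicit Types (phi : R -> R) (y k : 'rV[R]_n) (e : R).

Lemma cm_measurable phi : cm phi -> measurable_fun setT (fun k : 'rV[R]_n => phi (dotv k k)).
Proof.
elim=> {phi} [r r0|f g _ IHf _ IHg|c f c0 _ IH|f_ f _ IH ff].
- exact: measurable_gauv.
- exact: measurable_funD.
- exact: measurable_funM.
- apply: (measurable_fun_cvg IH) => k _; apply: ff; exact: dotv_ge0.
Qed.

(** The inverse Fourier integral of phi(|k|^2), up to a constant, made
    convergent for every bounded [phi] by a Gaussian factor. *)
Definition gauss_cosine e phi y : R := \int[leb]_k (cos (dotv k y) * (gauv e k * phi (dotv k k))).

Lemma gauss_cosine_bound phi y e k : cm phi ->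
  `|cos (dotv k y) * (gauv e k * phi (dotv k k))| <= phi 0 * gauv e k.
Proof.
move=> cp; have /andP[p0 p1] := cm_bounds cp (dotv_ge0 k).
rewrite normrM (ger0_norm (mulr_ge0 (gauv_ge0 _ _) p0)) mulrC (mulrC _ (phi _)).
rewrite -[leRHS]mulr1 ler_pM ?mulr_ge0 ?gauv_ge0// ?cos_max//.
by rewrite ler_wpM2r ?gauv_ge0.
Qed.

Lemma gauss_cosine_measurable phi y e : cm phi ->
  measurable_fun setT (fun k => cos (dotv k y) * (gauv e k * phi (dotv k k))).
Proof.
move=> cp; apply: measurable_funM.
  apply: measurableT_comp; first exact: continuous_measurable_fun (@continuous_cos R).
  by apply: measurable_dotv.
by apply: measurable_funM; [exact: measurable_gauv|exact: cm_measurable].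
Qed.

Lemma integrable_scale_gauv (c e : R) : 0 < e -> leb.-integrable setT (EFin \o (fun k => c * gauv e k)).
Proof. by move=> e0; have /(integrableZl measurableT c) := @integrable_gauv R n e e0. Qed.

Lemma gauss_cosine_integrable phi y e : 0 < e -> cm phi ->
  leb.-integrable setT (EFin \o (fun k => cos (dotv k y) * (gauv e k * phi (dotv k k)))).
Proof.
move=> e0 cp; apply: (Rle_integrable _ _ _ (integrable_scale_gauv (phi 0) e0)) => //.
  exact: gauss_cosine_measurable.
by move=> k _; exact: gauss_cosine_bound.
Qed.

(** If [phi] is a decaying exponential the transform is a Gaussian in y, a
    convex nonincreasing function of |y|^2; the general case follows by
    induction on complete monotonicity. *)
Lemma cm_radconv phi e : 0 < e -> cm phi -> radconv setT (gauss_cosine e phi).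
Proof.
move=> e0 cp; elim: cp => {phi} [r r0|f g cf IHf cg IHg|c f c0 cf IH|f_ f cf_ IH ff].
- have er : 0 < e + r by rewrite ltr_pwDl.
  rewrite (_ : gauss_cosine _ _ = fun y => Num.sqrt (pi / (e + r)) ^+ n * expR (- ((4 * (e + r))^-1 * dotv y y))).
    apply: radconvZ; first by rewrite exprn_ge0// sqrtr_ge0.
    by apply: radconv_gauss; rewrite invr_ge0 mulr_ge0// ltW.
  apply/funext => y; have := @gauv_fourier R n (e + r) 0 y er.
  rewrite cos0 mul1r (mulrC _ (dotv y y)) => <-.
  apply: eq_Rintegral => k _; rewrite addr0; congr (_ * _).
  by rewrite -expRD; congr expR; ring.
- rewrite (_ : gauss_cosine _ _ = fun y => gauss_cosine e f y + gauss_cosine e g y); first exact: radconvD.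
  apply/funext => y; rewrite -RintegralD//; [|exact: gauss_cosine_integrable|exact: gauss_cosine_integrable].
  by apply: eq_Rintegral => k _; ring.
- rewrite (_ : gauss_cosine _ _ = fun y => c * gauss_cosine e f y); first exact: radconvZ.
  apply/funext => y; rewrite -RintegralZl//; last exact: gauss_cosine_integrable.
  by apply: eq_Rintegral => k _; ring.
- apply: (radconv_lim IH) => y _.
  have [M M0] : exists M : R, forall m, f_ m 0 <= M.
    have : cvgn (fun m => f_ m 0) by apply/cvg_ex; exists (f 0); exact: ff.
    move=> /cvg_has_ub [M HM]; exists M => m; apply: le_trans (ler_norm _) _.
    by apply: HM; exists m.
  have [|||||_] := @Rdominated_cvg _ _ _ leb setT
    (fun m k => cos (dotv k y) * (gauv e k * f_ m (dotv k k)))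
    (fun k => cos (dotv k y) * (gauv e k * f (dotv k k))) (fun k => M * gauv e k).
  + exact: measurableT.
  + by move=> m; exact: gauss_cosine_measurable.
  + by move=> k _; apply: cvgMl_tmp; apply: cvgMl_tmp; apply: ff; exact: dotv_ge0.
  + exact: integrable_scale_gauv.
  + move=> m k _; apply: (le_trans (gauss_cosine_bound _ _ _ (cf_ m))).
    by rewrite ler_wpM2r ?gauv_ge0.
  + exact.
Qed.

End transform.

Section inversion.
Variables (R : realType) (n : nat).
Notation leb := (lebesgue_rV R n).
Variables (F : 'rV[R]_n -> R) (phi : R -> R).
Hypothesis intF : leb.-integrable setT (EFin \o F).
Hypothesis cosF : forall k, \int[leb]_x (cos (dotv k x) * F x) = phi (dotv k k).
Hypothesis sinF : forall k, \int[leb]_x (sin (dotv k x) * F x) = 0.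

Let mF : measurable_fun setT F.
Proof. by have /integrableP[/measurable_EFinP] := intF. Qed.

Lemma integrable_trigF (g : R -> R) k : continuous g -> (forall u, `|g u| <= 1) ->
  leb.-integrable setT (EFin \o (fun x => g (dotv k x) * F x)).
Proof.
move=> cg g1; apply: (Rle_integrable _ _ _ (integrable_norm intF)) => //.
  apply: measurable_funM => //; apply: measurableT_comp.
    exact: continuous_measurable_fun.
  exact: measurable_dotv.
by move=> x _; rewrite normrM ler_piMl.
Qed.

(** Both sides are double integrals of F(x) cos(k.(x - y)) exp(- e |k|^2):
    integrating in k first gives the left-hand side, in x first the right-hand
    side. *)
Lemma inversion_fubini e y : 0 < e ->
  Num.sqrt (pi / e) ^+ n * \int[leb]_x (F x * gauv ((4 * e)^-1) (x - y)) = gauss_cosine e phi y.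
Proof.
move=> e0.
pose f (p : 'rV[R]_n * 'rV[R]_n) := F p.1 * (cos (dotv p.2 (p.1 - y)) * gauv e p.2).
have mf : measurable_fun setT f.
  apply: measurable_funM; first exact: (measurableT_comp mF measurable_fst).
  apply: measurable_funM; last exact: (measurableT_comp (measurable_gauv e) measurable_snd).
  apply: measurableT_comp; first exact: continuous_measurable_fun (@continuous_cos R).
  apply: measurable_dotv => //.
  exact: (measurableT_comp (measurable_rV_subr y) measurable_fst).
have intf : (leb \x leb)%E.-integrable setT (EFin \o f).
  apply/integrable12ltyP; first exact/measurable_EFinP.
  apply: (@le_lt_trans _ _ (\int[leb]_x (`|F x| * \int[leb]_k gauv e k)%:E)%E).
    apply: ge0_le_integral => //.
    - by move=> x _; apply: integral_ge0.
    - by apply: (@measurable_fun_fubini_tonelli_F _ _ _ _ _ leb (fun p => `|(f p)%:E|%E)) => //; apply: measurableT_comp => //; exact/measurable_EFinP.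
    - by apply/measurable_EFinP; apply: measurable_funM => //; exact: (measurableT_comp (@normr_measurable _ setT) mF).
    move=> x _; rewrite EFinM.
    rewrite /Rintegral fineK; last exact: (integrable_fin_num measurableT (integrable_gauv n e0)).
    rewrite -ge0_integralZl//.
    - apply: ge0_le_integral => //.
      + by apply: measurableT_comp => //; apply/measurable_EFinP; exact: (measurableT_comp mf (pair1_measurable x)).
      + by apply/measurable_EFinP; apply: measurable_funM => //; exact: measurable_gauv.
      move=> k _; rewrite lee_fin /f/= !normrM ler_wpM2l//.
      by rewrite (ger0_norm (gauv_ge0 _ _)) ler_piMl ?gauv_ge0// cos_max.
    - by apply/measurable_EFinP; exact: measurable_gauv.
    - by move=> k _; rewrite lee_fin gauv_ge0.
  under eq_integral do rewrite mulrC EFinM.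
  rewrite ge0_integralZl//.
  - rewrite lte_mul_pinfty// ?lee_fin ?Rintegral_ge0//; first by move=> k _; exact: gauv_ge0.
    by have /integrableP[_] := intF.
  - by apply/measurable_EFinP; exact: (measurableT_comp (@normr_measurable _ setT) mF).
  - by rewrite lee_fin Rintegral_ge0// => k _; exact: gauv_ge0.
have in1 x : leb.-integrable setT (EFin \o (fun k => cos (dotv k (x - y)) * gauv e k)).
  have := @integrable_cos_gauv R n e 0 (x - y) e0.
  by congr (_.-integrable _ _); apply/funext => k /=; rewrite addr0.
have E1 : (\int[leb]_x \int[leb]_k (f (x, k))%:E)%E =
    (\int[leb]_x (Num.sqrt (pi / e) ^+ n * (F x * gauv ((4 * e)^-1) (x - y)))%:E)%E.
  apply: eq_integral => x _.
  have := @gauv_fourier R n e 0 (x - y) e0.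
  rewrite cos0 mul1r => H.
  have -> : Num.sqrt (pi / e) ^+ n * (F x * gauv (4 * e)^-1 (x - y)) =
      F x * \int[leb]_k (cos (dotv k (x - y) + 0) * gauv e k).
    by rewrite H /gauv (mulrC _ (dotv _ _)); ring.
  rewrite EFinM /Rintegral fineK.
    rewrite -integralZl//; first by apply: eq_integral => k _; rewrite addr0.
    by apply: integrable_cos_gauv.
  by apply: (integrable_fin_num measurableT); apply: integrable_cos_gauv.
have E2 : (\int[leb]_k \int[leb]_x (f (x, k))%:E)%E =
    (\int[leb]_k (cos (dotv k y) * (gauv e k * phi (dotv k k)))%:E)%E.
  apply: eq_integral => k _.
  have ic := integrable_trigF k (@continuous_cos R) (@cos_max R).
  have is_ := integrable_trigF k (@continuous_sin R) (@sin_max R).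
  have ic' : leb.-integrable setT (EFin \o (fun x => cos (dotv k y) * gauv e k * (cos (dotv k x) * F x))).
    by have /(integrableZl measurableT (cos (dotv k y) * gauv e k)) := ic.
  have is' : leb.-integrable setT (EFin \o (fun x => sin (dotv k y) * gauv e k * (sin (dotv k x) * F x))).
    by have /(integrableZl measurableT (sin (dotv k y) * gauv e k)) := is_.
  rewrite [LHS](_ : _ = (\int[leb]_x (cos (dotv k y) * gauv e k * (cos (dotv k x) * F x) +
     sin (dotv k y) * gauv e k * (sin (dotv k x) * F x))%:E)%E); last first.
    by apply: eq_integral => x _; congr EFin; rewrite /f/= dotvBr cosB; ring.
  rewrite -[LHS]fineK; last first.
    by apply: (integrable_fin_num measurableT); have := integrableD measurableT ic' is'.
  congr EFin; rewrite -/(Rintegral _ _ _) RintegralD// RintegralZl// RintegralZl//.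
  by rewrite cosF sinF mulr0 addr0 -mulrA.
rewrite -RintegralZl//; last first.
  apply: (Rle_integrable _ _ _ (integrable_norm intF)) => //.
    apply: measurable_funM => //; apply: (measurableT_comp (measurable_gauv _)).
    exact: measurable_rV_subr.
  move=> x _; rewrite normrM ler_piMr// ger0_norm ?gauv_ge0//.
  by rewrite expR_le1 oppr_le0 mulr_ge0 ?dotv_ge0// invr_ge0 mulr_ge0// ltW.
rewrite /gauss_cosine /Rintegral; congr fine.
transitivity (\int[leb]_x \int[leb]_k (f (x, k))%:E)%E; first exact: (esym E1).
transitivity (\int[leb]_k \int[leb]_x (f (x, k))%:E)%E; last exact: E2.
exact: (@Fubini _ _ _ _ _ leb leb (EFin \o f) intf).
Qed.

End inversion.

(** * Fourier inversion *)

Lemma cvg_pow_expR (R : realType) (n : nat) (c : R) : 0 < c ->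
  m.+1%:R ^+ n * expR (- (m.+1%:R * c)) @[m --> \oo] --> (0 : R).
Proof.
move=> c0.
apply: (@squeeze_cvgr _ _ _ _ (fun=> 0) (fun m => (n.+1`!%:R / c ^+ n.+1) * m.+1%:R^-1)).
- apply: nearW => m; rewrite mulr_ge0 ?exprn_ge0 ?expR_ge0//=.
  have mc : 0 < m.+1%:R * c by rewrite mulr_gt0.
  have := expR_ge1Dxn n (ltW mc); set X := m.+1%:R * c in mc *.
  have f0 : 0 < n.+1`!%:R :> R by rewrite ltr0n fact_gt0.
  move=> h; rewrite expRN ler_pdivrMr ?expR_gt0//.
  have h2 : X ^+ n.+1 / n.+1`!%:R <= expR X by apply: le_trans h; rewrite lerDr.
  apply: (@le_trans _ _ (n.+1`!%:R / c ^+ n.+1 / m.+1%:R * (X ^+ n.+1 / n.+1`!%:R))).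
    have key (p q g C : R) : p != 0 -> g != 0 -> C != 0 -> q = g / C / p * (p * q * C / g).
      by move=> p0 g0 C0; field; rewrite p0 g0 C0.
    rewrite le_eqVlt; apply/orP; left; apply/eqP.
    rewrite /X exprMn [_ ^+ n.+1 in X in _ * (X * _ / _)]exprS; apply: key.
    - by rewrite pnatr_eq0.
    - by rewrite gt_eqF.
    - by rewrite expf_neq0// gt_eqF.
  by rewrite ler_wpM2l// !divr_ge0// exprn_ge0// ltW.
- exact: cvg_cst.
- by rewrite -(mulr0 (n.+1`!%:R / c ^+ n.+1)); apply: cvgMl_tmp; exact: cvg_harmonic.
Qed.

Section approx_identity.
Variables (R : realType) (n : nat).
Notation leb := (lebesgue_rV R n).
Variable F : 'rV[R]_n -> R.
Hypothesis intF : leb.-integrable setT (EFin \o F).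

Let mF : measurable_fun setT F.
Proof. by have /integrableP[/measurable_EFinP] := intF. Qed.

Lemma continuous_dotv_ball (y : 'rV[R]_n) (e : R) : {for y, continuous F} -> 0 < e ->
  exists2 d : R, 0 < d & forall w, dotv w w < d ^+ 2 -> `|F (y - w) - F y| <= e.
Proof.
move=> /cvgrPdist_le/(_ _) H e0; have /nbhs_ballP[d /= d0 dF] := H e e0.
exists d => // w wd; rewrite distrC; apply: dF; split => // i j.
rewrite /ball/= !mxE opprB addrC subrK ord1.
rewrite -(@ltr_pXn2r _ 2)// ?nnegrE ?(ltW d0)//.
apply: le_lt_trans wd; rewrite real_normK ?num_real// /dotv (bigD1 j)//= -expr2 lerDl.
by apply: sumr_ge0 => k _; rewrite -expr2 sqr_ge0.
Qed.

Lemma shift_gauv (a : R) (y : 'rV[R]_n) :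
  \int[leb]_x (F x * gauv a (x - y)) = \int[leb]_w (F (y - w) * gauv a w).
Proof.
rewrite -(@Rintegral_rV_subl R n y (fun x => F x * gauv a (x - y))); last first.
  apply: measurable_funM => //; apply: (measurableT_comp (measurable_gauv _)).
  exact: measurable_rV_subr.
apply: eq_Rintegral => w _; congr (_ * _).
have -> : y - w - y = - w by rewrite addrAC subrr sub0r.
by rewrite /gauv dotvN.
Qed.

Lemma gauvD (a b : R) (w : 'rV[R]_n) : gauv (a + b) w = gauv a w * gauv b w.
Proof. by rewrite /gauv -expRD; congr expR; ring. Qed.

Lemma gauv_tail (a c : R) (w : 'rV[R]_n) : 0 <= a -> c <= dotv w w -> gauv a w <= expR (- (a * c)).
Proof. by move=> a0 cw; rewrite ler_expR lerN2 ler_wpM2l. Qed.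

(** Where |w| < d the oscillation of [F] is at most [e]. Elsewhere F(y - w) is
    controlled by the integral of |F| times the largest value of the Gaussian,
    and F(y) by a Gaussian tail, half of whose exponent is kept for
    integrability. *)
Lemma approx_bound (y : 'rV[R]_n) (e d a : R) : 0 < a ->
  (forall w, dotv w w < d ^+ 2 -> `|F (y - w) - F y| <= e) -> 0 <= e ->
  `|\int[leb]_x (F x * gauv a (x - y)) - Num.sqrt (pi / a) ^+ n * F y| <=
  e * Num.sqrt (pi / a) ^+ n + expR (- (a * d ^+ 2)) * (\int[leb]_x `|F x|)
   + `|F y| * expR (- (a / 2 * d ^+ 2)) * Num.sqrt (pi / (a / 2)) ^+ n.
Proof.
move=> a0 Fd e0; have a20 : 0 < a / 2 by rewrite divr_gt0.
have iFs := integrable_rV_subl y intF.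
have ig : leb.-integrable setT (EFin \o (fun w => F (y - w) * gauv a w)).
  apply: (Rle_integrable _ _ _ (integrable_norm iFs)) => //.
    apply: measurable_funM; last exact: measurable_gauv.
    by have /integrableP[/measurable_EFinP] := iFs.
  move=> w _; rewrite normrM ler_piMr// ger0_norm ?gauv_ge0//.
  by rewrite expR_le1 oppr_le0 mulr_ge0 ?dotv_ge0// ltW.
have iyg := integrable_scale_gauv n (F y) a0.
have E0 : Num.sqrt (pi / a) ^+ n * F y = \int[leb]_w (F y * gauv a w).
  by rewrite RintegralZl//; [rewrite Rintegral_gauv// mulrC|exact: integrable_gauv].
rewrite shift_gauv E0 -RintegralB//.
have iB : leb.-integrable setT (EFin \o (fun w => F (y - w) * gauv a w - F y * gauv a w)).
  by have := integrableB measurableT ig iyg.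
apply: (le_trans (le_normr_Rintegral measurableT iB)).
pose B w := e * gauv a w + expR (- (a * d ^+ 2)) * `|F (y - w)| +
   `|F y| * expR (- (a / 2 * d ^+ 2)) * gauv (a / 2) w.
have iB1 := integrable_scale_gauv n e a0.
have iB2 : leb.-integrable setT (EFin \o (fun w => expR (- (a * d ^+ 2)) * `|F (y - w)|)).
  by have /(integrableZl measurableT (expR (- (a * d ^+ 2)))) := integrable_norm iFs.
have iB3 := integrable_scale_gauv n (`|F y| * expR (- (a / 2 * d ^+ 2))) a20.
have iB12 : leb.-integrable setT (EFin \o (fun w => e * gauv a w + expR (- (a * d ^+ 2)) * `|F (y - w)|)).
  by have := integrableD measurableT iB1 iB2.
have iBB : leb.-integrable setT (EFin \o B).
  by have := integrableD measurableT iB12 iB3.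
have -> : e * Num.sqrt (pi / a) ^+ n + expR (- (a * d ^+ 2)) * (\int[leb]_x `|F x|)
   + `|F y| * expR (- (a / 2 * d ^+ 2)) * Num.sqrt (pi / (a / 2)) ^+ n = \int[leb]_w B w.
  rewrite /B RintegralD// RintegralD// RintegralZl//; last exact: integrable_gauv.
  rewrite RintegralZl//; last exact: integrable_norm iFs.
  rewrite RintegralZl//; last exact: integrable_gauv.
  rewrite !Rintegral_gauv// (@Rintegral_rV_subl R n y (fun x => `|F x|))//.
  exact: (measurableT_comp (@normr_measurable _ setT) mF).
apply: le_Rintegral => //; first exact: integrable_norm iB.
move=> w _; rewrite -mulrBl normrM (ger0_norm (gauv_ge0 _ _)) /B.
have [wd|wd] := ltP (dotv w w) (d ^+ 2).
  rewrite -addrA ler_wpDr ?ler_wpM2r ?gauv_ge0 ?Fd//.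
  by rewrite addr_ge0 ?mulr_ge0 ?expR_ge0.
apply: (@le_trans _ _ (`|F (y - w)| * gauv a w + `|F y| * gauv a w)).
  by rewrite -mulrDl ler_wpM2r ?gauv_ge0// ler_normB.
apply: lerD.
  rewrite -[leLHS]add0r lerD ?mulr_ge0 ?gauv_ge0// mulrC ler_wpM2r//.
  by apply: gauv_tail => //; exact: ltW.
rewrite -mulrA ler_wpM2l// {1}(_ : a = a / 2 + a / 2); last by field.
by rewrite gauvD ler_wpM2r ?gauv_ge0// gauv_tail// ltW.
Qed.

Lemma approx_identity (y : 'rV[R]_n) : {for y, continuous F} ->
  (Num.sqrt (pi / m.+1%:R) ^+ n)^-1 * \int[leb]_x (F x * gauv m.+1%:R (x - y))
    @[m --> \oo] --> F y.
Proof.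
move=> cF; apply/cvgrPdist_le => e e0.
have [|d d0 Fd] := @continuous_dotv_ball y (e / 2) cF; first by rewrite divr_gt0.
pose K1 := \int[leb]_x `|F x|.
have K10 : 0 <= K1 by apply: Rintegral_ge0.
have d20 : 0 < d ^+ 2 by rewrite exprn_gt0.
have d220 : 0 < d ^+ 2 / 2 by rewrite divr_gt0.
pose r m := K1 * (m.+1%:R ^+ n * expR (- (m.+1%:R * d ^+ 2))) +
  `|F y| * Num.sqrt 2 ^+ n * (m.+1%:R ^+ 0 * expR (- (m.+1%:R * (d ^+ 2 / 2)))).
have r0 : r m @[m --> \oo] --> (0 : R).
  have : r m @[m --> \oo] --> K1 * 0 + `|F y| * Num.sqrt 2 ^+ n * 0.
    by apply: cvgD; apply: cvgMl_tmp; exact: cvg_pow_expR.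
  by rewrite !mulr0 addr0.
have e20 : 0 < e / 2 by rewrite divr_gt0.
have /cvgrPdist_le/(_ _ e20) near1 := r0.
near=> m.
have rm : r m <= e / 2.
  have : `|0 - r m| <= e / 2 by near: m; exact: near1.
  by rewrite sub0r normrN => /(le_trans (ler_norm _)).
set a := m.+1%:R; have a0 : 0 < a :> R by [].
have a1 : 1 <= a :> R by rewrite ler1n.
set S := Num.sqrt (pi / a) ^+ n.
have S0 : 0 < S by rewrite exprn_gt0// sqrtr_gt0 divr_gt0// pi_gt0.
have := approx_bound a0 Fd (ltW e20); rewrite -/S -/K1 => Hb.
rewrite distrC -(ler_pM2l S0) -{1}(ger0_norm (ltW S0)) -normrM mulrBr mulVKf ?gt_eqF//.
apply: (le_trans Hb).
have S2 : Num.sqrt (pi / (a / 2)) ^+ n = Num.sqrt 2 ^+ n * S.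
  rewrite -exprMn -sqrtrM//; congr (Num.sqrt _ ^+ _); field; rewrite gt_eqF//.
have Sinv : 1 <= S * a ^+ n.
  rewrite /S -exprMn; apply: exprn_ege1.
  have aE : a = Num.sqrt (a ^+ 2) :> R by rewrite sqrtr_sqr ger0_norm// ltW.
  rewrite {2}aE -sqrtrM ?divr_ge0 ?(ltW a0) ?pi_ge0// -[leLHS]sqrtr1 ler_wsqrtr//.
  rewrite (_ : pi / a * a ^+ 2 = pi * a); last by field; rewrite gt_eqF.
  have p2 := pi_ge2 R.
  by rewrite -[leLHS]mulr1 ler_pM// (le_trans _ p2)// ler1n.
have aa : a / 2 * d ^+ 2 = a * (d ^+ 2 / 2) by ring.
rewrite S2 aa [X in _ <= S * X](_ : e = e / 2 + e / 2); last by field.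
rewrite mulrDr -addrA; apply: lerD; first by rewrite mulrC.
apply: (le_trans _ (ler_wpM2l (ltW S0) rm)); rewrite /r -/a expr0 mul1r mulrDr.
apply: lerD; last first.
  by rewrite le_eqVlt; apply/orP; left; apply/eqP; ring.
rewrite [leRHS](_ : _ = (expR (- (a * d ^+ 2)) * K1) * (S * a ^+ n)); last by ring.
by rewrite ler_peMr// mulr_ge0// expR_ge0.
Unshelve. all: by end_near. Qed.

End approx_identity.

Section inversion_radconv.
Variables (R : realType) (n : nat).
Notation leb := (lebesgue_rV R n).

(** The left-hand side of [inversion_fubini] is, once normalised, an
    approximation of F(y) as the Gaussian concentrates; radial convexity of the
    right-hand side passes to the limit. Continuity away from the origin
    makes the limit equal to F(y) at every such point, not just almost
    everywhere. *)
Lemma inversion_radconv (F : 'rV[R]_n -> R) (phi : R -> R) :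
  leb.-integrable setT (EFin \o F) ->
  (forall k, \int[leb]_x (cos (dotv k x) * F x) = phi (dotv k k)) ->
  (forall k, \int[leb]_x (sin (dotv k x) * F x) = 0) ->
  cm phi -> (forall x, x != 0 -> {for x, continuous F}) ->
  radconv [set x | x != 0] F.
Proof.
move=> intF cosF sinF cp cF.
(* chosen so that the Gaussian on the F side has parameter m.+1 *)
pose e (m : nat) : R := (4 * m.+1%:R)^-1.
have e0 m : 0 < e m by rewrite invr_gt0 mulr_gt0.
have eE m : (4 * e m)^-1 = m.+1%:R by rewrite /e invfM invrK mulKf.
pose c m := (Num.sqrt (pi / m.+1%:R) ^+ n)^-1 * (Num.sqrt (pi / e m) ^+ n)^-1 : R.
apply: (@radconv_lim _ _ _ (fun m y => c m * gauss_cosine (e m) phi y)).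
  move=> m; apply: radconvZ.
    by rewrite mulr_ge0// invr_ge0 exprn_ge0// sqrtr_ge0.
  exact: (radconvS (@subsetT _ _) (cm_radconv _ (e0 m) cp)).
move=> y y0.
rewrite (_ : (fun m => c m * gauss_cosine (e m) phi y) = (fun m => (Num.sqrt (pi / m.+1%:R) ^+ n)^-1 *
    \int[leb]_x (F x * gauv m.+1%:R (x - y)))).
  exact: (approx_identity intF (cF y y0)).
apply/funext => m; rewrite -(inversion_fubini intF cosF sinF y (e0 m)) eE /c.
by rewrite -mulrA mulKf// gt_eqF// exprn_gt0// sqrtr_gt0 divr_gt0// pi_gt0.
Qed.

End inversion_radconv.

(** * Two-sided decay of a radially nonincreasing function *)

Section box.
Variables (R : realType) (n : nat).
Notation leb := (lebesgue_rV R n).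

Definition box (a b : R) : set 'rV[R]_n := [set v | forall i, `[a, b]%classic (v ord0 i)].

Lemma measurable_box a b : measurable (box a b).
Proof. by apply: (@measurable_rV_box R n (fun=> `[a, b]%classic)) => i; exact: measurable_itv. Qed.

Lemma lebesgue_box a b : a <= b -> leb (box a b) = ((b - a) ^+ n)%:E.
Proof.
move=> ab; rewrite /box (@lebesgue_rV_box R n (fun=> `[a, b]%classic)); last by move=> i; exact: measurable_itv.
have -> : (\prod_(i < n) lebesgue_measure (`[a, b]%classic : set R))%E = (\prod_(i < n) (b - a)%:E)%E.
  apply: eq_bigr => i _; rewrite lebesgue_measure_itv/= lte_fin.
  case: ltP => // ba; have -> : b = a by apply/eqP; rewrite eq_le ab ba.
  by rewrite subrr.
by rewrite prodEFin prodr_const card_ord.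
Qed.

Lemma integrable_box a b : a <= b -> leb.-integrable setT (EFin \o \1_(box a b)).
Proof.
move=> ab; apply/integrableP; split.
  by apply/measurable_EFinP; apply: measurable_indic; exact: measurable_box.
under eq_integral do rewrite /= ger0_norm//.
have mb := measurable_box a b; rewrite integral_indic// setIT.
by rewrite [X in (X < _)%E](_ : _ = ((b - a) ^+ n)%:E) ?ltry//; exact: lebesgue_box.
Qed.

Lemma Rintegral_box a b : a <= b -> \int[leb]_x \1_(box a b) x = (b - a) ^+ n.
Proof.
have mb := measurable_box a b; move=> ab; rewrite /Rintegral integral_indic// setIT.
by rewrite [X in fine X](_ : _ = ((b - a) ^+ n)%:E)//; exact: lebesgue_box.
Qed.

Lemma box_dotv a b x : 0 <= a -> box a b x -> n%:R * a ^+ 2 <= dotv x x <= n%:R * b ^+ 2.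
Proof.
move=> a0 bx; have cE (c : R) : n%:R * c ^+ 2 = \sum_(i < n) c * c.
  by rewrite sumr_const card_ord -[in RHS]mulr_natl expr2.
rewrite !cE; apply/andP; split; apply: ler_sum => i _; have := bx i; rewrite /= in_itv/= => /andP[ax xb].
  by apply: ler_pM.
by apply: ler_pM => //; exact: le_trans ax.
Qed.

Lemma dotv_box (b : R) x : 0 <= b -> dotv x x <= b ^+ 2 -> box (- b) b x.
Proof.
move=> b0 xb i /=; rewrite in_itv/= -ler_norml -(@ler_pXn2r _ 2)// ?nnegrE//.
apply: le_trans xb; rewrite real_normK ?num_real// /dotv (bigD1 i)//= -expr2 lerDl.
by apply: sumr_ge0 => k _; rewrite -expr2 sqr_ge0.
Qed.

End box.

Section tail.
Variables (R : realType) (n : nat) (s : R).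
Notation leb := (lebesgue_rV R n).
Hypothesis n0 : (0 < n)%N.
Hypothesis s01 : 0 < s < 1.
Variables (F : 'rV[R]_n -> R) (phi : R -> R).
Hypothesis intF : leb.-integrable setT (EFin \o F).
Hypothesis F_gt0 : forall x, x != 0 -> 0 < F x.
Hypothesis F_dec : forall x y, x != 0 -> y != 0 -> dotv x x <= dotv y y -> F y <= F x.
Hypothesis intF1 : \int[leb]_x F x = 1.
Hypothesis gaussF : forall e, 0 < e ->
  Num.sqrt (pi / e) ^+ n * \int[leb]_x (F x * gauv ((4 * e)^-1) x) =
  \int[leb]_k (gauv e k * phi (dotv k k)).
Hypothesis mphi : measurable_fun setT (fun k : 'rV[R]_n => phi (dotv k k)).
Hypothesis phi01 : forall l, 0 <= l -> 0 <= phi l <= 1.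
Variables (c C l0 : R).
Hypothesis c0 : 0 < c.
Hypothesis C0 : 0 < C.
Hypothesis l00 : 0 < l0.
Hypothesis phi_low : forall l, 0 <= l <= l0 -> c * l `^ s <= 1 - phi l.
Hypothesis phi_up : forall l, 0 <= l -> 1 - phi l <= C * l `^ s.

Let s0 : 0 < s. Proof. by case/andP: s01. Qed.
Let s1 : s < 1. Proof. by case/andP: s01. Qed.
Let nR : 0 < n%:R :> R. Proof. by rewrite ltr0n. Qed.

Let mF : measurable_fun setT F.
Proof. by have /integrableP[/measurable_EFinP] := intF. Qed.

(** A smooth count of the mass of [F] at distance e^(1/2) and beyond. By duality it
    is the average of 1 - phi(|k|^2) against a Gaussian of width e^(-1/2)
    ([defectE]). *)
Definition defect e : R := \int[leb]_x (F x * (1 - gauv ((4 * e)^-1) x)).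

Lemma gauv_le1 a (x : 'rV[R]_n) : 0 <= a -> gauv a x <= 1.
Proof. by move=> a0; rewrite expR_le1 oppr_le0 mulr_ge0// dotv_ge0. Qed.

Lemma integrable_Fgauv a : 0 <= a -> leb.-integrable setT (EFin \o (fun x => F x * gauv a x)).
Proof.
move=> a0; apply: (Rle_integrable _ _ _ (integrable_norm intF)) => //.
  by apply: measurable_funM => //; exact: measurable_gauv.
by move=> x _; rewrite normrM ler_piMr// ger0_norm ?gauv_ge0// gauv_le1.
Qed.

Lemma integrable_defect a : 0 <= a -> leb.-integrable setT (EFin \o (fun x => F x * (1 - gauv a x))).
Proof.
move=> a0; apply: (Rle_integrable _ _ _ (integrable_norm intF)) => //.
  apply: measurable_funM => //; apply: measurable_funB => //; exact: measurable_gauv.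
move=> x _; rewrite normrM ler_piMr// ger0_norm ?subr_ge0 ?gauv_le1//.
by rewrite gerBl gauv_ge0.
Qed.

Lemma integrable_gphi e : 0 < e -> leb.-integrable setT (EFin \o (fun k => gauv e k * (1 - phi (dotv k k)))).
Proof.
move=> e0; apply: (Rle_integrable _ _ _ (integrable_gauv n e0)) => //.
  by apply: measurable_funM; [exact: measurable_gauv|exact: measurable_funB].
move=> k _; have /andP[? ?] := phi01 (dotv_ge0 k).
by rewrite normrM (ger0_norm (gauv_ge0 _ _)) ler_piMr ?gauv_ge0// ger0_norm ?subr_ge0// gerBl.
Qed.

Lemma defectE e : 0 < e -> Num.sqrt (pi / e) ^+ n * defect e =
  \int[leb]_k (gauv e k * (1 - phi (dotv k k))).
Proof.
move=> e0; have e40 : 0 <= (4 * e)^-1 by rewrite invr_ge0 mulr_ge0// ltW.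
have -> : defect e = 1 - \int[leb]_x (F x * gauv ((4 * e)^-1) x).
  transitivity (\int[leb]_x F x - \int[leb]_x (F x * gauv ((4 * e)^-1) x)); last by rewrite intF1.
  rewrite -RintegralB//; last exact: integrable_Fgauv.
  by apply: eq_Rintegral => x _; rewrite mulrBr mulr1.
have ig : leb.-integrable setT (EFin \o (fun k : 'rV[R]_n => gauv e k * phi (dotv k k))).
  apply: (Rle_integrable _ _ _ (integrable_gauv n e0)) => //.
    by apply: measurable_funM; [exact: measurable_gauv|].
  move=> k _; have /andP[? ?] := phi01 (dotv_ge0 k).
  by rewrite normrM (ger0_norm (gauv_ge0 _ _)) ler_piMr ?gauv_ge0// ger0_norm.
rewrite mulrBr mulr1 gaussF// -(Rintegral_gauv n e0) -RintegralB//; last exact: integrable_gauv.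
by apply: eq_Rintegral => k _; rewrite mulrBr mulr1.
Qed.

Let S_gt0 (e : R) : 0 < e -> 0 < Num.sqrt (pi / e) ^+ n.
Proof. by move=> e0; rewrite exprn_gt0// sqrtr_gt0 divr_gt0// pi_gt0. Qed.

(** Half of the Gaussian pays for the power, through
    (e V)^s <= 2 exp(e V / 2). *)
Lemma defect_up : exists2 C1 : R, 0 < C1 & forall e, 0 < e -> defect e <= C1 * e `^ (- s).
Proof.
exists (2 * C * Num.sqrt 2 ^+ n) => [|e e0].
  by rewrite !mulr_gt0// exprn_gt0// sqrtr_gt0.
rewrite -(ler_pM2l (S_gt0 e0)) defectE//.
have e20 : 0 < e / 2 by rewrite divr_gt0.
have es0 : 0 < e `^ s by rewrite powR_gt0.
have -> : Num.sqrt (pi / e) ^+ n * (2 * C * Num.sqrt 2 ^+ n * e `^ (- s)) =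
    \int[leb]_k ((2 * C * e `^ (- s)) * gauv (e / 2) k).
  rewrite RintegralZl//; last exact: integrable_gauv.
  rewrite Rintegral_gauv// (_ : pi / (e / 2) = 2 * (pi / e)); last by field; rewrite gt_eqF.
  by rewrite [Num.sqrt (2 * _)]sqrtrM// exprMn; ring.
apply: le_Rintegral => //; [exact: integrable_gphi|exact: integrable_scale_gauv|].
move=> k _; have d0 := dotv_ge0 k; set V := dotv k k in d0 *.
apply: (@le_trans _ _ (gauv e k * (C * V `^ s))).
  by rewrite ler_wpM2l ?gauv_ge0// phi_up.
have eV : 0 <= e * V by rewrite mulr_ge0// ltW.
have h1 : (e * V) `^ s <= 2 * expR (e / 2 * V).
  have h2 : (e * V) `^ s <= 1 + e * V.
    have [h|h] := leP (e * V) 1.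
      have : (e * V) `^ s <= 1 `^ s by apply: ge0_ler_powR => //; rewrite ?nnegrE// ltW.
      by rewrite powR1; lra.
    by have := ler1_powR (ltW h) (ltW s1); lra.
  have := expR_ge1Dx (e / 2 * V).
  have : e / 2 * V = e * V / 2 by ring.
  move: (e * V) (e/2 * V) h2 eV => u w; lra.
have -> : gauv e k = gauv (e / 2) k * expR (- (e / 2 * V)).
  by rewrite /gauv -expRD; congr expR; rewrite -/V; field.
rewrite mulrC; rewrite powRM ?(ltW e0)// in h1.
have VE : V `^ s = e `^ (- s) * (e `^ s * V `^ s) by rewrite powRN mulKf// gt_eqF.
rewrite VE [leLHS](_ : _ = (C * e `^ (- s) * gauv (e / 2) k) * ((e `^ s * V `^ s) * expR (- (e / 2 * V)))); last by ring.
rewrite [leRHS](_ : _ = (C * e `^ (- s) * gauv (e / 2) k) * 2); last by ring.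
rewrite ler_wpM2l ?mulr_ge0 ?gauv_ge0 ?powR_ge0 ?(ltW C0)//.
by rewrite expRN ler_pdivrMr ?expR_gt0.
Qed.

(** Restrict the average to a cube at distance of order e^(-1/2) from the
    origin, where 1 - phi(|k|^2) is at least of order e^(-s). *)
Lemma defect_low : exists c1 e1 : R, [/\ 0 < c1, 0 < e1 &
  forall e, e1 <= e -> c1 * e `^ (- s) <= defect e].
Proof.
pose e1 := 4 * n%:R / l0.
have e10 : 0 < e1 by rewrite divr_gt0// mulr_gt0.
exists (expR (- (4 * n%:R)) * c * n%:R `^ s / Num.sqrt pi ^+ n), e1; split => //.
  by rewrite divr_gt0 ?exprn_gt0 ?sqrtr_gt0 ?pi_gt0// !mulr_gt0 ?expR_gt0 ?powR_gt0.
move=> e ee; have e0 : 0 < e by exact: lt_le_trans ee.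
rewrite -(ler_pM2l (S_gt0 e0)) defectE//.
pose t := Num.sqrt (e^-1).
have t0 : 0 < t by rewrite sqrtr_gt0 invr_gt0.
have tt : t ^+ 2 = e^-1 by rewrite sqr_sqrtr// invr_ge0 ltW.
have tle : t <= 2 * t by rewrite ler_peMl ?(ltW t0)// ler1n.
pose A := expR (- (4 * n%:R)) * (c * (n%:R / e) `^ s).
have -> : Num.sqrt (pi / e) ^+ n * (expR (- (4 * n%:R)) * c * n%:R `^ s / Num.sqrt pi ^+ n * e `^ (- s)) =
    \int[leb]_k (A * \1_(box t (2 * t)) k).
  rewrite RintegralZl//; last exact: integrable_box.
  rewrite Rintegral_box// /A powRM ?invr_ge0 ?(ltW e0)//.
  rewrite sqrtrM ?pi_ge0// -/t exprMn (_ : 2 * t - t = t); last by ring.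
  have -> : (e^-1) `^ s = e `^ (- s) by rewrite -[e^-1]powR_inv1 ?(ltW e0)// -powRrM mulN1r.
  have p0 : Num.sqrt pi ^+ n != 0 :> R by rewrite gt_eqF// exprn_gt0// sqrtr_gt0 pi_gt0.
  by field.
apply: le_Rintegral => //.
- by have /(integrableZl measurableT A) := @integrable_box R n _ _ tle.
- exact: integrable_gphi.
- move=> k _; have /andP[p0 p1] := phi01 (dotv_ge0 k).
  rewrite indicE; case: (boolP (k \in box t (2 * t))) => [kb|_]; last first.
    by rewrite mulr0 mulr_ge0 ?gauv_ge0// subr_ge0.
  rewrite mulr1 /A; move: kb; rewrite inE => kb.
  have := box_dotv (ltW t0) kb; rewrite exprMn tt => /andP[V1 V2].
  have V2' : dotv k k <= l0.
    apply: (le_trans V2); move: ee; rewrite /e1 ler_pdivrMr// => ee.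
    have -> : n%:R * (2 ^+ 2 * e^-1) = 4 * n%:R / e by ring.
    by rewrite ler_pdivrMr// [leRHS]mulrC.
  rewrite ler_pM ?expR_ge0 ?mulr_ge0 ?powR_ge0 ?(ltW c0)//.
    rewrite ler_expR lerN2 (le_trans (ler_wpM2l (ltW e0) V2))//.
    rewrite le_eqVlt; apply/orP; left; apply/eqP; field; rewrite gt_eqF//.
  apply: (@le_trans _ _ (c * dotv k k `^ s)); last by rewrite phi_low// dotv_ge0.
  rewrite ler_wpM2l ?(ltW c0)// ge0_ler_powR ?(ltW s0)// nnegrE ?dotv_ge0//.
  by rewrite divr_ge0// ltW.
Qed.

Let p : R := n%:R / 2 + s.
Let p0 : 0 < p. Proof. by rewrite addr_gt0// divr_gt0. Qed.

Let defect_ge0_at a x : 0 <= a -> 0 <= F x * (1 - gauv a x).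
Proof.
move=> a0; have [->|x0] := eqVneq x 0.
  by rewrite /gauv (_ : dotv 0 0 = 0) ?mulr0 ?oppr0 ?expR0 ?subrr ?mulr0//; apply/eqP; rewrite dotv_eq0.
by rewrite mulr_ge0 ?(ltW (F_gt0 x0))// subr_ge0 gauv_le1.
Qed.

Lemma onem_expRN_ge (w : R) : 1 <= w -> 1 <= 2 * (1 - expR (- w)).
Proof.
move=> w1; have : expR (- w) <= 2^-1.
  rewrite expRN lef_pV2 ?posrE ?expR_gt0//.
  by apply: le_trans (expR_ge1Dx _); lra.
lra.
Qed.

Lemma le_onem_expRN (w : R) : 0 <= w <= 1 -> w <= 2 * (1 - expR (- w)).
Proof.
move=> /andP[w0 w1]; have w10 : 0 < 1 + w by rewrite ltr_wpDr.
have : expR (- w) <= (1 + w)^-1.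
  by rewrite expRN lef_pV2 ?posrE ?expR_gt0// expR_ge1Dx.
have : (1 + w)^-1 <= 1 - w / 2.
  by rewrite -[leLHS]div1r ler_pdivrMr//; nra.
lra.
Qed.

Lemma sqrt_powR (v : R) : 0 <= v -> Num.sqrt v ^+ n = v `^ (n%:R / 2).
Proof.
by move=> v0; rewrite -powR12_sqrt// -powR_mulrn ?powR_ge0// -powRrM mulrC.
Qed.

(** The cube [r, 2r]^n lies between |y| / 2 and |y| when |y|^2 = 4 n r^2. There
    F >= F(y) by monotonicity, while the mass of the cube is at most twice the
    defect at e = |y|^2 / 16. *)
Lemma decay_upper_bound : exists2 C2 : R, 0 < C2 &
  forall x, x != 0 -> F x <= C2 * dotv x x `^ (- p).
Proof.
have [C1 C10 HC1] := defect_up.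
pose B := 2 * C1 * 16 `^ s * (4 * n%:R) `^ (n%:R / 2).
exists B; first by rewrite !mulr_gt0 ?powR_gt0// mulr_gt0.
move=> y y0; set V := dotv y y.
have V0 : 0 < V by rewrite lt0r dotv_eq0 y0 dotv_ge0.
pose v := V / (4 * n%:R); have n4 : 0 < 4 * n%:R :> R by rewrite mulr_gt0.
have v0 : 0 < v by rewrite divr_gt0.
pose r := Num.sqrt v; have r0 : 0 < r by rewrite sqrtr_gt0.
have rr : r ^+ 2 = v by rewrite sqr_sqrtr// ltW.
have r2 : r <= 2 * r by rewrite ler_peMl ?(ltW r0)// ler1n.
pose e := V / 16; have e0 : 0 < e by rewrite divr_gt0.
have eE : (4 * e)^-1 = 4 / V by rewrite /e; field; rewrite gt_eqF.
have a0 : 0 <= (4 * e)^-1 by rewrite invr_ge0 mulr_ge0// ltW.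
have key : F y * r ^+ n <= 2 * defect e.
  have -> : F y * r ^+ n = \int[leb]_k (F y * \1_(box r (2 * r)) k).
    rewrite RintegralZl//; last exact: integrable_box.
    by rewrite Rintegral_box//; congr (_ * _ ^+ _); ring.
  rewrite /defect -RintegralZl//; last exact: integrable_defect.
  apply: le_Rintegral => //.
  - by have /(integrableZl measurableT (F y)) := @integrable_box R n _ _ r2.
  - by have /(integrableZl measurableT 2) := integrable_defect a0.
  move=> k _; rewrite indicE; case: (boolP (k \in box r (2 * r))) => [|_]; last first.
    by rewrite mulr0 mulr_ge0// defect_ge0_at.
  rewrite inE mulr1 => /(box_dotv (ltW r0)); rewrite exprMn rr => /andP[k1 k2].
  have k1' : V / 4 <= dotv k k.
    by apply: le_trans k1; rewrite /v le_eqVlt; apply/orP; left; apply/eqP; field; rewrite gt_eqF.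
  have k2' : dotv k k <= V.
    by apply: (le_trans k2); rewrite /v le_eqVlt; apply/orP; left; apply/eqP; field; rewrite gt_eqF.
  have kn0 : k != 0.
    by rewrite -dotv_eq0 gt_eqF// (lt_le_trans _ k1')// divr_gt0.
  rewrite mulrCA -[leLHS]mulr1 ler_pM ?(ltW (F_gt0 y0)) ?F_dec//.
  rewrite /gauv; apply: onem_expRN_ge; rewrite eE mulrAC ler_pdivlMr// mul1r.
  by rewrite mulrC -ler_pdivrMr.
have r_ne : 0 < r ^+ n by rewrite exprn_gt0.
rewrite -(ler_pM2r r_ne); apply: (le_trans key).
apply: (le_trans (ler_wpM2l _ (HC1 _ e0))) => //.
rewrite /r sqrt_powR ?(ltW v0)// /v /e /B /p.
rewrite !powRM ?invr_ge0 ?(ltW V0) ?(ltW n4)//.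
rewrite -[16^-1]powR_inv1// -powRrM mulN1r opprK.
rewrite -[(4 * _)^-1]powR_inv1 ?(ltW n4)// -powRrM mulN1r (powRN (4 * _)).
rewrite opprD powRD ?(gt_eqF V0) ?implybT//.
have q0 : (4 * n%:R) `^ (n%:R / 2) != 0 :> R by rewrite gt_eqF// powR_gt0.
rewrite (powRN V (n%:R / 2)).
have q1 : V `^ (n%:R / 2) != 0 :> R by rewrite gt_eqF// powR_gt0.
rewrite le_eqVlt; apply/orP; left; apply/eqP.
rewrite -(powRM (n%:R / 2) (ler0n R 4) (ler0n R n)).
by field; rewrite q0 q1.
Qed.

(** A Tauberian argument. With V = |y|^2 and rho = L V, split the defect at e =
    rho / 4 according to W = |x|^2. The part W <= V is at most 2 / L times the
    defect at rho / (4 L), hence of order L^(s-1) rho^(-s). The part W > L rho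
    is at most twice the defect at L rho / 4, hence of order L^(-s) rho^(-s).
    For L large, both are small compared with the lower bound of [defect_low];
    so the shell in between carries a definite mass, and there F <= F(y). *)
Lemma decay_lower_bound : exists c2 V0 : R, [/\ 0 < c2, 0 < V0 &
  forall x, V0 <= dotv x x -> c2 * dotv x x `^ (- p) <= F x].
Proof.
have [C1 C10 HC1] := defect_up.
have [c1 [e1 [c10 e10 Hc1]]] := defect_low.
have s1' : 0 < 1 - s by rewrite subr_gt0.
pose del := c1 / (8 * C1).
have del0 : 0 < del by rewrite divr_gt0// mulr_gt0.
(* L so large that the inner and outer parts are each at most a quarter of the
   lower bound of the defect *)
have [L [L1 La Lb]] : exists L : R, [/\ 1 <= L, L `^ (- (1 - s)) <= del & L `^ (- s) <= del].
  pose La := (del^-1) `^ ((1 - s)^-1); pose Lb := (del^-1) `^ (s^-1).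
  have pw (t : R) L : 0 < t -> (del^-1) `^ (t^-1) <= L -> L `^ (- t) <= del.
    move=> t0 tL; rewrite powRN -[leRHS]invrK.
    have d0 : 0 < del^-1 by rewrite invr_gt0.
    have L0 : 0 < L by apply: lt_le_trans tL; rewrite powR_gt0.
    rewrite lef_pV2 ?posrE ?powR_gt0//.
    have -> : del^-1 = ((del^-1) `^ (t^-1)) `^ t.
      by rewrite -powRrM mulVf ?gt_eqF// powRr1// ltW.
    by rewrite ge0_ler_powR ?(ltW t0)// nnegrE ?powR_ge0// ltW.
  exists (Num.max 1 (Num.max La Lb)); split.
  - by rewrite le_max lexx.
  - by apply: pw => //; rewrite !le_max lexx orbT.
  - by apply: pw => //; rewrite !le_max lexx !orbT.
have L0 : 0 < L by exact: lt_le_trans L1.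
pose V0 := 4 * e1 / L.
exists (c1 / 2 * 4 `^ s / 2 ^+ n / L `^ (n%:R + s)), V0; split.
- by rewrite !divr_gt0 ?exprn_gt0 ?powR_gt0// mulr_gt0 ?powR_gt0// divr_gt0.
- by rewrite divr_gt0// mulr_gt0.
move=> y yV; set V := dotv y y in yV *.
have Vp : 0 < V by apply: lt_le_trans yV; rewrite divr_gt0// mulr_gt0.
have y0 : y != 0 by rewrite -dotv_eq0 gt_eqF.
pose rho := L * V.
have rho0 : 0 < rho by rewrite mulr_gt0.
have rhoe1 : e1 <= rho / 4.
  by rewrite ler_pdivlMr// /rho mulrC; move: yV; rewrite /V0 ler_pdivrMr// mulrC (mulrC V).
pose ea := rho / 4; pose eb := rho / (4 * L); pose ec := L * rho / 4.
have ea0 : 0 < ea by rewrite divr_gt0.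
have eb0 : 0 < eb by rewrite divr_gt0// mulr_gt0.
have ec0 : 0 < ec by rewrite divr_gt0// mulr_gt0.
have eaE : (4 * ea)^-1 = rho^-1 by rewrite /ea; field; rewrite gt_eqF.
have ebE : (4 * eb)^-1 = L / rho by rewrite /eb; field; rewrite !gt_eqF.
have ecE : (4 * ec)^-1 = (L * rho)^-1 by rewrite /ec; field; rewrite !gt_eqF.
have pos (e : R) : 0 < e -> 0 <= (4 * e)^-1 by move=> e0; rewrite invr_ge0 mulr_ge0// ltW.
pose b := Num.sqrt (L * rho).
have b0 : 0 < b by rewrite sqrtr_gt0 mulr_gt0.
have bb : - b <= b by rewrite lerNl lerN10_ge0 || lra.
have key : defect ea <= (2 / L) * defect eb + 2 * defect ec + F y * (b - - b) ^+ n.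
  have i1 : leb.-integrable setT (EFin \o (fun x => (2 / L) * (F x * (1 - gauv (4 * eb)^-1 x)))).
    by have /(integrableZl measurableT (2 / L)) := integrable_defect (pos _ eb0).
  have i2 : leb.-integrable setT (EFin \o (fun x => 2 * (F x * (1 - gauv (4 * ec)^-1 x)))).
    by have /(integrableZl measurableT 2) := integrable_defect (pos _ ec0).
  have i3 : leb.-integrable setT (EFin \o (fun x => F y * \1_(box (- b) b) x)).
    by have /(integrableZl measurableT (F y)) := @integrable_box R n _ _ bb.
  have i12 : leb.-integrable setT (EFin \o (fun x => (2 / L) * (F x * (1 - gauv (4 * eb)^-1 x)) +
      2 * (F x * (1 - gauv (4 * ec)^-1 x)))).
    by have := integrableD measurableT i1 i2.
  have i123 : leb.-integrable setT (EFin \o (fun x => (2 / L) * (F x * (1 - gauv (4 * eb)^-1 x)) +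
      2 * (F x * (1 - gauv (4 * ec)^-1 x)) + F y * \1_(box (- b) b) x)).
    by have := integrableD measurableT i12 i3.
  have -> : (2 / L) * defect eb + 2 * defect ec + F y * (b - - b) ^+ n =
      \int[leb]_x ((2 / L) * (F x * (1 - gauv (4 * eb)^-1 x)) +
      2 * (F x * (1 - gauv (4 * ec)^-1 x)) + F y * \1_(box (- b) b) x).
    have j1 := integrable_defect (pos _ eb0); have j2 := integrable_defect (pos _ ec0).
    have j3 := @integrable_box R n _ _ bb.
    by rewrite RintegralD// RintegralD// !RintegralZl// Rintegral_box.
  apply: le_Rintegral => //; first exact: integrable_defect (pos _ ea0).
  move=> x _.
  have h1 := defect_ge0_at x (pos _ eb0).
  have h2 := defect_ge0_at x (pos _ ec0).
  have t1 : 0 <= 2 / L * (F x * (1 - gauv (4 * eb)^-1 x)) by rewrite mulr_ge0// divr_ge0// ltW.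
  have t2 : 0 <= 2 * (F x * (1 - gauv (4 * ec)^-1 x)) by rewrite mulr_ge0.
  have t3 : 0 <= F y * \1_(box (- b) b) x.
    by rewrite mulr_ge0 ?(ltW (F_gt0 y0))//; rewrite indicE; case: (_ \in _).
  have [x0|x0] := eqVneq x 0.
    have -> : F x * (1 - gauv (4 * ea)^-1 x) = 0.
      have d0 : dotv x x = 0 by apply/eqP; rewrite dotv_eq0; apply/eqP.
      by rewrite /gauv d0 mulr0 oppr0 expR0 subrr mulr0.
    by rewrite !addr_ge0.
  have Fx := ltW (F_gt0 x0).
  set W := dotv x x.
  have W0 : 0 < W by rewrite lt0r dotv_eq0 x0 dotv_ge0.
  have g1 : 1 - gauv (4 * ea)^-1 x <= 1 by rewrite gerBl gauv_ge0.
  have [WV|VW] := leP W V.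
    apply: (@le_trans _ _ (2 / L * (F x * (1 - gauv (4 * eb)^-1 x)))); last by rewrite -addrA lerDl addr_ge0.
    rewrite [leRHS]mulrCA ler_wpM2l//.
    have e1' : 1 - gauv (4 * ea)^-1 x <= W / rho.
      rewrite /gauv eaE -/W lerBlDr -lerBlDl (le_trans _ (expR_ge1Dx _))//.
      by rewrite mulrC.
    apply: (le_trans e1').
    have -> : W / rho = L^-1 * (L / rho * W) by field; rewrite !gt_eqF.
    rewrite [leRHS](_ : _ = L^-1 * (2 * (1 - gauv (4 * eb)^-1 x))); last by ring.
    rewrite ler_wpM2l ?invr_ge0 ?(ltW L0)//.
    rewrite /gauv ebE -/W; apply: le_onem_expRN.
    rewrite mulr_ge0 ?divr_ge0 ?(ltW L0) ?(ltW rho0) ?(ltW W0)//=.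
    have -> : L / rho * W = W / V by rewrite /rho; field; rewrite !gt_eqF.
    by rewrite ler_pdivrMr// mul1r.
  have [WL|LW] := leP W (L * rho).
    apply: (@le_trans _ _ (F y * \1_(box (- b) b) x)); last by rewrite lerDr addr_ge0.
    rewrite indicE mem_set; last first.
      by apply: dotv_box; [exact: ltW|rewrite sqr_sqrtr// mulr_ge0// ltW].
    by rewrite ler_pM ?subr_ge0 ?gauv_le1 ?(pos _ ea0)// F_dec// ltW.
  apply: (@le_trans _ _ (2 * (F x * (1 - gauv (4 * ec)^-1 x)))); last first.
    by rewrite [X in _ <= X + _]addrC -addrA lerDl addr_ge0.
  rewrite [leRHS]mulrCA ler_wpM2l// (le_trans g1)// /gauv ecE -/W; apply: onem_expRN_ge.
  by rewrite mulrC ler_pdivlMr ?mulr_gt0// mul1r ltW.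
have low := Hc1 _ rhoe1.
have upb := HC1 _ eb0; have upc := HC1 _ ec0.
have L20 : 0 <= 2 / L by rewrite divr_ge0// ltW.
have := le_trans low (le_trans key (lerD (lerD (ler_wpM2l L20 upb) (ler_wpM2l (ler0n R 2) upc)) (lexx _))).
have ebs : eb `^ (- s) = L `^ s * ea `^ (- s).
  have -> : eb = L^-1 * ea by rewrite /eb /ea; field; rewrite gt_eqF.
  rewrite powRM ?invr_ge0 ?(ltW L0) ?(ltW ea0)// -[L^-1]powR_inv1 ?(ltW L0)//.
  by rewrite -powRrM mulN1r opprK.
have ecs : ec `^ (- s) = L `^ (- s) * ea `^ (- s).
  have -> : ec = L * ea by rewrite /ec /ea; ring.
  by rewrite powRM ?(ltW L0) ?(ltW ea0).
have LL : L^-1 * L `^ s = L `^ (- (1 - s)).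
  by rewrite -[L^-1]powR_inv1 ?(ltW L0)// -powRD ?(gt_eqF L0) ?implybT//; congr (_ `^ _); ring.
rewrite ebs ecs => H.
set E := ea `^ (- s) in H.
have E0 : 0 < E by rewrite powR_gt0.
have H1 : 2 / L * (C1 * (L `^ s * E)) <= c1 / 4 * E.
  rewrite [leLHS](_ : _ = 2 * C1 * (L^-1 * L `^ s) * E); last by ring.
  rewrite LL ler_wpM2r ?(ltW E0)//.
  apply: (@le_trans _ _ (2 * C1 * del)); first by rewrite ler_wpM2l// mulr_ge0// ltW.
  by rewrite /del le_eqVlt; apply/orP; left; apply/eqP; field; rewrite gt_eqF.
have H2 : 2 * (C1 * (L `^ (- s) * E)) <= c1 / 4 * E.
  rewrite [leLHS](_ : _ = 2 * C1 * (L `^ (- s)) * E); last by ring.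
  rewrite ler_wpM2r ?(ltW E0)//.
  apply: (@le_trans _ _ (2 * C1 * del)); first by rewrite ler_wpM2l// mulr_ge0// ltW.
  by rewrite /del le_eqVlt; apply/orP; left; apply/eqP; field; rewrite gt_eqF.
have {H H1 H2} H : c1 / 2 * E <= F y * (b - - b) ^+ n.
  have -> : c1 / 2 * E = c1 * E - (c1 / 4 * E + c1 / 4 * E) by field.
  by lra.
have bE : (b - - b) ^+ n = 2 ^+ n * (L `^ n%:R * V `^ (n%:R / 2)).
  have -> : b - - b = 2 * b by ring.
  rewrite exprMn /b /rho sqrt_powR ?mulr_ge0 ?(ltW L0) ?(ltW Vp)//.
  rewrite mulrA powRM ?mulr_ge0 ?(ltW L0) ?(ltW Vp)//; congr (_ * (_ * _)).
  rewrite powRM ?(ltW L0)// -powRD ?(gt_eqF L0) ?implybT//.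
  by congr (_ `^ _); field.
have EE : E = 4 `^ s * L `^ (- s) * V `^ (- s).
  rewrite /E /ea /rho !powRM ?mulr_ge0 ?invr_ge0 ?(ltW L0) ?(ltW Vp)//.
  rewrite -[4^-1]powR_inv1// -powRrM mulN1r opprK; ring.
have b20 : 0 < (b - - b) ^+ n by rewrite exprn_gt0// opprK addr_gt0.
rewrite -(ler_pM2r b20); apply: le_trans H.
rewrite bE EE /p opprD [V `^ (_ + _)]powRD ?(gt_eqF Vp) ?implybT//.
rewrite (powRN V (n%:R / 2)) (powRN L) [L `^ (_ + _)]powRD ?(gt_eqF L0) ?implybT//.
have q1 : V `^ (n%:R / 2) != 0 :> R by rewrite gt_eqF// powR_gt0.
have q2 : L `^ n%:R != 0 :> R by rewrite gt_eqF// powR_gt0.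
have q3 : L `^ s != 0 :> R by rewrite gt_eqF// powR_gt0.
have q4 : 2 ^+ n != 0 :> R by rewrite gt_eqF// exprn_gt0.
rewrite le_eqVlt; apply/orP; left; apply/eqP; field.
by rewrite q1 q2 q3 q4.
Qed.

End tail.

(** * Slow variation *)

Section slow_variation.
Variables (R : realType) (n : nat) (p : R).
Hypothesis p0 : 0 < p.
Variable F : 'rV[R]_n -> R.
Hypothesis F_gt0 : forall x, x != 0 -> 0 < F x.
Hypothesis radF : radconv [set x | x != 0] F.
Variables (C2 c2 V0 V1 : R).
Hypothesis C20 : 0 < C2.
Hypothesis c20 : 0 < c2.
Hypothesis V00 : 0 < V0.
Hypothesis V10 : 0 < V1.
Hypothesis F_up : forall x, x != 0 -> F x <= C2 * dotv x x `^ (- p).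
Hypothesis F_low : forall x, V0 <= dotv x x -> c2 * dotv x x `^ (- p) <= F x.

Let Fdec x y : x != 0 -> y != 0 -> dotv x x <= dotv y y -> F y <= F x.
Proof. by have [_ + _] := radF; exact. Qed.

(** Monotonicity extends the lower bound down to any positive distance, with a
    smaller constant. *)
Lemma decay_lower_bound_from : exists2 c3 : R, 0 < c3 &
  forall x, V1 <= dotv x x -> c3 * dotv x x `^ (- p) <= F x.
Proof.
pose m := Num.min 1 (V1 / V0).
have m0 : 0 < m by rewrite lt_min ltr01 divr_gt0.
exists (c2 * m `^ p); first by rewrite mulr_gt0// powR_gt0.
move=> x; set V := dotv x x => V1x; have Vp : 0 < V by exact: lt_le_trans V1x.
have [V0V|VV0] := leP V0 V.
  apply: le_trans (F_low V0V); rewrite -/V ler_wpM2r ?powR_ge0// ler_piMr ?(ltW c20)//.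
  apply: (@le_trans _ _ (1 `^ p)); last by rewrite powR1.
  apply: ge0_ler_powR; rewrite ?nnegrE ?(ltW p0) ?(ltW m0)//.
  by rewrite ge_min lexx.
have x0 : x != 0 by rewrite -dotv_gt0.
pose a := Num.sqrt (V0 / V).
have a0 : 0 < a by rewrite sqrtr_gt0 divr_gt0.
have dax : dotv (a *: x) (a *: x) = V0.
  by rewrite dotvZ sqr_sqrtr ?divfK ?gt_eqF// divr_ge0// ltW.
have ax0 : a *: x != 0 by rewrite -dotv_gt0 dax.
apply: (@le_trans _ _ (F (a *: x))); last by rewrite Fdec// dax ltW.
apply: le_trans (F_low _); rewrite dax// -mulrA ler_wpM2l ?(ltW c20)//.
rewrite powRN ler_pdivrMr ?powR_gt0// powRN mulrC ler_pdivlMr ?powR_gt0//.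
rewrite -powRM ?(ltW m0) ?(ltW V00)//.
apply: ge0_ler_powR; rewrite ?nnegrE ?(ltW p0) ?mulr_ge0 ?(ltW m0) ?(ltW V00) ?(ltW Vp)//.
apply: le_trans V1x; apply: (@le_trans _ _ (V1 / V0 * V0)).
  by rewrite ler_wpM2r ?(ltW V00)// ge_min lexx orbT.
by rewrite divfK// gt_eqF.
Qed.

(** As a function of v = |x|^2, F is convex, nonincreasing and at most
    multiplied by a constant D when v is halved. Convexity between v / 2 and v
    bounds the increment of F over a length t v / 2 by t F(v / 2). *)
Lemma radconv_slow_variation : exists2 K : R, 0 < K & forall x w t, V1 <= dotv x x ->
  0 <= t <= 2^-1 -> `|dotv w w - dotv x x| <= t * dotv x x ->
  `|F w - F x| <= K * t * F x.
Proof.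
have [c3 c30 F3] := decay_lower_bound_from.
pose D := C2 * 2 `^ p / c3.
have D0 : 0 < D by rewrite divr_gt0// mulr_gt0// powR_gt0.
have [_ _ Fconv] := radF.
pose h : R := Num.sqrt (2^-1).
have hh : h ^+ 2 = 2^-1 by rewrite sqr_sqrtr// invr_ge0.
have h0 : h != 0 by rewrite gt_eqF// sqrtr_gt0 invr_gt0.
have dh y : dotv (h *: y) (h *: y) = dotv y y / 2 by rewrite dotvZ hh mulrC.
have doubling x : V1 <= dotv x x -> F (h *: x) <= D * F x.
  move=> V1x; have Vp : 0 < dotv x x by exact: lt_le_trans V1x.
  have hx0 : h *: x != 0 by rewrite -dotv_gt0 dh divr_gt0.
  apply: (le_trans (F_up hx0)); rewrite dh.
  apply: (@le_trans _ _ (D * (c3 * dotv x x `^ (- p)))); last by rewrite ler_wpM2l ?(ltW D0)// F3.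
  rewrite powRM ?invr_ge0 ?(ltW Vp)// -[2^-1]powR_inv1// -powRrM mulN1r opprK /D.
  by rewrite le_eqVlt; apply/orP; left; apply/eqP; field; rewrite gt_eqF.
(* y is a convex combination, in squared norm, of h *: z and z *)
have conv z y t : z != 0 -> 0 < t -> dotv z z / 2 <= dotv y y <= dotv z z ->
    dotv z z - dotv y y <= t * dotv z z / 2 -> F y - F z <= t * F (h *: z).
  move=> z0 t0 /andP[y1 y2] yt; set Vz := dotv z z in y1 y2 yt *.
  have Vz0 : 0 < Vz by rewrite dotv_gt0.
  have y0 : y != 0 by rewrite -dotv_gt0 (lt_le_trans _ y1)// divr_gt0.
  have hz0 : h *: z != 0 by rewrite -dotv_gt0 dh divr_gt0.
  pose th := 2 * dotv y y / Vz - 1.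
  have th01 : 0 <= th <= 1.
    rewrite /th subr_ge0 ler_pdivlMr// mul1r lerBlDr ler_pdivrMr//.
    by apply/andP; split; lra.
  have E : dotv y y = (1 - th) * dotv (h *: z) (h *: z) + th * dotv z z.
    by rewrite dh -/Vz /th; field; rewrite gt_eqF.
  have := Fconv (h *: z) z y th hz0 z0 y0 th01 E.
  have Fz := ltW (F_gt0 z0); have Fhz := ltW (F_gt0 hz0).
  have tht : 1 - th <= t.
    have -> : 1 - th = 2 * (Vz - dotv y y) / Vz by rewrite /th; field; rewrite gt_eqF.
    by rewrite ler_pdivrMr//; lra.
  move=> H; apply: (@le_trans _ _ ((1 - th) * F (h *: z) - (1 - th) * F z)); first by lra.
  apply: (@le_trans _ _ ((1 - th) * F (h *: z))); last by rewrite ler_wpM2r.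
  by rewrite gerBl mulr_ge0//; lra.
exists (2 * D); first by rewrite mulr_gt0.
move=> x w t V1x /andP[t0 t1] wx.
have Vp : 0 < dotv x x by exact: lt_le_trans V1x.
have x0 : x != 0 by rewrite -dotv_gt0.
have Fx := ltW (F_gt0 x0).
move: wx; rewrite ler_norml => /andP[wx1 wx2].
have tV : t * dotv x x <= dotv x x / 2 by rewrite mulrC ler_wpM2l ?(ltW Vp).
have w12 : dotv x x / 2 <= dotv w w by lra.
have w0 : w != 0 by rewrite -dotv_gt0 (lt_le_trans _ w12)// divr_gt0.
move: t0; rewrite le_eqVlt => /orP[/eqP t00|t0].
  have wE : dotv w w = dotv x x by move: wx1 wx2; rewrite -t00 mul0r; lra.
  have -> : F w = F x by apply/eqP; rewrite eq_le !Fdec// wE.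
  by rewrite subrr normr0 -t00 mulr0 mul0r.
have t2 : 0 < 2 * t by rewrite mulr_gt0.
have [wle|xlt] := leP (dotv w w) (dotv x x).
  rewrite ger0_norm ?subr_ge0 ?Fdec//.
  have H : F w - F x <= (2 * t) * F (h *: x).
    apply: conv => //; first by rewrite w12.
    by lra.
  apply: (le_trans H); rewrite (_ : 2 * D * t * F x = (2 * t) * (D * F x)); last by ring.
  by rewrite ler_wpM2l ?(ltW t2)// doubling.
rewrite distrC ger0_norm; last by rewrite subr_ge0 Fdec// ltW.
have H : F x - F w <= (2 * t) * F (h *: w).
  apply: conv => //.
    by apply/andP; split; lra.
  have : t * dotv x x <= t * dotv w w by rewrite ler_wpM2l ?(ltW t0)// ltW.
  by lra.
apply: (le_trans H); rewrite (_ : 2 * D * t * F x = (2 * t) * (D * F x)); last by ring.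
rewrite ler_wpM2l ?(ltW t2)//; apply: le_trans (doubling _ V1x).
have hx0 : h *: x != 0 by rewrite -dotv_gt0 dh divr_gt0.
have hw0 : h *: w != 0 by rewrite -dotv_gt0 dh divr_gt0// dotv_gt0.
by rewrite Fdec// !dh ler_pM2r ?invr_gt0// ltW.
Qed.

End slow_variation.

(** * Convolution with a slowly varying kernel *)

Section mild_estimate.
Variables (R : realType) (n : nat).
Notation leb := (lebesgue_rV R n).

(** Off [A] the kernel is compared with its value at x. On [A] the two terms
    of G(x - y) - G(x) are estimated separately: the first through the bound
    on [v] and the integral of |G|, the second through the mass of [v] on
    [A]. *)
Lemma mild_estimate (G v : 'rV[R]_n -> R) (x : 'rV[R]_n) (a B : R) (A : set 'rV[R]_n) :
  measurable A -> leb.-integrable setT (EFin \o G) -> leb.-integrable setT (EFin \o v) ->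
  (forall y, 0 <= v y) -> 0 <= a -> 0 <= B -> 0 <= G x ->
  (forall y, ~ A y -> `|G (x - y) - G x| <= a) -> (forall y, A y -> v y <= B) ->
  `|\int[leb]_y (G (x - y) * v y) - (\int[leb]_y v y) * G x| <=
  a * (\int[leb]_y v y) + B * (\int[leb]_y `|G y|) + G x * \int[leb]_y (v y * \1_A y).
Proof.
move=> mA iG iv v0 a0 B0 Gx0 Ga vB.
have iGs := integrable_rV_subl x iG.
have mGs : measurable_fun setT (fun y : 'rV[R]_n => G (x - y)) by have /integrableP[/measurable_EFinP] := iGs.
have mG : measurable_fun setT G by have /integrableP[/measurable_EFinP] := iG.
have mv : measurable_fun setT v by have /integrableP[/measurable_EFinP] := iv.
have ivA : leb.-integrable setT (EFin \o (fun y => v y * \1_A y)).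
  apply: (Rle_integrable _ _ _ iv) => //.
    by apply: measurable_funM => //; exact: measurable_indic.
  move=> y _; rewrite normrM (ger0_norm (v0 y)) ler_piMr// indicE.
  by case: (_ \in _); rewrite ?normr1 ?normr0.
have j1 : leb.-integrable setT (EFin \o (fun y => a * v y)).
  by have /(integrableZl measurableT a) := iv.
have j2 : leb.-integrable setT (EFin \o (fun y => B * `|G (x - y)|)).
  by have /(integrableZl measurableT B) := integrable_norm iGs.
have j3 : leb.-integrable setT (EFin \o (fun y => G x * (v y * \1_A y))).
  by have /(integrableZl measurableT (G x)) := ivA.
have j12 : leb.-integrable setT (EFin \o (fun y => a * v y + B * `|G (x - y)|)).
  by have := integrableD measurableT j1 j2.
have j123 : leb.-integrable setT (EFin \o (fun y => a * v y + B * `|G (x - y)| + G x * (v y * \1_A y))).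
  by have := integrableD measurableT j12 j3.
have bnd y : `|G (x - y) * v y - G x * v y| <= a * v y + B * `|G (x - y)| + G x * (v y * \1_A y).
  rewrite -mulrBl normrM (ger0_norm (v0 y)).
  have [Ay|nAy] := pselect (A y); last first.
    rewrite -addrA ler_wpDr ?ler_wpM2r ?Ga//.
    by rewrite addr_ge0 ?mulr_ge0// indicE.
  rewrite indicE mem_set// mulr1.
  apply: (@le_trans _ _ ((`|G (x - y)| + G x) * v y)).
    by rewrite ler_wpM2r// (le_trans (ler_normB _ _))// (ger0_norm Gx0).
  rewrite mulrDl lerD2r ler_wpDl ?mulr_ge0//.
  by rewrite mulrC ler_wpM2r// vB.
have iD : leb.-integrable setT (EFin \o (fun y => G (x - y) * v y - G x * v y)).
  apply: (Rle_integrable _ _ _ j123) => //.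
  by apply: measurable_funB; apply: measurable_funM.
have iGv : leb.-integrable setT (EFin \o (fun y => G x * v y)).
  by have /(integrableZl measurableT (G x)) := iv.
have iGsv : leb.-integrable setT (EFin \o (fun y => G (x - y) * v y)).
  have := integrableD measurableT iD iGv.
  by congr (_.-integrable _ _); apply/funext => y /=; rewrite -EFinD subrK.
have -> : (\int[leb]_y v y) * G x = \int[leb]_y (G x * v y) by rewrite RintegralZl// mulrC.
rewrite -RintegralB//.
apply: (le_trans (le_normr_Rintegral measurableT iD)).
have -> : a * (\int[leb]_y v y) + B * (\int[leb]_y `|G y|) + G x * \int[leb]_y (v y * \1_A y) =
    \int[leb]_y (a * v y + B * `|G (x - y)| + G x * (v y * \1_A y)).
  rewrite RintegralD// RintegralD// !RintegralZl//; last exact: integrable_norm iGs.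
  rewrite (@Rintegral_rV_subl R n x (fun y => `|G y|))//.
  exact: (measurableT_comp (@normr_measurable _ setT) mG).
apply: le_Rintegral => //; exact: integrable_norm iD.
Qed.

Lemma dotv_sub_near (x y : 'rV[R]_n) (d : R) : 0 < d <= 1 ->
  dotv y y <= d ^+ 2 * dotv x x -> `|dotv (x - y) (x - y) - dotv x x| <= 3 * d * dotv x x.
Proof.
move=> /andP[d0 d1] yx.
have E : dotv (x - y) (x - y) - dotv x x = dotv y y - 2 * dotv x y.
  by rewrite /dotv mulr_sumr -!sumrB; apply: eq_bigr => i _; rewrite !mxE; ring.
have V0 := dotv_ge0 x; have W0 := dotv_ge0 y.
have Ep : dotv (d *: x + y) (d *: x + y) = d ^+ 2 * dotv x x + 2 * d * dotv x y + dotv y y.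
  by rewrite /dotv !mulr_sumr -!big_split/=; apply: eq_bigr => i _; rewrite !mxE; ring.
have Em : dotv (d *: x - y) (d *: x - y) = d ^+ 2 * dotv x x - 2 * d * dotv x y + dotv y y.
  by rewrite /dotv !mulr_sumr -sumrB -!big_split/=; apply: eq_bigr => i _; rewrite !mxE; ring.
have hp := dotv_ge0 (d *: x + y); have hm := dotv_ge0 (d *: x - y).
rewrite Ep in hp; rewrite Em in hm.
set V := dotv x x in V0 yx hp hm *; set W := dotv y y in W0 yx hp hm *.
set P := dotv x y in hp hm *.
have b1 : `|P| <= d * V.
  rewrite -(ler_pM2l (_ : 0 < 2 * d)) ?mulr_gt0// -{1}(ger0_norm (ltW (_ : 0 < 2 * d))) ?mulr_gt0// -normrM.
  by rewrite ler_norml; apply/andP; split; nra.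
rewrite E (le_trans (ler_normB _ _))// normrM (ger0_norm W0) ger0_norm//.
have : d ^+ 2 * V <= d * V by rewrite ler_wpM2r// expr2 ler_piMl// ltW.
by move: b1 yx; rewrite -/V -/W -/P; lra.
Qed.

Lemma tail_cvg (v : 'rV[R]_n -> R) (eta : R) : leb.-integrable setT (EFin \o v) ->
  (forall y, 0 <= v y) -> 0 < eta -> exists2 r : R, 0 < r & forall c, r <= c ->
  \int[leb]_y (v y * \1_[set y | c < dotv y y] y) <= eta.
Proof.
move=> iv v0 eta0.
have mS c : measurable [set y : 'rV[R]_n | c < dotv y y] by exact: measurable_dotv_gt.
have mv : measurable_fun setT v by have /integrableP[/measurable_EFinP] := iv.
have mvS c : measurable_fun setT (fun y => v y * \1_[set y | c < dotv y y] y).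
  by apply: measurable_funM => //; exact: measurable_indic.
have vS c y : `|v y * \1_[set y | c < dotv y y] y| <= v y.
  rewrite normrM (ger0_norm (v0 y)) ler_piMr// indicE.
  by case: (_ \in _); rewrite ?normr1 ?normr0.
have iS c : leb.-integrable setT (EFin \o (fun y => v y * \1_[set y | c < dotv y y] y)).
  by apply: (Rle_integrable _ _ _ iv).
have [|||||_] := @Rdominated_cvg _ _ _ leb setT
   (fun m y => v y * \1_[set y | m%:R < dotv y y] y) (fun=> 0) v.
- exact: measurableT.
- by move=> m; exact: mvS.
- move=> y _; apply: cvg_near_cst; exists (Num.truncn (dotv y y)).+1 => // m /= ym.
  rewrite indicE memNset ?mulr0//=; apply/negP; rewrite -leNgt ltW//.
  by rewrite (lt_le_trans (truncnS_gt _))// ler_nat.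
- exact: iv.
- by move=> m y _; exact: vS.
rewrite Rintegral_cst// mul0r => /cvgrPdist_le/(_ _ eta0)[m _ Hm].
exists m.+1%:R => // c mc.
have := Hm m (leqnn m); rewrite /= sub0r normrN => /(le_trans (ler_norm _)); apply: le_trans.
apply: le_Rintegral => //.
move=> y _; rewrite ler_wpM2l// !indicE.
have [yc|] := boolP (y \in [set y | c < dotv y y]); last by rewrite ler0n.
rewrite mem_set//=; move: yc; rewrite inE/=; apply: le_lt_trans.
by rewrite (le_trans _ mc)// ler_nat.
Qed.

End mild_estimate.

(** * The fundamental solution *)

Section fundamental.
Variables (R : realType) (N : nat) (alpha s : R).
Notation leb := (lebesgue_rV R N).
Variable Z : 'rV[R]_N -> R -> R.
Hypothesis N1 : (0 < N)%N.
Hypothesis alpha01 : 0 < alpha < 1.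
Hypothesis s01 : 0 < s < 1.
Hypothesis Zfs : fundamental_solution alpha s Z.

Let s0 : 0 < s. Proof. by case/andP: s01. Qed.

(** The Fourier transform of Z(., 1) at k is [symb] (|k|^2). *)
Definition symb (l : R) : R := mittag_leffler alpha (- (l `^ s)).

Lemma cm_symb : cm symb.
Proof. exact: (cm_comp_bern (cm_mittag_leffler alpha01) (bern_powR s01)). Qed.

Lemma symb0 : symb 0 = 1.
Proof. by rewrite /symb powR0 ?gt_eqF// oppr0 (mittag_leffler0 alpha01). Qed.

Lemma symb_bounds l : 0 <= l -> 0 <= symb l <= 1.
Proof. by move=> l0; have := cm_bounds cm_symb l0; rewrite symb0. Qed.

Lemma symb_near0 : exists c C l0 : R, [/\ 0 < c, 0 < C, 0 < l0,
  forall l, 0 <= l <= l0 -> c * l `^ s <= 1 - symb l &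
  forall l, 0 <= l -> 1 - symb l <= C * l `^ s].
Proof.
have [c [C [z0 [c0 C0 z00 Hlow Hup]]]] := onem_mittag_leffler alpha01.
exists c, C, (z0 `^ (s^-1)); split => //; first by rewrite powR_gt0.
- move=> l /andP[l0 lz]; apply: Hlow; rewrite powR_ge0/=.
  have -> : z0 = (z0 `^ (s^-1)) `^ s by rewrite -powRrM mulVf ?gt_eqF// powRr1// ltW.
  by rewrite ge0_ler_powR ?(ltW s0)// nnegrE ?powR_ge0.
- by move=> l l0; apply: Hup; exact: powR_ge0.
Qed.

Lemma enorm_powR (k : 'rV[R]_N) : enorm k `^ (2 * s) = dotv k k `^ s.
Proof. by rewrite /enorm -powR12_sqrt ?dotv_ge0// -powRrM mulrA mulVf// mul1r. Qed.

Lemma Z_fourier t k : 0 < t ->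
  \int[leb]_x (cos (dotv k x) * Z x t) = mittag_leffler alpha (- (dotv k k `^ s * t `^ alpha)) /\
  \int[leb]_x (sin (dotv k x) * Z x t) = 0.
Proof.
move=> t0; have := fs_fourier Zfs k t0; rewrite /fourier enorm_powR.
by case=> -> /eqP; rewrite oppr_eq0 => /eqP ->.
Qed.

Lemma Z_cos1 k : \int[leb]_x (cos (dotv k x) * Z x 1) = symb (dotv k k).
Proof. by have [-> _] := Z_fourier k ltr01; rewrite powR1 mulr1. Qed.

Lemma Z_mass t : 0 < t -> \int[leb]_x Z x t = 1.
Proof.
move=> t0; have [+ _] := Z_fourier 0 t0.
rewrite dotv0l powR0 ?gt_eqF// mul0r oppr0 (mittag_leffler0 alpha01) => <-.
by apply: eq_Rintegral => x _; rewrite dotv0l cos0 mul1r.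
Qed.

Lemma Z_profile : [/\ forall x : 'rV[R]_N, x != 0 -> 0 < Z x 1,
  forall x : 'rV[R]_N, x != 0 -> {for x, continuous (Z ^~ 1)} &
  forall x t, x != 0 -> 0 < t -> Z x t = t `^ (- (alpha * N%:R / (2 * s))) *
    Z (t `^ (- (alpha / (2 * s))) *: x) 1].
Proof.
have [F [Fs F0 _ FE]] := fs_profile Zfs.
have ZF x : x != 0 -> Z x 1 = F x.
  by move=> x0; rewrite FE// !powR1 mul1r scale1r.
split.
- by move=> x x0; rewrite ZF// F0.
- move=> x x0; have [cF _] := Fs 0%N; have H := cF x x0.
  suff : (Z ^~ 1) y @[y --> x] --> F x by rewrite -(ZF x x0).
  have nx : 0 < `|x| by rewrite normr_gt0.
  apply: cvg_trans H; apply: near_eq_cvg; first exact: nbhs_filter.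
  apply: filterS (nbhsx_ballx x _ nx) => y /= xy; rewrite ZF//.
  apply/negP => /eqP y0; move: xy.
  by rewrite -ball_normE /ball_/= y0 subr0 ltxx.
- move=> x t x0 t0; rewrite FE// ZF// scaler_eq0 negb_or x0 andbT.
  by rewrite gt_eqF// powR_gt0.
Qed.

Lemma Z_gt0 x t : x != 0 -> 0 < t -> 0 < Z x t.
Proof.
move=> x0 t0; have [Z1 _ ZE] := Z_profile.
rewrite ZE// mulr_gt0 ?powR_gt0// Z1// scaler_eq0 negb_or x0 andbT.
by rewrite gt_eqF// powR_gt0.
Qed.

Lemma lebesgue_rV_set0 : leb [set 0] = 0%E.
Proof.
have -> : [set 0] = [set v : 'rV[R]_N | forall i, [set 0 : R] (v ord0 i)].
  apply/seteqP; split => v /=; first by move=> -> i; rewrite mxE.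
  by move=> v0; apply/rowP => i; rewrite mxE v0.
rewrite (@lebesgue_rV_box R N (fun=> [set 0])); last by move=> i; exact: measurable_set1.
by rewrite (bigD1 (Ordinal N1))//= lebesgue_measure_set1 mul0e.
Qed.

Lemma measurable_rV_set0 : measurable [set 0 : 'rV[R]_N].
Proof.
have -> : [set 0] = [set v : 'rV[R]_N | forall i, [set 0 : R] (v ord0 i)].
  apply/seteqP; split => v /=; first by move=> -> i; rewrite mxE.
  by move=> v0; apply/rowP => i; rewrite mxE v0.
by apply: (@measurable_rV_box R N (fun=> [set 0])) => i; exact: measurable_set1.
Qed.

Lemma Z_norm t : 0 < t -> \int[leb]_x `|Z x t| = 1.
Proof.
move=> t0; rewrite -(Z_mass t0) /Rintegral; congr fine.
have /measurable_int mZ := fs_integrable Zfs t0.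
apply: ae_eq_integral => //.
  apply/measurable_EFinP; apply: (measurableT_comp (@normr_measurable _ setT)).
  exact/measurable_EFinP.
exists [set 0]; split; [exact: measurable_rV_set0|exact: lebesgue_rV_set0|].
move=> x /= H; apply/eqP; apply: contra_notT H => x0 _.
by rewrite ger0_norm// ltW// Z_gt0.
Qed.

Lemma Z_radconv : radconv [set x | x != 0] (Z ^~ 1).
Proof.
have [_ cZ _] := Z_profile.
apply: (inversion_radconv (fs_integrable Zfs ltr01) Z_cos1 _ cm_symb cZ).
by move=> k; have [_] := Z_fourier k ltr01.
Qed.

Let p : R := N%:R / 2 + s.

Lemma Z_tail : exists C2 c2 V0 : R, [/\ 0 < C2, 0 < c2, 0 < V0,
  forall x, x != 0 -> Z x 1 <= C2 * dotv x x `^ (- p) &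
  forall x, V0 <= dotv x x -> c2 * dotv x x `^ (- p) <= Z x 1].
Proof.
have [Z1 _ _] := Z_profile; have [_ Zdec _] := Z_radconv.
have [c [C [l0 [c0 C0 l00 Hlow Hup]]]] := symb_near0.
have iZ := fs_integrable Zfs ltr01.
have gaussZ e : 0 < e ->
    Num.sqrt (pi / e) ^+ N * \int[leb]_x (Z x 1 * gauv ((4 * e)^-1) x) =
    \int[leb]_k (gauv e k * symb (dotv k k)).
  move=> e0; have := @inversion_fubini R N _ symb iZ Z_cos1 _ e 0 e0.
  rewrite /gauss_cosine => H.
  transitivity (Num.sqrt (pi / e) ^+ N * \int[leb]_x (Z x 1 * gauv (4 * e)^-1 (x - 0))).
    by congr (_ * _); apply: eq_Rintegral => x _; rewrite subr0.
  rewrite H; last by move=> k; have [_] := Z_fourier k ltr01.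
  by apply: eq_Rintegral => k _; rewrite dotvC dotv0l cos0 mul1r.
have mphi := @cm_measurable R N _ cm_symb.
have [C2 C20 HC2] := decay_upper_bound N1 s01 iZ Z1 Zdec (Z_mass ltr01) gaussZ mphi symb_bounds C0 Hup.
have [c2 [V0 [c20 V00 Hc2]]] := decay_lower_bound N1 s01 iZ Z1 Zdec (Z_mass ltr01) gaussZ mphi symb_bounds c0 C0 l00 Hlow Hup.
by exists C2, c2, V0.
Qed.

(** The self-similar form turns |x| >= nu t^(alpha/2s) into a fixed lower bound
    for the rescaled point, so that the constants are uniform in t. *)
Lemma Z_asymp (nu : R) : 0 < nu -> exists c K : R, [/\ 0 < c, 0 < K,
  forall t x, 0 < t -> nu * t `^ (alpha / (2 * s)) <= enorm x ->
    c * t `^ alpha * enorm x `^ (- (N%:R + 2 * s)) <= Z x t &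
  forall t x y d, 0 < t -> nu * t `^ (alpha / (2 * s)) <= enorm x ->
    0 < d <= 6^-1 -> dotv y y <= d ^+ 2 * dotv x x ->
    `|Z (x - y) t - Z x t| <= K * d * Z x t].
Proof.
move=> nu0; have [C2 [c2 [V0 [C20 c20 V00 Hup Hlow]]]] := Z_tail.
have [Z1 _ ZE] := Z_profile.
have p0 : 0 < p by rewrite addr_gt0// divr_gt0// ltr0n.
have V10 : 0 < nu ^+ 2 by rewrite exprn_gt0.
have [c3 c30 H3] := decay_lower_bound_from p0 Z_radconv c20 V00 V10 Hlow.
have [K K0 HK] := radconv_slow_variation p0 Z1 Z_radconv C20 c20 V00 V10 Hup Hlow.
have sc t (x : 'rV[R]_N) : 0 < t -> nu * t `^ (alpha / (2 * s)) <= enorm x ->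
    [/\ x != 0, t `^ (- (alpha / (2 * s))) *: x != 0 &
      nu ^+ 2 <= dotv (t `^ (- (alpha / (2 * s))) *: x) (t `^ (- (alpha / (2 * s))) *: x)].
  move=> t0 xt; have ta0 : 0 < t `^ (alpha / (2 * s)) by rewrite powR_gt0.
  have ex0 : 0 < enorm x by apply: lt_le_trans xt; rewrite mulr_gt0.
  have x0 : x != 0 by rewrite -dotv_gt0 -sqrtr_gt0.
  split => //; first by rewrite scaler_eq0 negb_or x0 andbT gt_eqF// powR_gt0.
  rewrite dotvZ -(sqr_sqrtr (dotv_ge0 x)) -/(enorm x) -exprMn lerXn2r ?nnegrE ?mulr_ge0 ?powR_ge0 ?(ltW nu0) ?(ltW ex0)//.
  by rewrite powRN mulrC ler_pdivlMr.
exists c3, (3 * K); split => //; first by rewrite mulr_gt0.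
- move=> t x t0 xt; have [x0 tx0 Vx] := sc _ _ t0 xt.
  rewrite (ZE _ _ x0 t0).
  apply: (@le_trans _ _ (t `^ (- (alpha * N%:R / (2 * s))) * (c3 *
      dotv (t `^ (- (alpha / (2 * s))) *: x) (t `^ (- (alpha / (2 * s))) *: x) `^ (- p)))); last first.
    by rewrite ler_wpM2l ?powR_ge0// H3.
  have dx : dotv x x = enorm x ^+ 2 by rewrite /enorm sqr_sqrtr// dotv_ge0.
  have en0 : 0 <= enorm x by exact: sqrtr_ge0.
  rewrite dotvZ dx powRM ?exprn_ge0 ?powR_ge0//.
  rewrite -!(powR_mulrn 2) ?powR_ge0// -!powRrM.
  have -> : 2 * (- p) = - (N%:R + 2 * s) by rewrite /p; field.
  rewrite le_eqVlt; apply/orP; left; apply/eqP.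
  have -> : t `^ alpha = t `^ (- (alpha * N%:R / (2 * s))) * t `^ (- (alpha / (2 * s)) * - (N%:R + 2 * s)).
    rewrite -powRD ?(gt_eqF t0) ?implybT//; congr (_ `^ _); field.
    by rewrite gt_eqF.
  ring.
- move=> t x y d t0 xt /andP[d0 d6] yx; have [x0 tx0 Vx] := sc _ _ t0 xt.
  set a := t `^ (- (alpha / (2 * s))) in tx0 Vx *.
  have a0 : 0 < a by rewrite powR_gt0.
  have d1 : 0 < d <= 1 by rewrite d0; lra.
  have near := dotv_sub_near d1 yx.
  have xp : 0 < dotv x x by rewrite dotv_gt0.
  have xy0 : x - y != 0.
    rewrite -dotv_gt0; move: near; rewrite ler_norml => /andP[h _].
    have : 3 * d * dotv x x <= 2^-1 * dotv x x by rewrite ler_wpM2r ?(ltW xp)//; lra.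
    by lra.
  rewrite (ZE _ _ x0 t0) (ZE _ _ xy0 t0) -/a -mulrBr normrM ger0_norm ?powR_ge0//.
  rewrite mulrCA ler_wpM2l ?powR_ge0//.
  have := HK (a *: x) (a *: (x - y)) (3 * d) Vx.
  rewrite !dotvZ -mulrBr normrM (ger0_norm (exprn_ge0 2 (ltW a0))) mulrCA.
  rewrite ler_wpM2l ?exprn_ge0 ?(ltW a0)// => /(_ _ isT).
  rewrite (_ : 3 * K * d = K * (3 * d)); last by ring.
  by apply; apply/andP; split; lra.
Qed.

End fundamental.

(** * Asymptotics of the mild solution *)

Section decay_class_representative.
Variables (R : realType) (n : nat).
Notation leb := (lebesgue_rV R n).

(** Changing the datum on a null set alters neither its mass nor the mild
    solution, and turns the almost everywhere hypotheses into pointwise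
    ones. *)
Lemma decay_class_representative (beta : R) (u : 'rV[R]_n -> R) :
  leb.-integrable setT (EFin \o u) -> {ae leb, forall x, 0 <= u x} ->
  decay_class beta u ->
  exists v : 'rV[R]_n -> R, [/\ leb.-integrable setT (EFin \o v),
    forall x, 0 <= v x, {ae leb, forall x, u x = v x} &
    exists C r : R, [/\ 0 < C, 0 < r &
      forall x, r < enorm x -> enorm x `^ beta * v x <= C]].
Proof.
move=> iu ae0 [C [r [C0 r0 aed]]].
have [E [mE E0 HE]] : leb.-negligible (~` [set x | 0 <= u x /\
    (r < enorm x -> enorm x `^ beta * `|u x| <= C)]).
  by apply: filterS2 ae0 aed => x u0 ux; split.
have mu : measurable_fun setT u by have /integrableP[/measurable_EFinP] := iu.
have good x : ~ E x -> 0 <= u x /\ (r < enorm x -> enorm x `^ beta * `|u x| <= C).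
  by move=> nE; apply: contrapT => h; apply: nE; exact: HE.
exists (fun x => u x * \1_(~` E) x); split.
- apply: (Rle_integrable (g := fun x => `|u x|)) => //.
  + apply: measurable_funM => //; apply: measurable_indic; exact: measurableC.
  + move=> x _; rewrite normrM ler_piMr// indicE.
    by case: (_ \in _); rewrite ?normr1 ?normr0.
  + exact: integrable_norm iu.
- move=> x; rewrite indicE; case: (boolP (x \in ~` E)) => [|_]; last by rewrite mulr0.
  by rewrite inE mulr1 => /good[].
- exists E; split => // x /= h; apply: contrapT => nE; apply: h.
  by rewrite indicE mem_set// mulr1.
exists C, r; split => // x rx; rewrite indicE.
case: (boolP (x \in ~` E)) => [|_]; last by rewrite !mulr0 ltW.
by rewrite inE => /good[u0 /(_ rx)]; rewrite mulr1 ger0_norm.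
Qed.

End decay_class_representative.

Section asymptotics.
Variables (R : realType) (N : nat) (alpha s beta : R).
Notation leb := (lebesgue_rV R N).
Variable Z : 'rV[R]_N -> R -> R.
Hypothesis N1 : (0 < N)%N.
Hypothesis alpha01 : 0 < alpha < 1.
Hypothesis s01 : 0 < s < 1.
Hypothesis beta_bounds : N%:R < beta < N%:R + 2 * s.
Hypothesis Zfs : fundamental_solution alpha s Z.

Let w : R := N%:R + 2 * s - beta.

Let a0 : 0 < alpha. Proof. by case/andP: alpha01. Qed.
Let s0 : 0 < s. Proof. by case/andP: s01. Qed.
Let w0 : 0 < w. Proof. by rewrite /w; case/andP: beta_bounds; lra. Qed.
Let b0 : 0 < beta. Proof. by case/andP: beta_bounds => + _; apply: le_lt_trans. Qed.

(** This is where the growth condition on [h] enters: writing w = N + 2s - beta,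
    it says that h(t)^w is small compared with t^alpha, and
    q^(- beta) = q^w q^(-N-2s). *)
Lemma window_powR (h : R -> R) (kappa : R) : (forall t, 0 < t -> 0 < h t) ->
  h t / t `^ (alpha / w) @[t --> +oo] --> 0 -> 0 < kappa ->
  \forall t \near +oo, forall q, 0 < q <= h t ->
    q `^ (- beta) <= kappa * (t `^ alpha * q `^ (- (N%:R + 2 * s))).
Proof.
move=> h0 hlim k0; have e0 : 0 < kappa `^ w^-1 by rewrite powR_gt0.
move/cvgrPdist_le/(_ _ e0) : hlim => H; near=> t => q /andP[q0 qh].
have t0 : 0 < t by near: t; exact: nbhs_pinfty_gt.
have : `|0 - h t / t `^ (alpha / w)| <= kappa `^ w^-1 by near: t.
have tp : 0 < t `^ (alpha / w) by rewrite powR_gt0.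
have ht0 : 0 <= h t / t `^ (alpha / w) by rewrite divr_ge0 ?(ltW tp)// ltW// h0.
rewrite sub0r normrN (ger0_norm ht0) ler_pdivrMr// => /(le_trans qh) qk.
have -> : - beta = w + - (N%:R + 2 * s) by rewrite /w; ring.
rewrite powRD ?(gt_eqF q0) ?implybT// mulrA ler_wpM2r ?powR_ge0//.
have -> : kappa * t `^ alpha = (kappa `^ w^-1 * t `^ (alpha / w)) `^ w.
  rewrite powRM ?powR_ge0// -!powRrM mulVf ?gt_eqF// powRr1 ?(ltW k0)//.
  by rewrite divfK// gt_eqF.
by rewrite ge0_ler_powR ?(ltW w0)// nnegrE ?(ltW q0)// mulr_ge0 ?powR_ge0.
Unshelve. all: by end_near.
Qed.

Lemma window_radius (nu X : R) : 0 < nu ->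
  \forall t \near +oo, X <= nu * t `^ (alpha / (2 * s)).
Proof.
move=> nu0; have p0 : 0 < alpha / (2 * s) by rewrite divr_gt0// mulr_gt0.
near=> t; rewrite -ler_pdivrMl//.
have -> : nu^-1 * X = X / nu by rewrite mulrC.
apply: (@le_trans _ _ (`|X / nu| `^ (alpha / (2 * s))^-1 `^ (alpha / (2 * s)))).
  by rewrite -powRrM mulVf ?gt_eqF// powRr1// ler_norm.
have lt : `|X / nu| `^ (alpha / (2 * s))^-1 <= t by near: t; exact: nbhs_pinfty_ge.
by rewrite ge0_ler_powR ?(ltW p0)// nnegrE ?powR_ge0// (le_trans _ lt)// powR_ge0.
Unshelve. all: by end_near.
Qed.

(** [mild_estimate] for |y| <= d |x| and |y| > d |x|: each of the three terms is
    at most a third of the allowed error, by the choice of d, by the decay of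
    the datum, and by its integrability, respectively. *)
Lemma mild_solution_asymp (v : 'rV[R]_N -> R) (nu : R) (h : R -> R) (C r eps : R) :
  leb.-integrable setT (EFin \o v) -> (forall y, 0 <= v y) ->
  0 < \int[leb]_y v y -> 0 < C ->
  (forall y, r < enorm y -> enorm y `^ beta * v y <= C) ->
  0 < nu -> (forall t, 0 < t -> 0 < h t) ->
  h t / t `^ (alpha / w) @[t --> +oo] --> 0 -> 0 < eps ->
  \forall t \near +oo, forall x,
    nu * t `^ (alpha / (2 * s)) <= enorm x -> enorm x <= h t ->
    `|mild_solution Z v x t - (\int[leb]_y v y) * Z x t| <=
      eps * ((\int[leb]_y v y) * Z x t).
Proof.
move=> iv v0 M0 C0 dec nu0 h0 hlim eps0.
set M := \int[leb]_y v y in M0 *.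
have [c [K [c0 K0 Zlow Zslow]]] := Z_asymp N1 alpha01 s01 Zfs nu0.
have e30 : 0 < eps / 3 by rewrite divr_gt0.
(* 1/6 is the largest ratio allowed in the slow variation estimate *)
pose d := Num.min 6^-1 (eps / 3 / K).
have d0 : 0 < d by rewrite lt_min invr_gt0 ltr0n divr_gt0.
have d6 : d <= 6^-1 by rewrite ge_min lexx.
have Kd : K * d <= eps / 3 by rewrite mulrC -ler_pdivlMr// ge_min lexx orbT.
have [r' r'0 tl] := tail_cvg iv v0 (mulr_gt0 e30 M0).
have k0 : 0 < eps / 3 * M * c * d `^ beta / C.
  by rewrite divr_gt0// !mulr_gt0// powR_gt0.
have win := window_powR h0 hlim k0.
have rad := window_radius ((`|r| + r' + 1) / d) nu0.
near=> t => x xnu xh.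
have t0 : 0 < t by near: t; exact: nbhs_pinfty_gt.
have ta : 0 < t `^ (alpha / (2 * s)) by rewrite powR_gt0.
set q := enorm x in xnu xh *.
have q0 : 0 < q by apply: lt_le_trans xnu; rewrite mulr_gt0.
have x0 : x != 0 by rewrite -dotv_gt0 -sqrtr_gt0.
have Z0 : 0 < Z x t by exact: (Z_gt0 Zfs).
have qd : `|r| + r' + 1 <= d * q.
  rewrite mulrC -ler_pdivrMr// (le_trans _ xnu)//.
  by near: t.
have rq : r <= d * q by rewrite (le_trans _ qd)//; have := ler_norm r; lra.
have r'q : r' <= (d * q) ^+ 2.
  have : r' + 1 <= d * q by rewrite (le_trans _ qd)//; have := normr_ge0 r; lra.
  by move: r'0; set z := d * q; nra.
have dx : dotv x x = q ^+ 2 by rewrite /q /enorm sqr_sqrtr// dotv_ge0.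
have dq0 : 0 < d * q by rewrite mulr_gt0.
have sq (y : 'rV[R]_N) : dotv y y = enorm y ^+ 2 by rewrite /enorm sqr_sqrtr// dotv_ge0.
pose A := [set y : 'rV[R]_N | (d * q) ^+ 2 < dotv y y].
have mA : measurable A by exact: measurable_dotv_gt.
pose B := C * (d * q) `^ (- beta).
have Kd0 : 0 <= K * d * Z x t by rewrite !mulr_ge0// ltW.
have B0 : 0 <= B by rewrite mulr_ge0 ?powR_ge0// ltW.
have nearE y : ~ A y -> `|Z (x - y) t - Z x t| <= K * d * Z x t.
  move=> /negP; rewrite -leNgt exprMn -dx => yx.
  by apply: Zslow => //; rewrite d0.
have farE y : A y -> v y <= B.
  rewrite /A/= sq ltr_pXn2r ?nnegrE ?(ltW dq0) ?sqrtr_ge0// => yq.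
  have ey0 : 0 < enorm y by exact: lt_trans yq.
  rewrite /B powRN ler_pdivlMr ?powR_gt0//.
  apply: le_trans (dec y (le_lt_trans rq yq)); rewrite mulrC ler_wpM2r//.
  by rewrite ge0_ler_powR ?(ltW b0)// ?nnegrE ?ltW.
have iG : leb.-integrable setT (EFin \o (fun y => Z y t)) by exact: (fs_integrable Zfs t0).
apply: (le_trans (mild_estimate mA iG iv v0 Kd0 B0 (ltW Z0) nearE farE)).
rewrite (Z_norm N1 alpha01 s01 Zfs t0) mulr1 -/M.
have e1 : K * d * Z x t * M <= eps / 3 * (M * Z x t).
  by rewrite -mulrA (mulrC M) ler_wpM2r// mulr_ge0// ltW.
have e2 : B <= eps / 3 * (M * Z x t).
  apply: (@le_trans _ _ (eps / 3 * M * (c * t `^ alpha * q `^ (- (N%:R + 2 * s))))); last first.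
    by rewrite [leRHS]mulrA ler_wpM2l ?Zlow// mulr_ge0// ltW.
  rewrite /B powRM ?(ltW d0) ?(ltW q0)//.
  have qh : 0 < q <= h t by rewrite q0.
  have : q `^ (- beta) <= eps / 3 * M * c * d `^ beta / C * (t `^ alpha * q `^ (- (N%:R + 2 * s))).
    by move: q qh {xnu xh q0 qd rq r'q dx dq0 A mA B B0 nearE farE}; near: t.
  have Cd0 : 0 <= C * d `^ (- beta) by rewrite mulr_ge0 ?powR_ge0// ltW.
  move/(ler_wpM2l Cd0); rewrite -!mulrA => /le_trans; apply.
  rewrite le_eqVlt; apply/orP; left; apply/eqP.
  rewrite powRN; field; rewrite (gt_eqF C0)/=.
  by rewrite gt_eqF// powR_gt0.
have e3 : Z x t * (\int[leb]_y (v y * \1_A y)) <= eps / 3 * (M * Z x t).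
  by rewrite mulrA (mulrC _ (Z x t)) ler_wpM2l ?(ltW Z0)// tl.
by lra.
Unshelve. all: by end_near.
Qed.

End asymptotics.

Theorem theorem3p2 (R : realType) (N : nat) (alpha s beta : R)
    (Z : 'rV[R]_N -> R -> R) (u0 : 'rV[R]_N -> R) (nu : R) (h : R -> R)
    (N_ge1 : (1 <= N)%N)
    (alpha01 : 0 < alpha < 1) (s01 : 0 < s < 1)
    (beta_bounds : N%:R < beta < N%:R + 2 * s)
    (Z_fs : fundamental_solution alpha s Z)
    (u0_L1 : (lebesgue_rV R N).-integrable setT (EFin \o u0))
    (u0_ge0 : {ae lebesgue_rV R N, forall x, 0 <= u0 x})
    (u0_nontrivial : ~ {ae lebesgue_rV R N, forall x, u0 x = 0})
    (u0_decay : decay_class beta u0)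
    (nu_gt0 : 0 < nu)
    (h_gt0 : forall t : R, 0 < t -> 0 < h t)
    (h_little_o :
      h t / t `^ (alpha / (N%:R + 2 * s - beta)) @[t --> +oo] --> 0) :
  let M := \int[lebesgue_rV R N]_x u0 x in
  let u := mild_solution Z u0 in
  forall eps : R, 0 < eps ->
  exists2 T : R, 0 < T &
    forall (t : R) (x : 'rV[R]_N), T <= t ->
      nu * t `^ (alpha / (2 * s)) <= enorm x -> enorm x <= h t ->
      `|u x t / (M * Z x t) - 1| <= eps.
Proof.
move=> M u eps eps0.
have [v [iv v0 uv [C [r [C0 r0 dec]]]]] := decay_class_representative u0_L1 u0_ge0 u0_decay.
have mu : measurable_fun setT u0 by have /integrableP[/measurable_EFinP] := u0_L1.
have mv : measurable_fun setT v by have /integrableP[/measurable_EFinP] := iv.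
have ME : M = \int[lebesgue_rV R N]_x v x.
  rewrite /M /Rintegral; congr fine; apply: ae_eq_integral => //.
  - exact/measurable_EFinP.
  - exact/measurable_EFinP.
  - by apply: filterS uv => x /= -> _.
have uE t x : 0 < t -> u x t = mild_solution Z v x t.
  move=> t0; rewrite /u /mild_solution /Rintegral; congr fine.
  have mZ : measurable_fun setT (fun y : 'rV[R]_N => Z (x - y) t).
    by have /integrableP[/measurable_EFinP] := integrable_rV_subl x (fs_integrable Z_fs t0).
  apply: ae_eq_integral => //.
  - by apply/measurable_EFinP; apply: measurable_funM.
  - by apply/measurable_EFinP; apply: measurable_funM.
  - by apply: filterS uv => y /= -> _.
have M0 : 0 < M.
  have Mge : 0 <= M by rewrite ME; apply: Rintegral_ge0.
  rewrite lt_def Mge andbT; apply/eqP => M00; apply: u0_nontrivial.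
  have : (\int[lebesgue_rV R N]_x `|(EFin \o v) x| = 0)%E.
    rewrite -[RHS]/(0%:E) -M00 ME /Rintegral fineK; last exact: integrable_fin_num.
    by apply: eq_integral => x _ /=; rewrite ger0_norm.
  have mEv : measurable_fun setT (EFin \o v) by exact/measurable_EFinP.
  move/(ae_eq_integral_abs _ measurableT mEv) => ae0.
  by apply: filterS2 uv ae0 => x /= -> /(_ I)[].
have [T0 [_ HT]] := mild_solution_asymp N_ge1 alpha01 s01 beta_bounds Z_fs iv v0
  (eq_ind _ (fun m => 0 < m) M0 _ ME) C0 dec nu_gt0 h_gt0 h_little_o eps0.
(* shifted to be positive and beyond T0 *)
exists (`|T0| + 1); first by rewrite ltr_pwDr.
move=> t x Tt xnu xh.
have t0 : 0 < t by rewrite (lt_le_trans _ Tt)// ltr_pwDr.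
have x0 : x != 0.
  by rewrite -dotv_gt0 -sqrtr_gt0; apply: lt_le_trans xnu; rewrite mulr_gt0 ?powR_gt0.
have MZ : 0 < M * Z x t by rewrite mulr_gt0// (Z_gt0 Z_fs).
have Tt' : T0 < t by rewrite (lt_le_trans _ Tt)// (le_lt_trans (ler_norm _))// ltrDl.
have := HT t Tt' x xnu xh; rewrite -ME -uE//.
have -> : u x t / (M * Z x t) - 1 =
    (u x t - M * Z x t) / (M * Z x t).
  by rewrite mulrBl divff// gt_eqF.
by rewrite normf_div (ger0_norm (ltW MZ)) ler_pdivrMr.
Qed.
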